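(* Let $c\geq 1$ and let $p$ be a prime with $p>c$. Let $\mathbb{G}_{c,p}$ be the Fraïssé limit of $\mathbb{K}^P_{c,p}$ and let $\mathbb{G}_{c,\mathbb{Q}}$ be the Fraïssé limit of $\mathbb{K}^P_{c,\mathbb{Q}}$. Then: (1) The reduct of $\mathbb{G}_{c,p}$ to the language of groups is the generic $c$-nilpotent group of exponent $p$, i.e. it is generic for the class $\mathbb{K}_{c,p}$. (2) The reduct of $\mathbb{G}_{c,\mathbb{Q}}$ to the language of $\mathbb{Q}$-powered groups is the generic $\mathbb{Q}$-powered $c$-nilpotent group, i.e. it is generic for the class $\mathbb{K}_{c,\mathbb{Q}}$. (3) The reduct of $\mathbb{G}_{c,\mathbb{Q}}$ to the language of groups is the generic torsion-free $c$-nilpotent group, i.e. it is generic for the class $\mathbb{K}_{c,\mathrm{tf}}$.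
   Context: Languages: the language of groups has symbols for multiplication, inverse and identity. A group $G$ is $\mathbb{Q}$-powered if it is torsion-free and for every $g\in G$ and $n\geq 2$ the equation $x^n=g$ has a unique solution in $G$. The language of $\mathbb{Q}$-powered groups is the language of groups together with a unary function symbol $\sqrt[n]{-}$ for each $n\geq 2$, interpreted as $n$-th root. ''$c$-nilpotent'' means nilpotent of class at most $c$; ''exponent $p$'' means $g^p=1$ for all $g$. Lazard series: a Lazard series (of length $c$) of a group $G$ is a chain of subgroups $G=P_1\geq P_2\geq\cdots\geq P_{c+1}=1$ with $[P_i,P_j]\leq P_{i+j}$ for all $i,j$ (where $P_k=1$ for $k>c$). Classes: - $\mathbb{K}_{c,p}$: finite (equivalently, finitely generated) groups of exponent $p$ and nilpotency class at most $c$, in the language of groups. - $\mathbb{K}^P_{c,p}$: the same groups, each equipped with an arbitrary Lazard series named by additional unary predicates $P_1,\ldots,P_{c+1}$. - $\mathbb{K}_{c,\mathbb{Q}}$: $\mathbb{Q}$-powered groups of nilpotency class at most $c$ that are finitely generated as $\mathbb{Q}$-powered groups, in the language of $\mathbb{Q}$-powered groups. - $\mathbb{K}^P_{c,\mathbb{Q}}$: the same structures, each equipped with an arbitrary Lazard series consisting of $\mathbb{Q}$-powered subgroups, named by additional unary predicates $P_1,\ldots,P_{c+1}$. - $\mathbb{K}_{c,\mathrm{tf}}$: finitely generated torsion-free groups of nilpotency class at most $c$, in the language of groups. The classes $\mathbb{K}^P_{c,p}$ and $\mathbb{K}^P_{c,\mathbb{Q}}$ are Fraïssé classes, so their Fraïssé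 limits exist. Genericity: let $\mathbb{K}$ be a class of finitely generated $L$-structures which is countable up to isomorphism, hereditary, has the joint embedding property, and is unbounded (each $A\in\mathbb{K}$ is properly contained in some $B\in\mathbb{K}$). Let $\mathbb{S}$ be the set of $L$-structures $M$ with underlying set $\omega$ that are not finitely generated and such that every finitely generated substructure of $M$ is isomorphic to a member of $\mathbb{K}$. For each finitely generated $L$-structure $B$ with $\mathrm{dom}(B)\subseteq\omega$ isomorphic to a member of $\mathbb{K}$, let $\mathcal{O}_B\subseteq\mathbb{S}$ be the set of $M\in\mathbb{S}$ such that $B$ is a substructure of $M$. The sets $\mathcal{O}_B$ form a basis of open sets of the topology on $\mathbb{S}$. A structure $M\in\mathbb{S}$ is generic for $\mathbb{K}$ if $\{N\in\mathbb{S}: N\cong M\}$ is comeager in $\mathbb{S}$; a countably infinite $L$-structure is called generic for $\mathbb{K}$ if it is isomorphic to a generic element of $\mathbb{S}$. If $\mathbb{K}$ is the class of finitely generated $X$'s, such a structure is called ''the generic $X$''. *)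

(* Defs.v *)
From HB Require Import structures.
From mathcomp Require Import all_boot.
From mathcomp Require Import boolp classical_sets functions cardinality.
From mathcomp Require Import topology borel_hierarchy.

Set Implicit Arguments.
Unset Strict Implicit.
Unset Printing Implicit Defensive.

Local Open Scope classical_set_scope.

(* Symbols are indexed by their arity. *)
Record language := Language {
  fun_sym : nat -> Type;
  rel_sym : nat -> Type }.

Record interp (L : language) (T : Type) := Interp {
  fun_interp : forall n, fun_sym L n -> n.-tuple T -> T;
  rel_interp : forall n, rel_sym L n -> n.-tuple T -> Prop }.

Record structure (L : language) := Structure {
  dom :> Type;
  str :> interp L dom }.

Definition is_embedding (L : language) (M N : structure L) (f : M -> N) :=
  [/\ injective f,
      forall n (F : fun_sym L n) (t : n.-tuple M),
        f (fun_interp M F t) = fun_interp N F (map_tuple f t)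
    & forall n (R : rel_sym L n) (t : n.-tuple M),
        rel_interp M R t <-> rel_interp N R (map_tuple f t)].

Definition is_isomorphism (L : language) (M N : structure L) (f : M -> N) :=
  is_embedding f /\ bijective f.

Definition embeds (L : language) (M N : structure L) :=
  exists f : M -> N, is_embedding f.

Definition isomorphic (L : language) (M N : structure L) :=
  exists f : M -> N, is_isomorphism f.

Definition fun_closed (L : language) (M : structure L) (X : set M) :=
  forall n (F : fun_sym L n) (t : n.-tuple M),
    (forall i, X (tnth t i)) -> X (fun_interp M F t).

Record substructure (L : language) (M : structure L) := Substructure {
  sub_set : set M;
  sub_closed : fun_closed sub_set }.

Lemma sval_inj (T : Type) (P : T -> Prop) : injective (@sval T P).
Proof. by move=> [x Px] [y Py] /= xy; exact: eq_exist. Qed.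

Lemma sval_tnth (T : Type) (X : set T) n (t : n.-tuple {x | X x}) i :
  X (tnth (map_tuple sval t) i).
Proof. by rewrite tnth_map; exact: svalP. Qed.

Definition sub_interp (L : language) (M : structure L) (X : substructure M) :
    interp L {x | sub_set X x} :=
  Interp
    (fun n (F : fun_sym L n) (t : n.-tuple {x | sub_set X x}) =>
       exist (sub_set X) (fun_interp M F (map_tuple sval t))
         (sub_closed (t := map_tuple sval t) F (sval_tnth t)))
    (fun n (R : rel_sym L n) t => rel_interp M R (map_tuple sval t)).

Definition sub_str (L : language) (M : structure L) (X : substructure M) :
  structure L := Structure (sub_interp X).

Definition generated (L : language) (M : structure L) (A : set M) : set M :=
  smallest (@fun_closed L M) A.

Definition finitely_generated (L : language) (M : structure L) :=
  exists2 A : set M, finite_set A & generated A = setT.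

Section Classes.
Variables (L : language) (K : structure L -> Prop).

Definition iso_member (M : structure L) := exists2 A, K A & isomorphic A M.

Definition fg_subs_in (M : structure L) :=
  forall X : substructure M, finitely_generated (sub_str X) ->
    iso_member (sub_str X).

Definition ultrahomogeneous (M : structure L) :=
  forall (X Y : substructure M) (f : sub_str X -> sub_str Y),
    finitely_generated (sub_str X) -> is_isomorphism f ->
    exists2 g : M -> M, is_isomorphism g & forall x, g (sval x) = sval (f x).

Definition fraisse_limit (M : structure L) :=
  [/\ countable [set: M],
      forall A, K A -> embeds A M,
      fg_subs_in M
    & ultrahomogeneous M].

Definition countable_up_to_iso :=
  exists A : nat -> structure L, forall B, K B -> exists n, isomorphic (A n) B.

Definition hereditary := forall A, K A -> fg_subs_in A.

Definition joint_embedding := forall A B, K A -> K B ->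
  exists C, [/\ K C, embeds A C & embeds B C].

Definition unbounded := forall A, K A ->
  exists (B : structure L) (f : A -> B), [/\ K B, is_embedding f & range f <> setT].

Definition genericity_class :=
  [/\ forall A, K A -> finitely_generated A,
      countable_up_to_iso, hereditary, joint_embedding & unbounded].

Definition str_space := {I : interp L nat |
  ~ finitely_generated (Structure I) /\ fg_subs_in (Structure I)}.

Definition str_of (M : str_space) : structure L := Structure (sval M).

Definition cylinder (D : set nat) (B : interp L {x | D x}) : set str_space :=
  [set M | @is_embedding L (Structure B) (str_of M) sval].

Definition basic_open (O : set str_space) :=
  exists (D : set nat) (B : interp L {x | D x}),
    [/\ finitely_generated (Structure B), iso_member (Structure B)
      & O = cylinder B].

Definition str_open (U : set str_space) :=
  forall M, U M -> exists O, [/\ basic_open O, O M & O `<=` U].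

End Classes.
Arguments cylinder {L} K {D} B.

Section GeneratedSubstructure.
Variables (L : language) (M : structure L).

Lemma generated_closed (A : set M) : fun_closed (generated A).
Proof.
move=> n F t tA X [/= cX AX]; apply: (cX) => i.
exact: (tA i X (conj cX AX)).
Qed.

Definition gen_sub (A : set M) := Substructure (@generated_closed A).

Lemma gen_sub_fg (A : set M) :
  finite_set A -> finitely_generated (sub_str (gen_sub A)).
Proof.
move=> finA; exists (sval @^-1` A).
  apply: finite_preimage => // x y _ _.
  exact: sval_inj.
apply/seteqP; split=> // -[x xA] _ X [/= cX AX].
pose Y : set M := [set y | exists yA : generated A y, X (exist _ y yA)].
have [xA' Xx] : Y x.
  apply: xA; split=> [n F t tY|y Ay] /=.
    have tA i : generated A (tnth t i) by have [] := tY i.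
    pose u : n.-tuple {y | generated A y} :=
      [tuple exist _ (tnth t i) (tA i) | i < n].
    have tu : map_tuple sval u = t.
      by apply: eq_from_tnth => i; rewrite tnth_map tnth_mktuple.
    have Xu : X (fun_interp (sub_str (gen_sub A)) F u).
      apply: cX => i; rewrite tnth_mktuple.
      by have [yA Xy] := tY i; rewrite (Prop_irrelevance (tA i) yA).
    exists (generated_closed F tA).
    by congr X : Xu; apply: eq_exist; rewrite /= tu.
  have yA : generated A y by move=> Z [_]; apply.
  by exists yA; exact: AX.
by rewrite (Prop_irrelevance xA xA').
Qed.

End GeneratedSubstructure.

Section StrSpaceTopology.
Variables (L : language) (K : structure L -> Prop).
Local Notation S := (str_space K).

Lemma gen_sub_cylinder (M : S) (A : set nat) : finite_set A ->
  let D := generated (M := str_of M) A in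
  exists B : interp L {x | D x}, basic_open (cylinder K B) /\ cylinder K B M.
Proof.
move=> finA D; pose B := sub_interp (@gen_sub L (str_of M) A).
have fgB : finitely_generated (Structure B) by exact: gen_sub_fg.
exists B; split.
  exists D, B; split=> //.
  have [_ MK] := svalP M.
  exact: (MK (@gen_sub L (str_of M) A)).
by split=> //; exact: sval_inj.
Qed.

Lemma sub_cylinder (M : S) (D E : set nat)
    (B : interp L {x | D x}) (C : interp L {x | E x}) :
  D `<=` E -> cylinder K B M -> cylinder K C M ->
  cylinder K C `<=` cylinder K B.
Proof.
move=> DE [_ BMf BMr] [_ CMf CMr] N [_ CNf CNr].
pose j (x : {x | D x}) : {x | E x} := exist _ (sval x) (DE _ (svalP x)).
have jK n (t : n.-tuple {x | D x}) :
    map_tuple sval (map_tuple j t) = map_tuple sval t.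
  by apply: eq_from_tnth => i; rewrite !tnth_map.
split=> [|n F t|n R t]; first exact: sval_inj.
  rewrite BMf -[in RHS]jK -[in LHS]jK.
  have <- := CNf n F (map_tuple j t).
  by have <- := CMf n F (map_tuple j t).
have := BMr n R t; rewrite /= -!jK.
have := CMr n R (map_tuple j t); have := CNr n R (map_tuple j t).
rewrite /=; tauto.
Qed.

Lemma str_openT : @str_open L K setT.
Proof.
move=> M _; have [B [oB BM]] := @gen_sub_cylinder M set0 (finite_set0 _).
by exists (cylinder K B).
Qed.

Lemma cylinder_gens (M : S) (D : set nat) (B : interp L {x | D x}) :
  finitely_generated (Structure B) -> cylinder K B M ->
  exists2 A : set nat, finite_set A & D `<=` generated (M := str_of M) A.
Proof.
move=> [A finA genA] [_ BMf _]; exists (sval @` A).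
  exact: finite_image.
move=> x Dx Y [cY AY].
have : generated (M := Structure B) A (exist _ x Dx) by rewrite genA.
move=> /(_ (fun y => Y (sval y))); apply; split=> [n F t tY|y Ay].
  rewrite BMf; apply: cY => i.
  by rewrite tnth_map; exact: tY.
by apply: AY; exists y.
Qed.

Lemma str_openI : setI_closed (@str_open L K).
Proof.
move=> U V oU oV M [UM VM].
have [_ [[D [B [fgB _ ->]]] BM BU]] := oU M UM.
have [_ [[E [C [fgC _ ->]]] CM CV]] := oV M VM.
have [A1 fA1 DA1] := cylinder_gens fgB BM.
have [A2 fA2 EA2] := cylinder_gens fgC CM.
have [|I [oI IM]] := @gen_sub_cylinder M (A1 `|` A2).
  by rewrite finite_setU.
have genS (A A' : set nat) : A `<=` A' ->
    generated (M := str_of M) A `<=` generated (M := str_of M) A'.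
  by move=> AA' x xA Y [cY AY]; apply: xA; split=> // y /AA' /AY.
exists (cylinder K I); split=> // N IN; split.
  by apply/BU/(sub_cylinder _ BM IM) => // x /DA1; apply: genS => y; left.
by apply/CV/(sub_cylinder _ CM IM) => // x /EA2; apply: genS => y; right.
Qed.

Lemma str_open_bigU (I : Type) (f : I -> set S) :
  (forall i, str_open (f i)) -> str_open (\bigcup_i f i).
Proof.
move=> of_ M [i _ fiM]; have [O [bO OM Of]] := of_ i M fiM.
by exists O; split=> // N /Of; exists i.
Qed.

HB.instance Definition _ := gen_eqMixin (str_space K).
HB.instance Definition _ := gen_choiceMixin (str_space K).
HB.instance Definition _ :=
  isOpenTopological.Build (str_space K) str_openT str_openI str_open_bigU.

Lemma str_space_openE : @open S = @str_open L K.
Proof. by []. Qed.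

End StrSpaceTopology.

Definition comeager (T : topologicalType) (A : set T) :=
  exists2 G : set T, Gdelta_dense G & G `<=` A.

Definition generic_point (L : language) (K : structure L -> Prop)
    (M : str_space K) :=
  comeager [set N : str_space K | isomorphic (str_of N) (str_of M)].

(* The notion is only defined for classes satisfying [genericity_class], so
   being generic for [K] includes that requirement. *)
Definition generic_for (L : language) (K : structure L -> Prop)
    (M : structure L) :=
  genericity_class K /\
  exists2 N : str_space K, generic_point N & isomorphic M (str_of N).

Inductive preds_sym (L : language) (m : nat) : nat -> Type :=
| OldRel n of rel_sym L n : preds_sym L m n
| NewPred of 'I_m : preds_sym L m 1.

Definition preds_lang (L : language) (m : nat) : language :=
  Language (fun_sym L) (preds_sym L m).

Definition preds_interp (L : language) (m : nat) (M : structure L)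
    (P : 'I_m -> set M) : interp (preds_lang L m) M :=
  Interp (L := preds_lang L m) (fun_interp M)
    (fun n (R : preds_sym L m n) =>
       match R in preds_sym _ _ k return k.-tuple M -> Prop with
       | OldRel k R => rel_interp M R
       | NewPred i => fun t => P i (thead t)
       end).

Definition preds_str (L : language) (m : nat) (M : structure L)
    (P : 'I_m -> set M) : structure (preds_lang L m) :=
  Structure (preds_interp P).

Record lang_map (L L' : language) := LangMap {
  fun_map : forall n, fun_sym L n -> fun_sym L' n;
  rel_map : forall n, rel_sym L n -> rel_sym L' n }.

Definition reduct (L L' : language) (h : lang_map L L') (M : structure L') :
    structure L :=
  Structure (Interp
    (fun n F => fun_interp M (fun_map h F))
    (fun n R => rel_interp M (rel_map h R))).

Definition forget_preds (L : language) (m : nat) : lang_map L (preds_lang L m) :=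
  @LangMap L (preds_lang L m) (fun _ F => F) (fun _ R => OldRel m R).

Inductive grp_sym : nat -> Type :=
| GMul : grp_sym 2
| GInv : grp_sym 1
| GOne : grp_sym 0.

Definition grp_lang : language := Language grp_sym (fun=> void).

Inductive qgrp_sym : nat -> Type :=
| QGrp k of grp_sym k : qgrp_sym k
| QRoot (n : nat) of (2 <= n)%N : qgrp_sym 1.

Definition qgrp_lang : language := Language qgrp_sym (fun=> void).

Definition forget_roots : lang_map grp_lang qgrp_lang :=
  LangMap (L := grp_lang) (L' := qgrp_lang) QGrp (fun _ R => R).

Local Open Scope group_scope.

Section GroupStructures.
Variable G : groupType.

Definition grp_op k (F : grp_sym k) : k.-tuple G -> G :=
  match F in grp_sym k return k.-tuple G -> G with
  | GMul => fun t => tnth t ord0 * tnth t ord_max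
  | GInv => fun t => (thead t)^-1
  | GOne => fun=> 1
  end.

Definition grp_str : structure grp_lang :=
  Structure (Interp (L := grp_lang) grp_op (fun _ R => of_void _ R)).

(* [root n] is only used for [2 <= n]. *)
Definition qgrp_op (root : nat -> G -> G) k (F : qgrp_sym k) : k.-tuple G -> G :=
  match F in qgrp_sym k return k.-tuple G -> G with
  | QGrp _ F => grp_op F
  | QRoot n _ => fun t => root n (thead t)
  end.

Definition qgrp_str (root : nat -> G -> G) : structure qgrp_lang :=
  Structure (Interp (L := qgrp_lang) (qgrp_op root) (fun _ R => of_void _ R)).

Definition subgroup (A : set G) := group_closed (mem A).

Definition subgroup_gen (A : set G) : set G := smallest subgroup A.

Definition commutator_subgroup (A B : set G) : set G :=
  subgroup_gen [set z | exists x y, [/\ A x, B y & z = [~ x, y]]].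

(* [lower_central n] is the [n.+1]-st term of the lower central series. *)
Fixpoint lower_central (n : nat) : set G :=
  if n is m.+1 then commutator_subgroup (lower_central m) setT else setT.

Definition nilpotent_le (c : nat) := lower_central c = [set 1].

Definition exponent (p : nat) := forall x : G, x ^+ p = 1.

Definition torsion_free := forall (x : G) n, (0 < n)%N -> x ^+ n = 1 -> x = 1.

Definition Q_powered :=
  torsion_free /\
  forall (g : G) n, (2 <= n)%N -> exists! x : G, x ^+ n = g.

Definition is_root (root : nat -> G -> G) :=
  forall n g, (2 <= n)%N -> root n g ^+ n = g.

Definition Q_powered_subgroup (A : set G) :=
  subgroup A /\
  forall g n, (2 <= n)%N -> A g -> exists2 x, A x & x ^+ n = g.

(* The series is indexed from 1; [P 0] is unconstrained. *)
Definition lazard_series (c : nat) (P : nat -> set G) :=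
  [/\ forall i, (0 < i)%N -> subgroup (P i),
      P 1%N = setT,
      forall i, (0 < i)%N -> P i.+1 `<=` P i,
      forall k, (c < k)%N -> P k = [set 1]
    & forall i j, (0 < i)%N -> (0 < j)%N ->
        commutator_subgroup (P i) (P j) `<=` P (i + j)%N].

End GroupStructures.

Definition K_cp (c p : nat) (M : structure grp_lang) : Prop :=
  exists G : groupType,
    [/\ finite_set [set: G], exponent G p, nilpotent_le G c
      & isomorphic M (grp_str G)].

(* The predicate with index [i : 'I_c.+1] names [P i.+1]. *)
Definition KP_cp (c p : nat) (M : structure (preds_lang grp_lang c.+1)) : Prop :=
  exists (G : groupType) (P : nat -> set G),
    [/\ finite_set [set: G], exponent G p, nilpotent_le G c, lazard_series c P
      & isomorphic M
          (@preds_str grp_lang c.+1 (grp_str G) (fun i => P i.+1))].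

Definition K_cQ (c : nat) (M : structure qgrp_lang) : Prop :=
  exists (G : groupType) (root : nat -> G -> G),
    [/\ Q_powered G /\ is_root root, nilpotent_le G c,
        finitely_generated (qgrp_str root)
      & isomorphic M (qgrp_str root)].

Definition KP_cQ (c : nat) (M : structure (preds_lang qgrp_lang c.+1)) : Prop :=
  exists (G : groupType) (root : nat -> G -> G) (P : nat -> set G),
    [/\ Q_powered G /\ is_root root, nilpotent_le G c,
        finitely_generated (qgrp_str root),
        lazard_series c P /\ (forall i, (0 < i)%N -> Q_powered_subgroup (P i))
      & isomorphic M
          (@preds_str qgrp_lang c.+1 (qgrp_str root) (fun i => P i.+1))].

Definition K_ctf (c : nat) (M : structure grp_lang) : Prop :=
  exists G : groupType,
    [/\ torsion_free G, nilpotent_le G c, finitely_generated (grp_str G)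
      & isomorphic M (grp_str G)].

(* Main.v *)
From HB Require Import structures.
From mathcomp Require Import all_boot ssralg ssrint zmodp matrix.
From mathcomp Require Import boolp classical_sets functions cardinality.
From mathcomp Require Import topology borel_hierarchy.
From mathcomp Require Import zify.
Require Import Defs.

(** A structure M is generic for a class K as soon as every finite subset a of M has a
    finite extension b that _determines_ it: each embedding of the structure generated
    by b in a member C of K can be followed by an embedding of C in M that is inverse to
    it on the structure generated by a. The copies of M are then dense, and they are cut
    out by countably many open conditions, the rounds of a back-and-forth game
    ([generic_criterion]).

    Let G be one of the two limits, with its Lazard series P. By the extension property
    ([fraisse_extend]), the criterion for the reduct holds if b can be chosen so that
    P can be read off from the group generated by b: in every group C containing
    b and for every Lazard series R of C, the series R induces on a the same series
    as P. Homogeneity provides this. An element x of level k, that is, in P k but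
    not in P (k + 1), can be moved by an automorphism onto any other element of that
    level, for instance onto a commutator of weight k in a copy of a group of
    unitriangular matrices. So x is itself a commutator of k elements of G, and some
    commutator of x with c - k further elements is not 1. The first fact puts x in
    R k. The second keeps it out of R (k + 1), since otherwise that commutator would lie
    in R (c + 1), which is trivial. Finitely many such witnesses suffice for all
    elements x of the structure generated by a; for Q-powered groups this uses that
    ascending and descending chains of Q-powered subgroups are finite there
    ([polycyclic_rank], [lazard_determined]).

    It remains to equip the members of the classes with Lazard series. For exponent p the
    lower central series is one. A finitely generated torsion-free nilpotent group is
    residually a p-torsion group for every prime p ([exists_p_quotient]); a reduced
    product of p-torsion quotients, taken over the primes p, is Q-powered, and it
    carries a Lazard series made from the lower central series of the factors
    ([embed_in_Qpowered]). Finally the roots of a subgroup of a nilpotent group form a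
    subgroup, so that partial isomorphisms between Q-powered nilpotent groups extend
    uniquely to the Q-powered hulls ([extend_to_roots]). This carries the Lazard series
    over to Q-powered groups, and it reduces the statement on torsion-free groups to
    the one on Q-powered groups. *)

Set Implicit Arguments.
Unset Strict Implicit.
Unset Printing Implicit Defensive.
Local Open Scope classical_set_scope.
Local Open Scope group_scope.

(** * Subgroups, homomorphisms and quotients *)

Section GroupOf.
Variables (T : Type) (mul : T -> T -> T) (inv : T -> T) (one : T).
Hypotheses (mA : associative mul) (m1 : left_id one mul)
  (mV : left_inverse one inv mul).

Let mrV : right_inverse one inv mul.
Proof. by move=> x; rewrite -[LHS]m1 -{1}(mV (inv x)) -!mA [mul (inv x) _]mA mV m1 mV. Qed.

Let mr1 : right_id one mul.
Proof. by move=> x; rewrite -(mV x) mA mrV m1. Qed.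

Definition choice_of : choiceType := HB.pack T (gen_eqMixin T) (gen_choiceMixin T).
(** The carrier is convertible to [T]; this lets a structure whose operations
    satisfy the laws become a group on its own domain. *)
Definition group_of : groupType :=
  HB.pack T (Choice.class choice_of) (@isGroup.Build choice_of one inv mul mA m1 mr1 mV mrV).
End GroupOf.

Section Subgroups.
Variable G : groupType.
Implicit Types (A B : set G) (x y z : G).

Lemma subgroupP A :
  subgroup A <-> A 1 /\ forall x y, A x -> A y -> A (x * y^-1).
Proof.
split=> [[A1 AV]|[A1 AV]].
  split=> [|x y Ax Ay]; first exact: set_mem A1.
  exact: set_mem (AV x y (mem_set Ax) (mem_set Ay)).
split=> [|x y /set_mem Ax /set_mem Ay]; first exact: (@mem_set _ A).
by apply: (@mem_set _ A); apply: AV.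
Qed.

Lemma sub1 A : subgroup A -> A 1.
Proof. by case/subgroupP. Qed.

Lemma subV A x : subgroup A -> A x -> A x^-1.
Proof. by case/subgroupP=> A1 AV Ax; rewrite -[x^-1]mul1g; apply: AV. Qed.

Lemma subM A x y : subgroup A -> A x -> A y -> A (x * y).
Proof.
move=> sA Ax Ay; rewrite -[y]invgK; case/subgroupP: (sA) => _; apply=> //.
exact: subV.
Qed.

Lemma subX A x n : subgroup A -> A x -> A (x ^+ n).
Proof.
by move=> sA Ax; elim: n => [|n IH]; [apply: sub1 | rewrite expgS; apply: subM].
Qed.

Lemma subgroup_intro A : A 1 -> (forall x y, A x -> A y -> A (x * y)) ->
  (forall x, A x -> A x^-1) -> subgroup A.
Proof. by move=> A1 AM AV; apply/subgroupP; split=> // x y Ax Ay; apply: AM => //; apply: AV. Qed.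

Lemma subMr A x y : subgroup A -> A x -> A (x * y) -> A y.
Proof. by move=> sA Ax Axy; rewrite -[y](mulKg x); apply: subM => //; apply: subV. Qed.

Lemma subMl A x y : subgroup A -> A y -> A (x * y) -> A x.
Proof. by move=> sA Ay Axy; rewrite -[x](mulgK y); apply: subM => //; apply: subV. Qed.

Lemma subR A x y : subgroup A -> A x -> A y -> A [~ x, y].
Proof.
by move=> sA Ax Ay; rewrite /commg /conjg; do ?[apply: subM => // | apply: subV].
Qed.

Lemma subgroupT : subgroup [set: G].
Proof. exact: subgroup_intro. Qed.

Lemma subgroup1 : subgroup [set 1 : G].
Proof.
apply: subgroup_intro => //= [x y -> ->|x ->]; [exact: mulg1 | exact: invg1].
Qed.

Lemma subgroupI A B : subgroup A -> subgroup B -> subgroup (A `&` B).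
Proof.
move=> sA sB; apply: subgroup_intro => [|x y [Ax Bx] [Ay By]|x [Ax Bx]].
- by split; apply: sub1.
- by split; apply: subM.
- by split; apply: subV.
Qed.

Lemma subgroup_genP A : subgroup (subgroup_gen A).
Proof.
apply: subgroup_intro => [B [sB _]|x y Ax Ay B AB|x Ax B AB].
- exact: sub1.
- by apply: subM; [case: AB | apply: Ax | apply: Ay].
- by apply: subV; [case: AB | apply: Ax].
Qed.

Lemma sub_gen A : A `<=` subgroup_gen A.
Proof. by move=> x Ax B [_]; apply. Qed.

Lemma gen_min A B : subgroup B -> A `<=` B -> subgroup_gen A `<=` B.
Proof. by move=> sB AB x; apply. Qed.

Lemma gen_mono A B : A `<=` B -> subgroup_gen A `<=` subgroup_gen B.
Proof. by move=> AB; apply: gen_min; [exact: subgroup_genP | move=> x /AB; exact: sub_gen]. Qed.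

Lemma comm_sub_le A B C : subgroup C ->
  (forall x y, A x -> B y -> C [~ x, y]) <-> commutator_subgroup A B `<=` C.
Proof.
move=> sC; split=> [H|H x y Ax By].
  by apply: gen_min => // z [x [y [Ax By ->]]]; apply: H.
by apply: H; apply: sub_gen; exists x, y.
Qed.

Lemma comm_subP A B x y : A x -> B y -> commutator_subgroup A B [~ x, y].
Proof. by move=> Ax By; apply: sub_gen; exists x, y. Qed.

Definition normal_subgroup A := subgroup A /\ forall x y, A x -> A (x ^ y).

Lemma normalR A x y : normal_subgroup A -> A x -> A [~ x, y].
Proof. by case=> sA nA Ax; rewrite /commg; apply: subM => //; [apply: subV | apply: nA]. Qed.

End Subgroups.

Section Homs.
Variables G H : groupType.

Definition hom (f : G -> H) := {morph f : x y / x * y}.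

Variables (f : G -> H) (hf : hom f).

Lemma hom1 : f 1 = 1.
Proof. by apply: (@mulgI _ (f 1)); rewrite -hf !mulg1. Qed.

Lemma homV x : f x^-1 = (f x)^-1.
Proof. by apply: (@mulgI _ (f x)); rewrite -hf !mulgV hom1. Qed.

Lemma homX x n : f (x ^+ n) = f x ^+ n.
Proof. by elim: n => [|n IH]; rewrite ?hom1 // !expgS hf IH. Qed.

Lemma homJ x y : f (x ^ y) = f x ^ f y.
Proof. by rewrite /conjg !hf homV. Qed.

Lemma homR x y : f [~ x, y] = [~ f x, f y].
Proof. by rewrite /commg hf homV homJ. Qed.

Lemma hom_ker_inj : (forall x, f x = 1 -> x = 1) -> injective f.
Proof.
by move=> k x y fxy; apply: divg1_eq; apply: k; rewrite hf homV fxy mulgV.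
Qed.

Lemma hom_preimage (A : set H) : subgroup A -> subgroup (f @^-1` A).
Proof.
move=> sA; apply: subgroup_intro => [|x y Ax Ay|x Ax] /=.
- by rewrite hom1; apply: sub1.
- by rewrite hf; apply: subM.
- by rewrite homV; apply: subV.
Qed.

Lemma hom_image (A : set G) : subgroup A -> subgroup (f @` A).
Proof.
move=> sA; apply: subgroup_intro => [|_ _ [x Ax <-] [y Ay <-]|_ [x Ax <-]].
- by exists 1; [apply: sub1 | apply: hom1].
- by exists (x * y); [apply: subM | apply: hf].
- by exists x^-1; [apply: subV | apply: homV].
Qed.

End Homs.

(** Maps that are multiplicative on a subgroup [Y] only; this is the form in which
    embeddings of substructures appear below. *)
Section PartialHoms.
Variables (G H : groupType) (Y : set G) (f : G -> H).
Hypotheses (sY : subgroup Y)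
  (fm : forall x y, Y x -> Y y -> f (x * y) = f x * f y).

Lemma phom1 : f 1 = 1.
Proof. by apply: (@mulgI _ (f 1)); rewrite -fm ?mulg1 //; exact: sub1. Qed.

Lemma phomV x : Y x -> f x^-1 = (f x)^-1.
Proof.
move=> Yx; apply: (@mulgI _ (f x)); rewrite -fm ?mulgV ?phom1 //; exact: subV.
Qed.

Lemma phomX x n : Y x -> f (x ^+ n) = f x ^+ n.
Proof.
move=> Yx; elim: n => [|n IH]; first by rewrite !expg0 phom1.
by rewrite !expgS fm ?IH //; exact: subX.
Qed.

Lemma partial_preimage (R : set H) : subgroup R -> subgroup (Y `&` f @^-1` R).
Proof.
move=> sR; apply: subgroup_intro => [|u v [Yu Ru] [Yv Rv]|u [Yu Ru]].
- by split; [exact: sub1 | rewrite /preimage /= phom1; exact: sub1].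
- by split; [exact: subM | rewrite /preimage /= fm //; exact: subM].
- by split; [exact: subV | rewrite /preimage /= phomV //; exact: subV].
Qed.

End PartialHoms.

Lemma map_lift (A : Type) (B : eqType) (f : A -> B) (s : seq B) :
  (forall y, y \in s -> exists x, f x = y) -> exists t, map f t = s.
Proof.
elim: s => [|y s IH] h; first by exists [::].
have [x xy] := h y (mem_head _ _).
have [|t ts] := IH; first by move=> z zs; apply: h; rewrite inE zs orbT.
by exists (x :: t); rewrite /= xy ts.
Qed.

Lemma exists_sub (G : groupType) (A : set G) : subgroup A ->
  exists (H : groupType) (j : H -> G), [/\ hom j, injective j & range j = A].
Proof.
move=> sA; pose T := {x | A x}.
pose mul (u v : T) : T := exist A _ (subM sA (svalP u) (svalP v)).
pose inv (u : T) : T := exist A _ (subV sA (svalP u)).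
pose one : T := exist A _ (sub1 sA).
have mA : associative mul by move=> u v w; apply: sval_inj; exact: mulgA.
have m1 : left_id one mul by move=> u; apply: sval_inj; exact: mul1g.
have mV : left_inverse one inv mul by move=> u; apply: sval_inj; exact: mulVg.
exists (group_of mA m1 mV), (@sval G A); split=> //; first exact: sval_inj.
apply/seteqP; split=> [_ [u _ <-]|x Ax]; first exact: svalP.
by exists (exist A x Ax).
Qed.

(** The group laws are only required up to the congruence [e], so that reduced
    products, where [T] is a type of functions, are covered as well as quotients. *)
Lemma exists_quot (T : Type) (mul : T -> T -> T) (inv : T -> T) (one : T)
    (e : T -> T -> Prop) :
  (forall x, e x x) -> (forall x y, e x y -> e y x) ->
  (forall x y z, e x y -> e y z -> e x z) ->
  (forall x x' y y', e x x' -> e y y' -> e (mul x y) (mul x' y')) ->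
  (forall x y z, e (mul x (mul y z)) (mul (mul x y) z)) ->
  (forall x, e (mul one x) x) -> (forall x, e (mul (inv x) x) one) ->
  exists (Q : groupType) (q : T -> Q),
    [/\ forall x y, q (mul x y) = q x * q y, forall z, exists x, q x = z
      & forall x y, q x = q y <-> e x y].
Proof.
move=> er es et em eA e1 eV.
pose QT := {A : set T | exists x, A = e x}.
pose q x : QT := exist _ (e x) (ex_intro _ x erefl).
have qE x y : q x = q y <-> e x y.
  split=> [/(congr1 sval) /= exy|exy]; first by rewrite exy; exact: er.
  apply: sval_inj => /=; apply/funext => z; apply/propext; split=> h.
    by apply: et h; exact: es.
  exact: et exy h.
have qs z : {x | q x = z}.
  apply: cid; case: z => A [x Ax]; exists x; apply: sval_inj => /=; exact: esym.
pose r z := sval (qs z); have rK z : q (r z) = z by exact: (svalP (qs z)).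
have rq x : e (r (q x)) x by apply/qE; rewrite rK.
pose m u v := q (mul (r u) (r v)); pose i u := q (inv (r u)).
have qm x y : q (mul x y) = m (q x) (q y).
  by apply/qE; apply: em; apply: es; apply: rq.
have mA : associative m.
  by move=> u v w; rewrite -(rK u) -(rK v) -(rK w) -!qm; apply/qE.
have m1 : left_id (q one) m.
  by move=> u; rewrite -(rK u) -!qm; apply/qE.
have mV : left_inverse (q one) i m.
  by move=> u; rewrite -{2}(rK u) /i -!qm; apply/qE.
exists (group_of mA m1 mV), q; split=> // z; by exists (r z); exact: rK.
Qed.

Lemma exists_quotient (G : groupType) (N : set G) : normal_subgroup N ->
  exists (Q : groupType) (q : G -> Q),
    [/\ hom q, forall z, exists x, q x = z & forall x, q x = 1 <-> N x].
Proof.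
case=> sN nN.
have [| | | | | | |Q [q [qm qs qe]]] :=
    @exists_quot G *%g (fun x => x^-1) 1 (fun x y => N (x^-1 * y)).
- by move=> x; rewrite mulVg; apply: sub1.
- by move=> x y /(subV sN); rewrite invgM invgK.
- move=> x y z xy yz.
  have -> : x^-1 * z = (x^-1 * y) * (y^-1 * z) by rewrite mulgA mulgK.
  exact: subM.
- move=> x x' y y' xx yy; rewrite invgM.
  have -> : y^-1 * x^-1 * (x' * y') = (x^-1 * x') ^ y * (y^-1 * y').
    by rewrite /conjg !mulgA mulgK.
  by apply: subM => //; apply: nN.
- by move=> x y z; rewrite (mulgA x) mulVg; apply: sub1.
- by move=> x; rewrite mul1g mulVg; apply: sub1.
- by move=> x; rewrite mulVg mulg1 invg1; apply: sub1.
exists Q, q; split=> // x; rewrite -(hom1 qm); split.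
  by move/qe => /(subV sN); rewrite mulg1 invgK.
by move=> Nx; apply/qe; rewrite mulg1; apply: subV.
Qed.

(** * Commutators, central series and nilpotency *)

Section Commutators.
Variable G : groupType.
Implicit Types (x y z g : G) (s : seq G) (N : set G).

Lemma commMl x y z : [~ x * y, z] = [~ x, z] ^ y * [~ y, z].
Proof. by rewrite /commg /conjg !gnorm. Qed.

Lemma commMr x y z : [~ x, y * z] = [~ x, z] * [~ x, y] ^ z.
Proof. by rewrite /commg /conjg !gnorm. Qed.

Lemma commVl x z : [~ x^-1, z] = [~ x, z]^-1 ^ x^-1.
Proof. by rewrite /commg /conjg !gnorm. Qed.

Lemma commJl x y z : [~ x ^ y, z] = [~ x, z ^ y^-1] ^ y.
Proof. by rewrite /commg /conjg !gnorm. Qed.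

Lemma hall_witt x y z :
  [~ x, y^-1, z] ^ y * ([~ y, z^-1, x] ^ z * [~ z, x^-1, y] ^ x) = 1.
Proof. by rewrite /commg /conjg !gnorm. Qed.

Lemma commXl x g n : commute x [~ x, g] -> [~ x ^+ n, g] = [~ x, g] ^+ n.
Proof.
move=> cx; elim: n => [|n IH]; first by rewrite !expg0 comm1g.
rewrite expgS commMl IH expgS; congr (_ * _); apply/conjg_fixP/commgP.
exact/commuteX/commute_sym.
Qed.

Lemma commXr x g n : commute g [~ x, g] -> [~ x, g ^+ n] = [~ x, g] ^+ n.
Proof.
move=> cg; elim: n => [|n IH]; first by rewrite !expg0 commg1.
rewrite expgS commMr IH expgSr; congr (_ * _); apply/conjg_fixP/commgP.
exact/commuteX/commute_sym.
Qed.

(** The left-normed commutator of [x] with the entries of [s]. *)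
Definition icomm x s := foldl (fun u v => [~ u, v]) x s.

Lemma icomm1 s : icomm 1 s = 1.
Proof. by elim: s => //= y s IH; rewrite comm1g. Qed.

Lemma icomm_cat x s t : icomm x (s ++ t) = icomm (icomm x s) t.
Proof. exact: foldl_cat. Qed.

(** The upper central series above [N]: for normal [N] it is the preimage of the
    upper central series of the quotient. *)
Definition uc N k : set G := [set x | forall s, size s = k -> N (icomm x s)].

Lemma uc0 N : uc N 0 = N.
Proof.
apply/seteqP; split=> [x /(_ [::] erefl) //|x Nx s /size0nil -> //].
Qed.

Lemma ucS N k x : uc N k.+1 x <-> forall y, uc N k [~ x, y].
Proof.
split=> [H y s ss|H [|y s] //= [ss]]; first by apply: (H (y :: s)); rewrite /= ss.
exact: H.
Qed.

Lemma uc_normal N k : normal_subgroup N -> normal_subgroup (uc N k).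
Proof.
move=> nN; elim: k => [|k [sK nK]]; first by rewrite uc0.
split.
  apply: subgroup_intro => [|x y /ucS Hx /ucS Hy|x /ucS Hx]; apply/ucS => z.
  - by rewrite comm1g; apply: (sub1 sK).
  - by rewrite commMl; apply: (subM sK) => //; apply: nK.
  - by rewrite commVl; apply: nK; apply: (subV sK).
by move=> x y /ucS Hx; apply/ucS => z; rewrite commJl; apply: nK.
Qed.

(** Being nilpotent of class at most [c], as a condition on tuples, which passes
    to substructures and is checked locally. *)
Definition nil_class c := forall x s, size s = c -> icomm x s = 1.

Lemma lower_central_normal i : normal_subgroup (@lower_central G i).
Proof.
elim: i => [|i [sL nL]] /=; first by split=> //; exact: subgroupT.
split; first exact: subgroup_genP.
move=> x y; pose B := [set x | commutator_subgroup (lower_central i) setT (x ^ y)].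
have sB : subgroup B.
  have sC := subgroup_genP [set z | exists u v : G, [/\ lower_central i u, setT v & z = [~ u, v]]].
  apply: subgroup_intro => [|u v Bu Bv|u Bu]; rewrite /B /=.
  - by rewrite conj1g; apply: (sub1 sC).
  - by rewrite conjMg; apply: (subM sC).
  - by rewrite conjVg; apply: (subV sC).
apply: (gen_min sB) => _ [u [v [Lu _ ->]]]; rewrite /B /= conjRg.
by apply: comm_subP => //; apply: nL.
Qed.

Lemma lower_central_sub i : subgroup (@lower_central G i).
Proof. by case: (lower_central_normal i). Qed.

Lemma lower_central_comm i x y : lower_central i x -> lower_central i.+1 [~ x, y].
Proof. by move=> Lx; apply: comm_subP. Qed.

Lemma lower_central_le i : @lower_central G i.+1 `<=` lower_central i.
Proof.
apply/comm_sub_le => [|x y Lx _]; first exact: lower_central_sub.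
exact: normalR (lower_central_normal i) Lx.
Qed.

Lemma lower_central_icomm i x s :
  lower_central i x -> lower_central (i + size s) (icomm x s).
Proof.
elim: s i x => [|y s IH] i x Lx /=; first by rewrite addn0.
by rewrite addnS -addSn; apply: IH; apply: lower_central_comm.
Qed.

Lemma nilP c : nilpotent_le G c <-> nil_class c.
Proof.
split=> [H x s ss|H].
  by have := @lower_central_icomm 0 x s I; rewrite add0n ss H.
have Lu i j : (i + j)%N = c -> @lower_central G i `<=` uc [set 1] j.
  elim: i j => [|i IH] j; first by rewrite add0n => -> x _ s; exact: H.
  rewrite addSn -addnS => /IH Li; apply/comm_sub_le => [|x y /Li /ucS //].
  apply: (proj1 (uc_normal j _)); split; first exact: subgroup1.
  by move=> x y /= ->; rewrite conj1g.
apply/seteqP; split=> [x /(Lu c 0 (addn0 _)) |x ->]; first by rewrite uc0.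
by apply: sub1; apply: lower_central_sub.
Qed.

(** By induction on [j]: the Hall-Witt identity is the three subgroups lemma. *)
Lemma lower_central_lazard i j x y :
  lower_central i x -> lower_central j y -> lower_central (i + j).+1 [~ x, y].
Proof.
elim: j i x y => [|j IH] i x y Lx.
  by move=> _; rewrite addn0; apply: lower_central_comm.
have sL k := lower_central_sub k.
have [K KE] : exists K, K = @lower_central G (i + j.+1).+1 by eexists.
have [sK nK] : normal_subgroup K by rewrite KE; exact: lower_central_normal.
rewrite -KE; pose B := [set y | K [~ x, y]].
have sB : subgroup B.
  apply: subgroup_intro => [|u v Bu Bv|u Bu]; rewrite /B /=.
  - by rewrite commg1; apply: (sub1 sK).
  - by rewrite commMr; apply: (subM sK) => //; apply: nK.
  - rewrite -[X in K X]invgK invgR; apply: (subV sK).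
    by rewrite commVl invgR; apply: nK.
apply: (gen_min sB) => _ [u [z [Lu _ ->]]]; rewrite /B /= -[[~ x, _]]invgK invgR.
apply: (subV sK); rewrite -[z]invgK; set t := z^-1.
have a1 : K ([~ x, u^-1, t] ^ u).
  apply: nK; rewrite KE addnS; apply: lower_central_comm.
  by apply: IH => //; apply: (subV (sL _)).
have a2 : K ([~ t, x^-1, u] ^ x).
  apply: nK; rewrite KE addnS -addSn; apply: IH => //.
  rewrite -[X in lower_central _ X]invgK invgR; apply: (subV (sL _)).
  by apply: lower_central_comm; apply: (subV (sL _)).
have : K ([~ u, t^-1, x] ^ t).
  apply: (subMl sK a2); apply: (subMr sK a1).
  by rewrite hall_witt; apply: (sub1 sK).
by move=> /(nK _ t^-1); rewrite conjgK.
Qed.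

Lemma lower_central_series c : nilpotent_le G c ->
  lazard_series c (fun i => @lower_central G i.-1).
Proof.
move=> nc; split=> //.
- by move=> i _; apply: lower_central_sub.
- by case=> // i _; apply: lower_central_le.
- case=> // k; rewrite ltnS => /= ck; apply/seteqP; split=> [x|x ->].
    rewrite -nc; elim: k ck => [|k IH]; first by rewrite leqn0 => /eqP ->.
    by rewrite leq_eqVlt => /orP[/eqP -> //|/IH H /lower_central_le].
  by apply: sub1; apply: lower_central_sub.
case=> // i [//|j] _ _; rewrite addSn addnS /=; apply/comm_sub_le.
  exact: (@lower_central_sub (i + j).+1).
by move=> x y; apply: lower_central_lazard.
Qed.

End Commutators.

Section NilTransfer.
Variables (G H : groupType) (f : G -> H).
Hypothesis hf : hom f.

Lemma hom_icomm x s : f (icomm x s) = icomm (f x) (map f s).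
Proof. by elim: s x => //= y s IH x; rewrite IH homR. Qed.

Lemma nil_inj c : injective f -> nil_class H c -> nil_class G c.
Proof.
move=> fi nH x s ss; apply: fi; rewrite hom_icomm nH ?size_map //.
by rewrite hom1.
Qed.

Lemma nil_surj c : (forall y, exists x, f x = y) -> nil_class G c -> nil_class H c.
Proof.
move=> fs nG y s; have [x <-] := fs y.
have [t <-] := map_lift (fun z (_ : z \in s) => fs z).
by rewrite size_map => /(nG x) h; rewrite -hom_icomm h hom1.
Qed.

End NilTransfer.

(** * Roots of subgroups of nilpotent groups *)

Section Central.
Variables (G : groupType) (z : G).
Hypothesis cz : forall y : G, commute z y.

Lemma comm_centralr x y : [~ x * z, y] = [~ x, y].
Proof.
rewrite commMl (elimT eqP (introT commgP (cz y))) mulg1.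
exact/conjg_fixP/commgP/commute_sym/cz.
Qed.

Lemma comm_centrall x y : [~ y, x * z] = [~ y, x].
Proof. by rewrite -[LHS]invgK invgR comm_centralr invgR. Qed.

End Central.

Section Congruences.
Variables (G : groupType) (N A : set G).
Hypotheses (nN : normal_subgroup N) (sA : subgroup A) (NA : N `<=` A).

Lemma mem_mod (Q : groupType) (q : G -> Q) x y :
  hom q -> (forall x, q x = 1 <-> N x) -> q x = q y -> A x -> A y.
Proof.
move=> hq kq qxy Ax; have : N (x^-1 * y) by apply/kq; rewrite hq (homV hq) qxy mulVg.
by move=> /NA /(subM sA Ax); rewrite mulVKg.
Qed.

Lemma mod_expM x y n : N [~ x, y] -> A (x ^+ n * y ^+ n) -> A ((x * y) ^+ n).
Proof.
move=> Nxy; have [Q [q [hq _ kq]]] := exists_quotient nN.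
apply: (mem_mod hq kq (x := x ^+ n * y ^+ n)) => //; rewrite hq !(homX hq) hq expgMn //; apply/commgP.
by rewrite -(homR hq); apply/eqP/kq.
Qed.

End Congruences.

Section Roots.
Variable G : groupType.
Implicit Types (A B : set G) (x y : G).

Definition roots A : set G := [set x | exists2 n, (0 < n) & A (x ^+ n)].

Lemma sub_roots A : A `<=` roots A.
Proof. by move=> x Ax; exists 1%N. Qed.

Lemma roots_mono A B : A `<=` B -> roots A `<=` roots B.
Proof. by move=> AB x [n n0 Ax]; exists n => //; apply: AB. Qed.

Lemma roots_root A x n : (0 < n) -> roots A (x ^+ n) -> roots A x.
Proof. by move=> n0 [m m0 Ax]; exists (n * m)%N; rewrite ?muln_gt0 ?n0 // expgnA. Qed.

Lemma roots_common A x y : subgroup A -> roots A x -> roots A y ->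
  exists n, [/\ (0 < n), A (x ^+ n) & A (y ^+ n)].
Proof.
move=> sA [n n0 Ax] [m m0 Ay]; exists (n * m)%N; split.
- by rewrite muln_gt0 n0.
- by rewrite expgnA; apply: subX.
- by rewrite mulnC expgnA; apply: subX.
Qed.

(** The induction goes up the lower central series: commutators [u, g] of weight
    k + 1 are bilinear modulo the next term, where the powers of u and g
    differ from elements of A only by central factors. *)
Lemma roots_generate k A : subgroup A -> lower_central k `<=` A ->
  (forall B, subgroup B -> roots A `<=` B -> forall x, B x) -> forall x, roots A x.
Proof.
elim: k A => [|k IH] A sA LA gA x; first by apply: sub_roots; apply: LA.
pose N := @lower_central G k.+1; have nN : normal_subgroup N by exact: lower_central_normal.
have sL := @lower_central_sub G k; have nL := @lower_central_normal G k.
have [Q [q [hq qs kq]]] := exists_quotient nN.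
have Lc z y : lower_central k z -> commute (q z) (q y).
  by move=> Lz; apply/commgP; rewrite -(homR hq); apply/eqP/kq; apply: lower_central_comm.
pose A' := [set w | exists a z, [/\ A a, lower_central k z & w = a * z]].
have sA' : subgroup A'.
  apply: subgroup_intro => [|_ _ [a [z [Aa Lz ->]]] [b [t [Ab Lt ->]]]|_ [a [z [Aa Lz ->]]]].
  - by exists 1, 1; split; [apply: sub1 | apply: (sub1 sL) | rewrite mulg1].
  - exists (a * b), (z ^ b * t); split; first exact: subM.
      by apply: (subM sL) => //; apply: (proj2 nL).
    by rewrite /conjg !gnorm.
  - exists a^-1, (z^-1 ^ a^-1); split; first exact: subV.
      by apply: (proj2 nL); apply: (subV sL).
    by rewrite /conjg !gnorm.
have AA' : A `<=` A' by move=> a Aa; exists a, 1; rewrite mulg1; split=> //; apply: (sub1 sL).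
have rA' : forall x, roots A' x.
  apply: IH => // [z Lz|B sB AB]; first by exists 1, z; rewrite mul1g; split=> //; exact: sub1.
  by apply: gA => // z /(roots_mono AA'); apply: AB.
pose B := [set w | lower_central k w /\ roots A w].
have sB : subgroup B.
  apply: subgroup_intro => [|u v [Lu Au] [Lv Av]|u [Lu [n n0 Au]]].
  - by split; [apply: (sub1 sL) | apply: sub_roots; apply: sub1].
  - split; first exact: (subM sL).
    have [n [n0 un vn]] := roots_common sA Au Av; exists n => //.
    by apply: (mod_expM nN) => //; [apply: lower_central_comm | apply: subM].
  - by split; [apply: (subV sL) | exists n; rewrite // expVgn; apply: subV].
have LB : forall w, lower_central k w -> roots A w.
  move=> w Lw; suff: B w by case.
  have [k0|[k' k'E]] : k = 0%N \/ exists k', k = k'.+1 by case: (k); [left|right; eexists].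
    by apply: gA => // z Az; split=> //; rewrite k0.
  move: w Lw; rewrite k'E; apply: (gen_min sB) => _ [u [g [Lu _ ->]]].
  have Lug : lower_central k [~ u, g] by rewrite k'E; apply: lower_central_comm.
  split=> //; have [n n0 [a [z [Aa Lz un]]]] := rA' u.
  have [m m0 [b [t [Ab Lt gm]]]] := rA' g.
  exists (n * m)%N; rewrite ?muln_gt0 ?n0 //.
  apply: (mem_mod sA LA hq kq (x := [~ a, b])); last exact: subR.
  have cug (y : Q) : commute [~ q u, q g] y.
    by rewrite -(homR hq); have [y' <-] := qs y; apply: Lc.
  rewrite (homX hq) !(homR hq) expgnA -commXl; last exact/commute_sym.
  rewrite -commXr; last by rewrite commXl; [apply: commuteX; exact/commute_sym | exact/commute_sym].
  rewrite -!(homX hq) un gm !hq comm_centralr ?comm_centrall // => y.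
    by have [y' <-] := qs y; apply: Lc.
  by have [y' <-] := qs y; apply: Lc.
have [n n0 [a [z [Aa Lz xn]]]] := rA' x.
have [m m0 Azm] := LB z Lz; exists (n * m)%N; rewrite ?muln_gt0 ?n0 // expgnA xn.
apply: (mod_expM nN) => //; last by apply: subM => //; apply: subX.
rewrite -invgR; apply: (subV (proj1 nN)); exact: lower_central_comm.
Qed.

End Roots.

Section RootsNilpotent.
Variables (G : groupType) (c : nat).
Hypothesis nG : nil_class G c.

(** Inside the subgroup generated by the roots of [A], all elements are roots. *)
Theorem roots_subgroup (A : set G) : subgroup A -> subgroup (roots A).
Proof.
move=> sA; pose K := subgroup_gen (roots A).
have sK : subgroup K by exact: subgroup_genP.
have [H [j [hj ij rj]]] := exists_sub sK.
suff KA x : K x -> roots A x.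
  have -> // : roots A = K by apply/seteqP; split; [exact: sub_gen | exact: KA].
have jroots h : roots (j @^-1` A) h <-> roots A (j h).
  by split=> -[n n0 /= An]; exists n => //=; move: An; rewrite (homX hj).
have Kj h : K (j h) by rewrite -rj; exists h.
rewrite -rj => -[h _ <-]; apply/jroots.
apply: (@roots_generate _ c); first exact: hom_preimage.
  rewrite (proj2 (nilP H c) (nil_inj hj ij nG)) => _ ->.
  by rewrite /= (hom1 hj); apply: sub1.
move=> B sB rB h'; have : (j @` B) (j h').
  apply: (gen_min (hom_image hj sB)) (Kj h') => z Az.
  have := sub_gen Az; rewrite -/K -rj => -[u _ uz]; exists u => //.
  by apply: rB; apply/jroots; rewrite uz.
by case=> u Bu /ij <-.
Qed.

End RootsNilpotent.

(** * Q-powered groups *)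

Section QPowered.
Variable G : groupType.
Implicit Types (A B : set G) (x y : G).

Lemma Qpowered_expI n x y : Q_powered G -> (0 < n) -> x ^+ n = y ^+ n -> x = y.
Proof.
case=> _ ur; case: n => // -[_|n _ xy]; first by rewrite !expg1.
by have [z [_ uz]] := ur (x ^+ n.+2) n.+2 isT; rewrite -(uz x) // -(uz y).
Qed.

Lemma Qpowered_sub_root A n x : Q_powered G -> Q_powered_subgroup A -> (0 < n) ->
  A (x ^+ n) <-> A x.
Proof.
move=> QG [sA rA] n0; split; last exact: subX.
case: n n0 => // -[_|n _ Axn]; first by rewrite expg1.
have [y Ay yx] := rA _ n.+2 isT Axn.
by rewrite -(@Qpowered_expI n.+2 y x).
Qed.

Lemma Qpowered_sub_roots A : Q_powered G -> Q_powered_subgroup A -> roots A `<=` A.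
Proof. by move=> QG QA x [n n0 /(Qpowered_sub_root x QG QA n0)]. Qed.

Lemma roots_Qpowered c A : Q_powered G -> nil_class G c -> subgroup A ->
  Q_powered_subgroup (roots A).
Proof.
move=> QG nG sA; split; first exact: (roots_subgroup nG).
move=> g n n2 rg; have [x [xg _]] := proj2 QG g n n2; exists x => //.
by apply: (@roots_root _ _ _ n); [apply: ltnW | rewrite xg].
Qed.

Lemma Qpowered_subI A B :
  Q_powered G -> Q_powered_subgroup A -> Q_powered_subgroup B ->
  Q_powered_subgroup (A `&` B).
Proof.
move=> QG QA QB; split; first exact: subgroupI (proj1 QA) (proj1 QB).
move=> g n n2 [Ag Bg]; have [x Ax xg] := proj2 QA g n n2 Ag; exists x => //.
by split=> //; apply/(Qpowered_sub_root x QG QB (ltnW n2)); rewrite xg.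
Qed.

End QPowered.

Section Products.
Variables G H : groupType.

Lemma pairX (u : G * H) n : u ^+ n = (u.1 ^+ n, u.2 ^+ n).
Proof. by elim: n => [|n IH] //; rewrite !expgS IH. Qed.

Lemma hom_fst : hom (fst : G * H -> G). Proof. by []. Qed.
Lemma hom_snd : hom (snd : G * H -> H). Proof. by []. Qed.

Lemma nil_prod c : nil_class G c -> nil_class H c -> nil_class (G * H)%type c.
Proof.
move=> nG nH x s ss; have := hom_icomm hom_fst x s; have := hom_icomm hom_snd x s.
by rewrite nG ?nH ?size_map //; case: (icomm x s) => a b /= -> ->.
Qed.

Lemma Qpowered_prod : Q_powered G -> Q_powered H -> Q_powered (G * H)%type.
Proof.
move=> [tG rG] [tH rH]; split.
  move=> [x y] n n0; rewrite pairX => -[/= xn yn].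
  by rewrite (tG x n) // (tH y n).
move=> [g h] n n2; have [x [xg ux]] := rG g n n2; have [y [yh uy]] := rH h n n2.
exists (x, y); split; first by rewrite pairX xg yh.
by move=> [x' y']; rewrite pairX => -[/= /ux -> /uy ->].
Qed.

End Products.

(** The two hypotheses say that both projections are injective on [R]. *)
Lemma graph_hom (G H : groupType) (R : set (G * H)) : subgroup R ->
  (forall y, R (1, y) -> y = 1) -> (forall x, R (x, 1) -> x = 1) ->
  let D := [set x | exists y, R (x, y)] in
  exists f : G -> H,
    [/\ forall x y, D x -> D y -> f (x * y) = f x * f y,
        forall x y, D x -> D y -> f x = f y -> x = y
      & forall x y, R (x, y) -> f x = y].
Proof.
move=> sR Rf Ri D.
have rRf x y z : R (x, y) -> R (x, z) -> y = z.
  move=> xy xz; apply: divg1_eq; apply: Rf.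
  by have := subM sR xy (subV sR xz); rewrite /= -[_ * _]/(_, _) /= mulgV.
have rRi x y z : R (x, z) -> R (y, z) -> x = y.
  move=> xy xz; apply: divg1_eq; apply: Ri.
  by have := subM sR xy (subV sR xz); rewrite /= -[_ * _]/(_, _) /= mulgV.
have [f fP] : {f : G -> H & forall x, D x -> R (x, f x)}.
  apply: (@boolp.choice _ _ (fun x y => D x -> R (x, y))) => x.
  by have [[y Ry]|nDx] := pselect (D x); [exists y | exists 1].
exists f; split.
- move=> x y Dx Dy; have Rxy := subM sR (fP _ Dx) (fP _ Dy).
  by apply: (rRf (x * y)) => //; apply: fP; exists (f x * f y).
- by move=> x y Dx Dy fxy; apply: rRi (fP _ Dx) _; rewrite fxy; exact: fP.
- by move=> x y Rxy; apply: (rRf x) => //; apply: fP; exists y.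
Qed.

(** Uniqueness of the hull of a subgroup in Q-powered groups: a partial
    isomorphism, given by its graph, extends to the roots, because the roots of
    the graph in the product again form a subgroup, and this subgroup is a graph. *)
Theorem extend_to_roots (G H : groupType) c (R : set (G * H)) :
  Q_powered G -> Q_powered H -> nil_class G c -> nil_class H c -> subgroup R ->
  (forall y, R (1, y) -> y = 1) -> (forall x, R (x, 1) -> x = 1) ->
  let D := roots [set x | exists y, R (x, y)] in
  exists f : G -> H,
    [/\ forall x y, D x -> D y -> f (x * y) = f x * f y,
        forall x y, D x -> D y -> f x = f y -> x = y,
        forall x y, R (x, y) -> f x = y
      & forall x, D x -> exists2 n, (0 < n) & R (x ^+ n, f x ^+ n)].
Proof.
move=> QG QH nG nH sR Rf Ri D.
have rE x y : roots R (x, y) <-> exists2 n, (0 < n) & R (x ^+ n, y ^+ n).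
  by split=> -[n n0]; [rewrite pairX | ] => Rn; exists n; rewrite ?pairX.
have srR : subgroup (roots R) := roots_subgroup (nil_prod nG nH) sR.
have expI1 (K : groupType) (x : K) n : Q_powered K -> (0 < n) -> x ^+ n = 1 -> x = 1.
  by move=> QK n0 xn; apply: (@Qpowered_expI _ n); rewrite // expg1n.
have [||f [fm fi fR]] := graph_hom srR.
- by move=> y /rE[n n0]; rewrite expg1n => /Rf; apply: expI1.
- by move=> x /rE[n n0]; rewrite expg1n => /Ri; apply: expI1.
have DE x : D x -> exists y, roots R (x, y).
  case=> n n0 [y Ry]; have n2 : (2 <= n * 2)%N by rewrite -[2%N]mul1n leq_mul2r n0.
  have [z [zy _]] := proj2 QH (y ^+ 2) (n * 2)%N n2.
  exists z; apply/rE; exists (n * 2)%N; first exact: ltnW.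
  by rewrite zy expgnA; have := subX 2 sR Ry; rewrite pairX.
exists f; split.
- by move=> x y /DE Dx /DE Dy; apply: fm.
- by move=> x y /DE Dx /DE Dy; apply: fi.
- by move=> x y Rxy; apply: fR; exact: sub_roots.
- by move=> x /DE[y Rxy]; rewrite (fR _ _ Rxy); apply/rE.
Qed.

(** * Ranks of isolated subgroups *)

Notation gens s := (subgroup_gen [set x | x \in s]).

Section Generators.
Variable G : groupType.
Implicit Types (x y g : G) (N : set G) (s l : seq G).

Lemma gens_cons_min B y s : subgroup B -> B y -> gens s `<=` B -> gens (y :: s) `<=` B.
Proof.
move=> sB By sB'; apply: (gen_min sB) => x /=; rewrite inE => /orP[/eqP -> //|xs].
by apply: sB'; apply: sub_gen.
Qed.

Lemma gens_head y s : gens (y :: s) y.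
Proof. by apply: sub_gen => /=; rewrite inE eqxx. Qed.

Lemma gens_nil x : gens ([::] : seq G) x -> x = 1.
Proof. by move=> /(_ [set 1]); apply; split=> //; exact: subgroup1. Qed.

Lemma centralizer_mod N x : normal_subgroup N -> subgroup [set g | N [~ x, g]].
Proof.
case=> sN nN; apply: subgroup_intro => [|u v Nu Nv|u Nu] /=.
- by rewrite commg1; apply: (sub1 sN).
- by rewrite commMr; apply: (subM sN) => //; apply: nN.
- rewrite -[X in N X]invgK invgR; apply: (subV sN).
  by rewrite commVl invgR; apply: nN.
Qed.

Lemma centralizer_modl N A : normal_subgroup N ->
  subgroup [set u | forall g, A g -> N [~ u, g]].
Proof.
case=> sN nN; apply: subgroup_intro => [g _|u v Nu Nv g Ag|u Nu g Ag] /=.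
- by rewrite comm1g; apply: (sub1 sN).
- by rewrite commMl; apply: (subM sN); [apply: nN; apply: Nu | apply: Nv].
- by rewrite commVl; apply: nN; apply: (subV sN); apply: Nu.
Qed.

(** Each entry normalizes the subgroup generated by the entries after it, so the
    subgroups generated by the suffixes form a series with cyclic factors. *)
Fixpoint polycyclic l :=
  if l is y :: l' then
    polycyclic l' /\ forall u, gens l' u -> gens l' (u ^ y) /\ gens l' (u ^ y^-1)
  else True.

(** Commutators are bilinear modulo the next term, so the commutators of generators
    suffice. Generation modulo the next term is expressed through the subgroups [B]
    containing that term. *)
Lemma lower_central_gens s k : (forall x, gens s x) ->
  exists2 t : seq G, (forall x, x \in t -> lower_central k x) &
    forall B, subgroup B -> lower_central k.+1 `<=` B ->
      (forall x, x \in t -> B x) -> lower_central k `<=` B.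
Proof.
move=> sG; elim: k => [|k [t tL tB]].
  by exists s => // B sB _ Bs x _; apply: (gen_min sB) (sG x).
exists [seq [~ u, g] | u <- t, g <- s].
  by move=> _ /allpairsP[[u g] [/= ut _ ->]]; apply: lower_central_comm; apply: tL.
move=> B sB LB Bt.
pose N : set G := B `&` lower_central k.+1.
have nN : normal_subgroup N.
  split; first exact: subgroupI (lower_central_sub _ _).
  move=> x y [Bx Lx]; split; last exact: (proj2 (lower_central_normal _ _)).
  have -> : x ^ y = x * [~ x, y] by rewrite /commg mulVKg.
  by apply: (subM sB) => //; apply: LB; apply: (lower_central_comm (i := k.+1)).
have uP u : u \in t -> forall g, N [~ u, g].
  move=> ut g; apply: (gen_min (centralizer_mod u nN)) (sG g) => h /= hs; split.
    by apply: Bt; apply/allpairsP; exists (u, h).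
  by apply: lower_central_comm; apply: tL.
have LN u : lower_central k u -> forall g, setT g -> N [~ u, g].
  apply: (tB _ (centralizer_modl setT nN)) => [v Lv g _|v vt g _]; last exact: uP.
  have Lv' := lower_central_comm g Lv; split; first exact: LB.
  exact: lower_central_le.
by apply/comm_sub_le => // u g Lu _; case: (LN u Lu g I).
Qed.

(** Generators of the terms of the lower central series are concatenated from the
    last term upwards; a subgroup lying between two consecutive terms is normal. *)
Lemma exists_polycyclic c s : nil_class G c -> (forall x, gens s x) ->
  exists2 l, polycyclic l & forall x, gens l x.
Proof.
move=> nG sG.
suff H k : (k <= c) -> exists2 l, polycyclic l & gens l = @lower_central G (c - k)%N.
  by have [l pl lE] := H c (leqnn c); exists l => // x; rewrite lE subnn.
elim: k => [_|k IH kc].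
  exists [::] => //; rewrite subn0 (proj2 (nilP G c) nG); apply/seteqP; split.
    exact: gens_nil.
  by move=> _ ->; apply: sub1; apply: subgroup_genP.
have [l pl lE] := IH (ltnW kc); set i := (c - k.+1)%N.
have ci : (c - k)%N = i.+1 by rewrite /i subnSK.
rewrite ci in lE; have [t tL tB] := lower_central_gens i sG.
have ll : gens l `<=` lower_central i by rewrite lE; apply: lower_central_le.
suff [p1 p2] : polycyclic (t ++ l) /\ gens (t ++ l) `<=` lower_central i.
  exists (t ++ l) => //; apply/seteqP; split=> //; apply: tB.
  - exact: subgroup_genP.
  - by rewrite -lE; apply: gen_mono => x /= xl; rewrite mem_cat xl orbT.
  - by move=> x xt; apply: sub_gen; rewrite /= mem_cat xt.
elim: t tL {tB} => //= y t IHt tL; have [x xt|pt gt] := IHt.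
  by apply: tL; rewrite inE xt orbT.
have Ly : lower_central i y by apply: tL; rewrite inE eqxx.
split; last by apply: gens_cons_min => //; apply: lower_central_sub.
split=> // u gu.
have stl := subgroup_genP [set x | x \in t ++ l].
have cu z : gens (t ++ l) (u ^ z).
  have -> : u ^ z = u * [~ u, z] by rewrite /commg mulVKg.
  apply: (subM stl) => //.
  have : lower_central i.+1 [~ u, z] by apply: lower_central_comm; apply: gt.
  by rewrite -lE; apply: gen_mono => x /= xl; rewrite mem_cat xl orbT.
by split; apply: cu.
Qed.

Section Cyclic.
Variables (y : G) (l : seq G).
Hypothesis yl : forall u, gens l u -> gens l (u ^ y) /\ gens l (u ^ y^-1).

Let sl : subgroup (gens l) := subgroup_genP _.

Lemma normX u n : gens l u -> gens l (u ^ (y ^+ n)) /\ gens l (u ^ (y ^- n)).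
Proof.
elim: n u => [|n IH] u lu; first by rewrite expg0 invg1 conjg1.
have [lu1 lu2] := IH u lu; rewrite {1}expgSr expgS invgM !conjgM.
by split; [case: (yl lu1) | case: (yl lu2)].
Qed.

Lemma gens_cyclic x : gens (y :: l) x ->
  exists n u, gens l u /\ (x = y ^+ n * u \/ x = y ^- n * u).
Proof.
pose B := [set x | exists a b u, gens l u /\ x = y ^- b * y ^+ a * u].
have cyy a b : commute (y ^- b) (y ^+ a).
  by apply: commuteX; apply/commute_sym; apply: commuteV; apply: commuteX.
have nab a b u : gens l u -> gens l (u ^ (y ^- b * y ^+ a)).
  by move=> lu; rewrite conjgM; have [_ /(normX a) []] := normX b lu.
have BE : gens (y :: l) `<=` B.
  apply: gens_cons_min => [||u lu].
  - apply: subgroup_intro.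
    + by exists 0%N, 0%N, 1; split; [apply: (sub1 sl) | rewrite !expg0 invg1 !mulg1].
    + move=> _ _ [a [b [u [lu ->]]]] [a' [b' [v [lv ->]]]].
      exists (a + a')%N, (b' + b)%N, (u ^ (y ^- b' * y ^+ a') * v); split.
        by apply: (subM sl) => //; apply: nab.
      rewrite !expgnDr invgM -[LHS]mulgA (mulgA u) (conjgC u) !mulgA; congr (_ * _ * _).
      rewrite -(mulgA _ (y ^+ a)) -(cyy a b') !mulgA; congr (_ * _).
    + move=> _ [a [b [u [lu ->]]]].
      exists b, a, ((u^-1) ^ (y ^- a * y ^+ b)); split; first by apply: nab; apply: (subV sl).
      by rewrite -conjgC !invgM invgK.
  - by exists 1%N, 0%N, 1; split; [apply: (sub1 sl) | rewrite expg0 invg1 mul1g mulg1].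
  - by exists 0%N, 0%N, u; split=> //; rewrite !expg0 invg1 !mul1g.
move=> /BE [a [b [u [lu ->]]]].
have [ab|ba] := leqP b a.
  exists (a - b)%N, u; split=> //; left.
  by rewrite cyy -expgnFr.
exists (b - a)%N, u; split=> //; right.
by rewrite expgnFr ?(ltnW ba) // invgM invgK cyy.
Qed.

Lemma mod_cyclicX n u m : gens l u ->
  exists2 v, gens l v & (y ^+ n * u) ^+ m = y ^+ (n * m) * v.
Proof.
move=> lu; elim: m => [|m [v lv IH]].
  by exists 1; [apply: (sub1 sl) | rewrite muln0 !expg0 mulg1].
exists (u ^ y ^+ (n * m) * v); first by apply: (subM sl) => //; case: (normX (n * m) lu).
rewrite expgS IH mulnS expgnDr -!mulgA; congr (_ * _). by rewrite mulVKg.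
Qed.

End Cyclic.

Definition isolated A := subgroup A /\ forall x n, (0 < n) -> A (x ^+ n) -> A x.

(** A rank detecting inclusions between isolated subgroups; it exists because a
    nilpotent finitely generated group has a series with cyclic factors, and an
    isolated subgroup is determined by the factors on which it is nontrivial. *)
Lemma polycyclic_rank l : polycyclic l ->
  exists (r : set G -> nat) d, [/\ forall A, (r A <= d),
    forall A B, A `<=` B -> (r A <= r B)
  & forall A B, isolated A -> isolated B -> A `<=` B -> (r B <= r A) ->
      B `&` gens l `<=` A].
Proof.
elim: l => [_|y l IH /= [/IH[r [d [rd rm rs]]] yl]].
  exists (fun=> 0%N), 0%N; split=> // A B [sA _] _ _ _ x [_ /gens_nil ->].
  exact: sub1.
pose e A := `[< exists2 x, A x /\ gens (y :: l) x & ~ roots (gens l) x >].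
have em A B : A `<=` B -> (e A <= e B).
  move=> AB; rewrite /e; case: asboolP => // -[x [Ax lx] rx].
  by case: asboolP => // -[]; exists x => //; split=> //; apply: AB.
exists (fun A => r A + e A)%N, d.+1; split.
- by move=> A; rewrite -addn1 leq_add // leq_b1.
- by move=> A B AB; apply: leq_add; [apply: rm | apply: em].
move=> A B iA iB AB rAB b [Bb lb].
have rBA : (r B <= r A).
  by have := em A B AB; have := rm A B AB; lia.
have eBA : (e B <= e A).
  by have := em A B AB; have := rm A B AB; lia.
have BlA : B `&` gens l `<=` A by exact: rs.
have [sA tA] := iA; have [sB tB] := iB.
have [[n n0 lbn]|nlb] := pselect (roots (gens l) b).
  by apply: (tA _ n) => //; apply: BlA; split=> //; apply: subX.
have eA : e A.
  suff: e B by move: eBA; case: (e B) => //; case: (e A).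
  by apply/asboolP; exists b.
move/asboolP: eA => [a [Aa la] nla].
have wlogpos (C : set G) x : subgroup C -> C x -> gens (y :: l) x -> ~ roots (gens l) x ->
  exists n u, [/\ (0 < n), gens l u, C (y ^+ n * u) & forall D, subgroup D -> (D (y ^+ n * u) <-> D x)].
  move=> sC Cx /(gens_cyclic yl)[n [u [lu xE]]] nx.
  have n0 : (0 < n).
    rewrite lt0n; apply/eqP => n0; apply: nx; apply: sub_roots.
    by case: xE => ->; rewrite n0 expg0 ?invg1 mul1g.
  case: xE => xE; first by exists n, u; rewrite -xE; split.
  exists n, (u^-1 ^ y ^+ n); rewrite -conjgC.
  have -> : u^-1 * y ^+ n = x^-1 by rewrite xE invgM invgK.
  split=> //; first by have [] := normX yl n (subV (subgroup_genP _) lu).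
    exact: subV.
  by move=> D sD; split=> [/(subV sD)|/(subV sD) //]; rewrite invgK.
have [n [u [n0 lu An _]]] := wlogpos A a sA Aa la nla.
have [m [v [m0 lv Bm bE]]] := wlogpos B b sB Bb lb nlb.
apply/(bE A sA); apply: (tA _ n) => //.
have [u' lu' uE] := mod_cyclicX yl n m lu.
have [v' lv' vE] := mod_cyclicX yl m n lv.
have Au : A (y ^+ (n * m) * u') by rewrite -uE; apply: subX.
have Bv : B (y ^+ (m * n) * v') by rewrite -vE; apply: subX.
rewrite vE; have -> : y ^+ (m * n) * v' = y ^+ (n * m) * u' * (u'^-1 * v').
  by rewrite mulnC !gnorm.
apply: (subM sA) => //; apply: BlA; split; last first.
  exact: (subM (subgroup_genP _) (subV (subgroup_genP _) lu') lv').
have -> : u'^-1 * v' = (y ^+ (n * m) * u')^-1 * (y ^+ (m * n) * v').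
  by rewrite mulnC !gnorm.
by apply: (subM sB) => //; apply: (subV sB); apply: AB.
Qed.

End Generators.

(** * Residual properties of finitely generated nilpotent groups *)

Section PTorsion.
Variables (G : groupType) (p : nat).
Hypothesis p_pr : prime p.
Implicit Types (x y z g : G) (N : set G) (s : seq G).

Definition p_root N x := exists k, N (x ^+ (p ^ k)).

Lemma p_root_leq N x k k' : subgroup N -> (k <= k') ->
  N (x ^+ (p ^ k)) -> N (x ^+ (p ^ k')).
Proof. by move=> sN kk Nx; rewrite -(subnK kk) expnD mulnC expgnA; apply: subX. Qed.

Lemma mod_commX N x g n : normal_subgroup N -> N [~ [~ x, g], x] ->
  N ([~ x, g] ^+ n) -> N [~ x ^+ n, g].
Proof.
move=> nN Nc; have [Q [q [hq _ kq]]] := exists_quotient nN.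
move=> /kq Nx; apply/kq; rewrite (homR hq) (homX hq) commXl; last first.
  by apply/commute_sym/commgP; rewrite -!(homR hq); apply/eqP/kq.
by rewrite -(homR hq) -(homX hq).
Qed.

Lemma set1_normal : normal_subgroup [set 1 : G].
Proof. by split=> [|x y /= ->]; [exact: subgroup1 | rewrite conj1g]. Qed.

(** Sending x to its commutators with the generators is a homomorphism modulo a
    term of the upper central series; hence p-torsion passes from each factor of
    that series to the next one. *)
Lemma p_torsion_center c s : nil_class G c -> (forall x, gens s x) ->
  (forall z, (forall y, commute z y) -> p_root [set 1] z) ->
  forall x, p_root [set 1] x.
Proof.
move=> nG sG Zp; pose U := uc [set 1 : G].
have nU k : normal_subgroup (U k) by apply: uc_normal; exact: set1_normal.
have step k : forall x, U k.+1 x -> p_root (U k) x.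
  elim: k => [|k IH] x /ucS Hx.
    rewrite /U uc0; apply: Zp => y; apply/commgP/eqP.
    by have := Hx y; rewrite uc0.
  have [j jP] : exists j, forall t, t \in s -> U k ([~ x, t] ^+ (p ^ j)).
    elim: (s) => [|t s' [j jP]]; first by exists 0%N.
    have [i iP] := IH _ (Hx t); exists (maxn i j) => t'; rewrite inE => /orP[/eqP ->|ts].
      by apply: (p_root_leq (proj1 (nU k)) (leq_maxl _ _) iP).
    by apply: (p_root_leq (proj1 (nU k)) (leq_maxr _ _)); apply: jP.
  exists j; apply/ucS => g.
  apply: (gen_min (centralizer_mod _ (nU k))) (sG g) => t /= ts.
  apply: (mod_commX (nU k)); last exact: jP.
  by have /ucS := Hx t; apply.
have all k : forall x, U k x -> p_root [set 1] x.
  elim: k => [|k IH] x; first by rewrite /U uc0 => ->; exists 0%N.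
  by move=> /step [j /IH [i xji]]; exists (j + i)%N; rewrite expnD expgnA.
by move=> x; apply: (all c) => t st; apply: nG.
Qed.

End PTorsion.

Section PQuotient.
Variables (G : groupType) (p : nat).
Hypothesis p_pr : prime p.
Implicit Types (N : set G) (s : seq G).

(** A maximal normal subgroup containing no power of [g] with exponent prime to
    p: modulo it, the centre is p-torsion because each nontrivial central
    subgroup contains such a power of [g]. *)
Lemma exists_p_quotient c s g : nil_class G c -> (forall x, gens s x) ->
  (forall m, (0 < m) -> g ^+ m <> 1) ->
  exists N, [/\ normal_subgroup N, ~ N g & forall x, p_root p N x].
Proof.
move=> nG sG go.
pose ok A := normal_subgroup A /\ forall m, ~~ (p %| m) -> ~ A (g ^+ m).
have ok1 : ok [set 1].
  split=> [|m pm]; first exact: set1_normal.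
  by apply: go; rewrite lt0n; apply: contraNneq pm => ->; rewrite dvdn0.
have [|N [NP Nmax]] := @Zorn_bigcup G (fun A => ok A \/ A = set0).
  move=> F FP totF; have [[A FA [z Az]]|F0] := pselect (exists2 A, F A & exists z, A z); last first.
    right; apply/seteqP; split=> // z [A FA Az]; case: F0; exists A => //; by exists z.
  have okF B w : F B -> B w -> ok B.
    by move=> FB Bw; case: (FP _ FB) => // B0; move: Bw; rewrite B0.
  left; split; last by move=> m pm [B FB Bg]; have [_] := okF _ _ FB Bg; apply; eauto.
  split.
    apply: subgroup_intro => [|x y [B FB Bx] [C FC Cy]|x [B FB Bx]].
    + by exists A => //; apply: sub1; case: (okF _ _ FA Az) => -[].
    + have [BC|CB] := totF _ _ FB FC.
        by exists C => //; apply: subM => //; [case: (okF _ _ FC Cy) => -[] | exact: BC].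
      by exists B => //; apply: subM => //; [case: (okF _ _ FB Bx) => -[] | exact: CB].
    + by exists B => //; apply: subV => //; case: (okF _ _ FB Bx) => -[].
  by move=> x y [B FB Bx]; exists B => //; have [[_ nB] _] := okF _ _ FB Bx; apply: nB.
have [nN Ng] : ok N.
  case: NP => // N0; case: (Nmax [set 1]); last by left.
  by rewrite N0; split=> // h; have := h 1 erefl.
exists N; split=> //; first by rewrite -[g]expg1; apply: Ng; rewrite dvdn1; case: eqP p_pr => // ->.
have [Q [q [hq qs kq]]] := exists_quotient nN.
pose gq := q g.
have gqE m : ~~ (p %| m) -> gq ^+ m <> 1.
  by move=> pm; rewrite -(homX hq) => /kq; apply: Ng.
have gqeq m n : (m <= n) -> ~~ (p %| n - m)%N -> gq ^+ m <> gq ^+ n.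
  by move=> mn pmn e; apply: (gqE _ pmn); rewrite expgnFr // -e mulgV.
have Qmax (z : Q) : (forall y : Q, commute z y) -> z <> 1 ->
    exists m a b, ~~ (p %| m) /\ gq ^+ m * z ^+ b = z ^+ a.
  move=> cz z1; pose M := [set x | exists a b, q x * z ^+ b = z ^+ a].
  have czX b (y : Q) : commute (z ^+ b) y by apply/commute_sym/commuteX/commute_sym.
  have nM : normal_subgroup M.
    split; first apply: subgroup_intro => [|x y [a [b xab]] [a' [b' yab]]|x [a [b xab]]].
    + by exists 0%N, 0%N; rewrite (hom1 hq) mulg1.
    + exists (a + a')%N, (b + b')%N; rewrite hq !expgnDr -xab -yab.
      by rewrite !mulgA; congr (_ * _); rewrite -!mulgA; congr (_ * _); apply/commute_sym.
    + exists b, a; rewrite (homV hq) -xab mulKg //.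
    + move=> x y [a [b xab]]; exists a, b; rewrite (homJ hq) /conjg.
      have -> : (q y)^-1 * (q x * q y) * z ^+ b = (q y)^-1 * (q x * z ^+ b) * q y.
        by rewrite -!mulgA (czX b).
      by rewrite xab -mulgA czX mulKg.
  have [m [pm [a [b e]]]] : exists m, ~~ (p %| m) /\ M (g ^+ m).
    apply: contrapT => h; apply: (Nmax M); last by left; split=> // m pm Mg; apply: h; exists m.
    split=> [x /kq qx|MN]; first by exists 0%N, 0%N; rewrite qx mulg1.
    have [w wz] := qs z; apply: z1; rewrite -wz; apply/kq; apply: MN.
    by exists 1%N, 0%N; rewrite mulg1.
  by exists m, a, b; rewrite -(homX hq).
have Zp (z : Q) : (forall y : Q, commute z y) -> exists2 e, (0 < e) & z ^+ e = 1.
  move=> cz; have [->|z1] := pselect (z = 1); first by exists 1%N; rewrite // expg1n.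
  have [m [a [b [pm e]]]] := Qmax z cz z1.
  have czX i (y : Q) : commute (z ^+ i) y by apply/commute_sym/commuteX/commute_sym.
  pose h := gq ^+ m; have hE : h = z ^+ a * z ^- b by rewrite -e mulgK.
  have ch (y : Q) : commute h y.
    rewrite hE; apply/commute_sym; apply: commuteM; first exact/commute_sym.
    by apply: commuteV; apply/commute_sym.
  have hp : h ^+ p = 1.
    apply: contrapT => hp1.
    have [m' [a' [b' [pm' e']]]] := Qmax (h ^+ p) (fun y => commute_sym (commuteX p (commute_sym (ch y)))) hp1.
    move: e'; rewrite /h -!expgnA -expgnDr.
    set u := (m' + _)%N; set v := (m * (p * a'))%N => uv.
    have [uv'|vu'] := leqP u v.
      apply: (gqeq u v) => //; apply: contra pm' => puv.
      have pv : (p %| v) by rewrite /v mulnCA dvdn_mulr.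
      have pu : (p %| u) by rewrite -(dvdn_addr _ puv) subnK.
      by move: pu; rewrite /u dvdn_addl // mulnCA dvdn_mulr.
    apply: (gqeq v u) => //; first exact: ltnW.
    apply: contra pm' => puv.
    have pv : (p %| v) by rewrite /v mulnCA dvdn_mulr.
    have pu : (p %| u) by rewrite -(subnK (ltnW vu')) dvdn_add.
    by move: pu; rewrite /u dvdn_addl // mulnCA dvdn_mulr.
  have ab : a != b.
    apply/eqP => ab; apply: (gqE _ pm); rewrite -/h hE ab mulgV //.
  have zab : z ^+ (a * p) = z ^+ (b * p).
    rewrite !expgnA -e expgMn; last exact: ch.
    by rewrite -/h hp mul1g.
  have [lt|lt|abE] := ltngtP a b; last by rewrite abE eqxx in ab.
    exists (b * p - a * p)%N; first by rewrite subn_gt0 ltn_pmul2r ?prime_gt0.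
    by rewrite expgnFr ?zab ?mulgV // leq_mul2r (ltnW lt) orbT.
  exists (a * p - b * p)%N; first by rewrite subn_gt0 ltn_pmul2r ?prime_gt0.
  by rewrite expgnFr ?zab ?mulgV // leq_mul2r (ltnW lt) orbT.
have Zt (z : Q) : (forall y : Q, commute z y) -> p_root p [set 1] z.
  move=> cz; have [e e0 ze] := Zp z cz.
  have [n pn en] := pfactor_coprime p_pr e0; set k := logn p e in en.
  exists k => /=; apply: contrapT => z1.
  have czk (y : Q) : commute (z ^+ (p ^ k)) y by apply/commute_sym/commuteX/commute_sym.
  have [m [a [b [pm mE]]]] := Qmax _ czk z1.
  have zn : (z ^+ (p ^ k)) ^+ n = 1 by rewrite -expgnA mulnC -en.
  have pmn : ~~ (p %| m * n)%N by rewrite Euclid_dvdM // negb_or pm -prime_coprime.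
  apply: (gqE _ pmn).
  rewrite expgnA; have -> : gq ^+ m = (z ^+ (p ^ k)) ^+ a * (z ^+ (p ^ k)) ^- b.
    by rewrite -mE mulgK.
  rewrite expgMn; last by apply/commuteV/commuteX2.
  by rewrite expVgn (expgnAC _ a) (expgnAC _ b) zn !expg1n invg1 mulg1.
move=> x; have [k xk] : p_root p [set 1] (q x).
  apply: (p_torsion_center (c := c) (s := map q s)); [exact (nil_surj hq qs nG)| |exact: Zt].
  move=> y; have [w <-] := qs y.
  apply: (gen_min (hom_preimage hq (subgroup_genP _))) (sG w) => t ts.
  by apply: sub_gen; apply: map_f.
by exists k; apply/kq; rewrite (homX hq).
Qed.

End PQuotient.
(** * Embedding torsion-free nilpotent groups in Q-powered groups *)

Definition lazard_Q (G : groupType) c (P : nat -> set G) :=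
  [/\ Q_powered G, nil_class G c, lazard_series c P
    & forall i, (0 < i) -> Q_powered_subgroup (P i)].

(** Modulo [N] the exponent [a] inverts [n], because [n] is prime to the orders of x
    and y, which are powers of p. Using the same exponent for both elements gives the
    uniqueness of roots. *)
Lemma modular_root (G : groupType) (N : set G) (p n : nat) x y :
  prime p -> (0 < n < p) -> normal_subgroup N -> p_root p N x -> p_root p N y ->
  exists a, N (x^-1 * (x ^+ a) ^+ n) /\ N (y^-1 * (y ^+ a) ^+ n).
Proof.
move=> p_pr /andP[n0 np] [sN nN] [j Nx] [k Ny].
have co : coprime n (p ^ (maxn j k)).
  apply: coprimeXr; rewrite coprime_sym prime_coprime //.
  by apply/negP => /(dvdn_leq n0); rewrite leqNgt np.
have [a b ab _] := egcdnP (p ^ (maxn j k)) n0.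
move: ab; rewrite (eqP co) => ab; exists a.
have key (z : G) : N (z ^+ (p ^ (maxn j k))) -> N (z^-1 * (z ^+ a) ^+ n).
  move=> Nz; rewrite -expgnA ab expgnDr expg1 mulnC expgnA.
  exact: (nN _ z (subX b sN Nz)).
by split; apply: key; [apply: p_root_leq Nx => //; exact: leq_maxl
                      | apply: p_root_leq Ny => //; exact: leq_maxr].
Qed.

(** A reduced product of p-torsion quotients of [G]: the functions of g and p are
    compared at (g, p) in a p-torsion quotient where g survives, and two functions
    are identified when for each g they agree for all large primes p. As soon as p is
    larger than n, the n-th roots exist and are unique in the factors, so they are in
    the reduced product. The constant functions embed [G], and the functions with
    values in the terms of the lower central series form a Lazard series. *)
Theorem embed_in_Qpowered (G : groupType) c (s : seq G) :
  nil_class G c -> torsion_free G -> (forall x : G, gens s x) ->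
  exists (U : groupType) (i : G -> U) (P : nat -> set U),
    [/\ lazard_Q c P, hom i & injective i].
Proof.
move=> nG tG sG.
have [N NP] : {N : G -> nat -> set G & forall g p, g <> 1 -> prime p ->
    [/\ normal_subgroup (N g p), ~ N g p g & forall x, p_root p (N g p) x]}.
  suff H g : {N : nat -> set G & forall p, g <> 1 -> prime p ->
    [/\ normal_subgroup (N p), ~ N p g & forall x, p_root p (N p) x]}.
    by exists (fun g => projT1 (H g)) => g; exact: projT2 (H g).
  apply: (@boolp.choice _ _ (fun p A => g <> 1 -> prime p ->
    [/\ normal_subgroup A, ~ A g & forall x, p_root p A x])) => p.
  have [[g1 pp]|h] := pselect (g <> 1 /\ prime p).
    have [|N NP] := exists_p_quotient pp nG sG (g := g); last by exists N.
    by move=> m m0 /(tG g m m0).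
  by exists set0 => g1 pp; case: h.
pose T := G -> nat -> G.
pose mul (x y : T) : T := fun g p => x g p * y g p.
pose inv (x : T) : T := fun g p => (x g p)^-1.
pose one : T := fun _ _ => 1.
pose e (x y : T) := forall g, g <> 1 -> exists p0, forall p, (p0 <= p) -> prime p ->
  N g p ((x g p)^-1 * y g p).
have nN g p : g <> 1 -> prime p -> normal_subgroup (N g p) by move=> g1 pp; case: (NP g p g1 pp).
have e2 (x y z t u v : T) : (forall g p, g <> 1 -> prime p -> N g p ((x g p)^-1 * y g p) ->
    N g p ((z g p)^-1 * t g p) -> N g p ((u g p)^-1 * v g p)) -> e x y -> e z t -> e u v.
  move=> H xy zt g g1; have [p1 h1] := xy g g1; have [p2 h2] := zt g g1.
  exists (maxn p1 p2) => p; rewrite geq_max => /andP[pp1 pp2] pp.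
  by apply: H => //; [apply: h1 | apply: h2].
have e0 (x y : T) : (forall g p, x g p = y g p) -> e x y.
  move=> xy g g1; exists 0%N => p _ pp; rewrite xy mulVg.
  exact: sub1 (proj1 (nN g p g1 pp)).
have [| | | | | | |U [q [qm qs qe]]] := @exists_quot T mul inv one e.
- by move=> x; exact: e0.
- move=> x y xy; apply: (e2 _ _ _ _ _ _ _ xy xy) => g p g1 pp Nxy _.
  by have := subV (proj1 (nN g p g1 pp)) Nxy; rewrite invgM invgK.
- move=> x y z; apply: e2 => g p g1 pp h1 h2.
  by have := subM (proj1 (nN g p g1 pp)) h1 h2; rewrite mulgA mulgK.
- move=> x x' y y'; apply: e2 => g p g1 pp h1 h2; have [sN cN] := nN g p g1 pp.
  have -> : (mul x y g p)^-1 * mul x' y' g p =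
      ((x g p)^-1 * x' g p) ^ (y g p) * ((y g p)^-1 * y' g p).
    by rewrite /mul /conjg invgM !mulgA mulgK.
  by apply: (subM sN) => //; apply: cN.
- by move=> x y z; apply: e0 => g p; exact: mulgA.
- by move=> x; apply: e0 => g p; exact: mul1g.
- by move=> x; apply: e0 => g p; exact: mulVg.
have q1 : q one = 1.
  apply: (@mulgI _ (q one)); rewrite mulg1 -qm; congr q.
  by apply/funext => g; apply/funext => p; exact: mulg1.
have qV x : q (inv x) = (q x)^-1.
  apply: (@mulgI _ (q x)); rewrite mulgV -qm -q1; congr q.
  by apply/funext => g; apply/funext => p; exact: mulgV.
have qX x n : q (fun g p => x g p ^+ n) = q x ^+ n.
  elim: n => [|n IH]; first by rewrite expg0 -q1.
  rewrite expgS -IH -qm; congr q; apply/funext => g; apply/funext => p.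
  by rewrite expgS.
have qR x y : q (fun g p => [~ x g p, y g p]) = [~ q x, q y].
  by rewrite /commg /conjg -!qV -!qm.
have nU : nil_class U c.
  move=> u t st; have [x <-] := qs u.
  have [s' s'E] := map_lift (fun z (_ : z \in t) => qs z).
  have icE (x' : T) (l : seq T) :
      q (fun g p => icomm (x' g p) [seq y g p | y <- l]) = icomm (q x') (map q l).
    by elim: l x' => //= y l IH x'; rewrite -qR -IH.
  rewrite -s'E -icE -q1; congr q; apply/funext => g; apply/funext => p.
  by apply: nG; rewrite size_map -st -s'E size_map.
have modroot n (x y : T) : (0 < n) -> e (fun g p => x g p ^+ n) (fun g p => y g p ^+ n) -> e x y.
  move=> n0 xy g g1; have [p0 h0] := xy g g1.
  exists (maxn p0 n.+1) => p; rewrite geq_max => /andP[pp0 pn] pp.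
  have [[sN cN] _ Nt] := NP g p g1 pp.
  have np : (0 < n < p) by rewrite n0.
  have [a [xa ya]] := modular_root pp np (nN g p g1 pp) (Nt (x g p)) (Nt (y g p)).
  have [Q [f [hf _ kf]]] := exists_quotient (nN g p g1 pp).
  have fE z w : N g p (z^-1 * w) <-> f z = f w.
    rewrite -kf hf (homV hf); split=> [/mulg1_eq|->]; last by rewrite mulVg.
    by rewrite invgK.
  apply/fE; move/fE: xa => ->; move/fE: ya => ->.
  by rewrite !(expgnAC _ a) (homX hf) [in RHS](homX hf); congr (_ ^+ a); apply/fE; apply: h0.
have rootP (x : T) n : (0 < n) -> exists y : T,
    (forall A : set G, subgroup A -> (forall g p, A (x g p)) -> forall g p, A (y g p)) /\
    e x (fun g p => y g p ^+ n).
  move=> n0.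
  have [y yP] : {y : G -> nat -> G & forall g p, (exists a, y g p = x g p ^+ a) /\
      (g <> 1 -> prime p -> (n < p) -> N g p ((x g p)^-1 * y g p ^+ n))}.
    suff H g : {y : nat -> G & forall p, (exists a, y p = x g p ^+ a) /\
      (g <> 1 -> prime p -> (n < p) -> N g p ((x g p)^-1 * y p ^+ n))}.
      by exists (fun g => projT1 (H g)) => g; exact: projT2 (H g).
      apply: (@boolp.choice _ _ (fun p z => (exists a, z = x g p ^+ a) /\
      (g <> 1 -> prime p -> (n < p) -> N g p ((x g p)^-1 * z ^+ n)))) => p.
    have [[g1 [pp np]]|h] := pselect (g <> 1 /\ prime p /\ (n < p)); last first.
      by exists (x g p ^+ 0); split; [exists 0%N | move=> g1 pp np; case: h].
    have [_ _ Nt] := NP g p g1 pp.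
    have n0p : (0 < n < p) by rewrite n0.
    have [a [xa _]] := modular_root pp n0p (nN g p g1 pp) (Nt (x g p)) (Nt (x g p)).
    by exists (x g p ^+ a); split=> //; exists a.
  exists y; split=> [A sA Ax g p|g g1].
    by have [[a ->] _] := yP g p; apply: subX.
  by exists n.+1 => p np pp; have [_] := yP g p; apply.
have QU : Q_powered U.
  have inj n (u v : U) : (0 < n) -> u ^+ n = v ^+ n -> u = v.
    move=> n0; have [x <-] := qs u; have [y <-] := qs v.
    by rewrite -!qX => /qe /(modroot _ _ _ n0) /qe.
  split=> [u n n0 un|u n n2]; first by apply: (inj n) => //; rewrite expg1n.
  have [x <-] := qs u; have [y [_ /qe xy]] := rootP x n (ltnW n2).
  exists (q y); split; first by rewrite -qX -xy.
  by move=> v vx; apply: (inj n); rewrite ?(ltnW n2) // vx -qX xy.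
have [L1 L2 L3 L4 L5] := lower_central_series (proj2 (nilP G c) nG).
pose P i : set U := [set u | exists2 x, (forall g p, lower_central i.-1 (x g p)) & q x = u].
have sP i : (0 < i) -> subgroup (P i).
  move=> i0; have sL := L1 i i0.
  apply: subgroup_intro => [|_ _ [x Lx <-] [y Ly <-]|_ [x Lx <-]].
  - by exists one => // g p; apply: (sub1 sL).
  - by exists (mul x y) => // g p; apply: (subM sL).
  - by exists (inv x) => // g p; apply: (subV sL).
exists U, (fun x => q (fun _ _ => x)), P; split.
- split=> //; last first.
    move=> i i0; split=> [|_ n n2 [x Lx <-]]; first exact: sP.
    have [y [yL xy]] := rootP x n (ltnW n2); exists (q y).
      by exists y => //; apply: yL => //; exact: L1.
    by rewrite -qX; apply/esym/qe.
  split=> //.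
  + by apply/seteqP; split=> // u _; have [x <-] := qs u; exists x.
  + by move=> i i0 _ [x Lx <-]; exists x => // g p; apply: L3.
  + move=> k ck; apply/seteqP; split=> [_ [x Lx <-]|_ ->].
      rewrite /= -q1; congr q; apply/funext => g; apply/funext => p.
      by have := Lx g p; rewrite L4.
    by apply: sub1; apply: sP; apply: leq_ltn_trans ck.
  + move=> i j i0 j0; apply/comm_sub_le; first by apply: sP; rewrite addn_gt0 i0.
    move=> _ _ [x Lx <-] [y Ly <-]; exists (fun g p => [~ x g p, y g p]); last exact: qR.
    by move=> g p; apply: (L5 i j) => //; apply: comm_subP.
- by move=> x y; rewrite -qm.
- apply: hom_ker_inj => [x y|x]; first by rewrite -qm.
  rewrite -q1 => /qe h; apply: contrapT => x1; have [p0 hp] := h x x1.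
  have [p p0p pp] := prime_above p0.
  have [[sN _] nx _] := NP x p x1 pp; apply: nx.
  by have := subV sN (hp p (ltnW p0p) pp); rewrite mulg1 invgK.
Qed.

(** * Unitriangular matrices *)

Section Unitriangular.
Import GRing.Theory.

Variables (R : nzRingType) (c : nat).
Local Notation MT := ('M[R]_(c.+1)).

(** The ideals of the filtration by distance from the diagonal. *)
Definition above (i : nat) (A : MT) := forall r s : 'I_c.+1, (s < r + i)%N -> A r s = 0%R.

Lemma above0 i : above i 0%R.
Proof. by move=> r s _; rewrite mxE. Qed.

Lemma aboveD i A B : above i A -> above i B -> above i (A + B)%R.
Proof. by move=> hA hB r s rs; rewrite mxE hA // hB // addr0. Qed.

Lemma aboveN i A : above i A -> above i (- A)%R.
Proof. by move=> hA r s rs; rewrite mxE hA // oppr0. Qed.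

Lemma above_le i j A : (i <= j) -> above j A -> above i A.
Proof. by move=> ij hA r s rs; apply: hA; apply: leq_trans rs _; rewrite leq_add2l. Qed.

Lemma aboveM i j A B : above i A -> above j B -> above (i + j) (A * B)%R.
Proof.
move=> hA hB r s rs; rewrite mxE big1 // => t _.
have [tr|rt] := ltnP t (r + i); first by rewrite hA // mul0r.
rewrite hB ?mulr0 //; apply: leq_trans rs _.
by rewrite addnA leq_add2r.
Qed.

Lemma above_eq0 i A : (c < i) -> above i A -> A = 0%R.
Proof.
move=> ci hA; apply/matrixP => r s; rewrite [RHS]mxE; apply: hA.
by apply: leq_trans (ltn_ord s) _; apply: leq_trans ci (leq_addl _ _).
Qed.

Lemma above1 : above 0 (1 : MT)%R.
Proof. by move=> r s; rewrite addn0 => rs; rewrite mxE -val_eqE gtn_eqF. Qed.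

Lemma above_unit A : above 1 (A - 1)%R -> above 0 A.
Proof.
move=> hA; rewrite -[A](subrK 1%R); apply: aboveD above1.
exact: above_le hA.
Qed.

Lemma above_units (A B : MT) :
  above 1 (A - 1)%R -> above 1 (B - 1)%R -> above 1 (A * B - 1)%R.
Proof.
move=> hA hB.
have -> : (A * B - 1 = A * (B - 1) + (A - 1))%R.
  by rewrite mulrBr mulr1 addrA subrK.
by apply: aboveD => //; apply: (aboveM (i := 0)) => //; apply: above_unit.
Qed.

Definition is_uni (A : MT) := above 1 (A - 1)%R.
Definition uni := {A : MT | is_uni A}.

Definition uni_inv_mx (A : MT) : MT := (\sum_(i < c.+1) (1 - A) ^+ i)%R.

Lemma aboveX n A : above 1 A -> above n (A ^+ n)%R.
Proof.
move=> hA; elim: n => [|n IH]; first by rewrite expr0; exact: above1.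
by rewrite exprS -add1n; apply: aboveM.
Qed.

Lemma uni_mulV A : above 1 (A - 1)%R ->
  (uni_inv_mx A * A = 1)%R /\ above 1 (uni_inv_mx A - 1)%R.
Proof.
move=> hA; have hN : above 1 (1 - A)%R by rewrite -opprB; exact: aboveN.
split.
  have := subrX1 (1 - A)%R c.+1.
  rewrite (above_eq0 (ltnSn c) (aboveX (n := c.+1) hN)) sub0r -/(uni_inv_mx A).
  have -> : (1 - A - 1 = - A)%R by rewrite addrAC subrr sub0r.
  rewrite mulNr => /oppr_inj AV.
  rewrite AV; apply/esym/commr_sum => i _; apply: commrX.
  by apply: commrB; [exact: commr1 | exact: commr_refl].
rewrite /uni_inv_mx big_ord_recl expr0 addrAC subrr add0r.
elim/big_ind: _ => [|B C|i _]; [exact: above0 | exact: aboveD |].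
by rewrite lift0; apply: above_le (aboveX hN).
Qed.

Definition uni_mul (A B : uni) : uni :=
  exist is_uni _ (above_units (svalP A) (svalP B)).
Definition uni_inv (A : uni) : uni :=
  exist is_uni _ (proj2 (uni_mulV (svalP A))).
Lemma uni_one_subproof : above 1 (1 - 1 : MT)%R.
Proof. by rewrite subrr; exact: above0. Qed.
Definition uni_one : uni := exist is_uni _ uni_one_subproof.

Fact uni_mulA : associative uni_mul.
Proof. by move=> A B C; apply: sval_inj; exact: mulrA. Qed.
Fact uni_mul1 : left_id uni_one uni_mul.
Proof. by move=> A; apply: sval_inj; exact: mul1r. Qed.
Fact uni_mulVl : left_inverse uni_one uni_inv uni_mul.
Proof. by move=> A; apply: sval_inj; case: (uni_mulV (svalP A)). Qed.

Definition unitriangular : groupType := group_of uni_mulA uni_mul1 uni_mulVl.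
Local Notation UT := unitriangular.
Definition mx_of (x : UT) : MT := sval x.

Lemma mx_ofM (x y : UT) : mx_of (x * y) = (mx_of x * mx_of y)%R.
Proof. by []. Qed.
Lemma mx_of1 : mx_of 1 = 1%R.
Proof. by []. Qed.
Lemma mx_of_inj : injective mx_of. Proof. exact: sval_inj. Qed.
Lemma mx_ofP (x : UT) : above 1 (mx_of x - 1)%R. Proof. exact: (svalP x). Qed.

Lemma mx_ofX (x : UT) n : mx_of (x ^+ n) = (mx_of x ^+ n)%R.
Proof.
elim: n => [|n IH]; first by rewrite expg0 expr0.
by rewrite expgS mx_ofM IH exprS.
Qed.

(** With u and v the differences of the two matrices to 1, that of the commutator is
    the product of an invertible matrix with u v - v u. *)
Lemma mx_of_comm (x y : UT) i j : above i (mx_of x - 1)%R -> above j (mx_of y - 1)%R ->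
  above (i + j) (mx_of [~ x, y] - 1)%R.
Proof.
move=> hx hy; set u := (mx_of x - 1)%R in hx; set v := (mx_of y - 1)%R in hy.
have -> : (mx_of [~ x, y] - 1 = mx_of (y * x)^-1 * (u * v - v * u))%R.
  have -> : (u * v - v * u = mx_of (x * y) - mx_of (y * x))%R.
    have E (a b : MT) : ((a + 1) * (b + 1) = a * b + (a + b + 1))%R.
      by rewrite mulrDl !mulrDr !mulr1 mul1r !addrA.
    rewrite !mx_ofM -[mx_of x](subrK 1%R) -[mx_of y](subrK 1%R) -/u -/v.
    by rewrite !E (addrC v u) opprD addrACA subrr addr0.
  rewrite mulrBr -!mx_ofM mulVg mx_of1; congr (mx_of _ - _)%R.
  by rewrite /commg /conjg invgM !mulgA.
rewrite -[(i + j)%N]add0n; apply: aboveM; first exact: above_unit (mx_ofP _).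
apply: aboveD; first exact: aboveM.
by apply: aboveN; rewrite addnC; apply: aboveM.
Qed.

Lemma unitriangular_nil : nil_class UT c.
Proof.
suff H s i (x : UT) : above i (mx_of x - 1)%R -> above (i + size s) (mx_of (icomm x s) - 1)%R.
  move=> x s ss; apply: mx_of_inj; apply: (@addIr _ (- 1)%R); rewrite mx_of1 subrr.
  apply: (@above_eq0 c.+1) => //.
  by have := H s 1%N x (mx_ofP x); rewrite ss add1n.
elim: s i x => [|y s IH] i x hx /=; first by rewrite addn0.
by rewrite addnS -addSn; apply: IH; rewrite -addn1; apply: mx_of_comm => //; exact: mx_ofP.
Qed.

Lemma mxMn (A : MT) r s n : ((A *+ n)%R r s = A r s *+ n)%R.
Proof. by elim: n => [|k IHk]; rewrite ?mxE // !mulrS mxE IHk. Qed.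

(** If x = 1 + u, then x ^ n is 1 + n u modulo the next ideal, so u moves away from
    the diagonal step by step. *)
Lemma unitriangular_torsion_free :
  (forall (a : R) n, (0 < n) -> (a *+ n = 0 -> a = 0)%R) -> torsion_free UT.
Proof.
move=> tR x n n0 xn.
suff H i : above i.+1 (mx_of x - 1)%R.
  apply: mx_of_inj; apply: (@addIr _ (- 1)%R); rewrite mx_of1 subrr.
  exact: above_eq0 (H c).
elim: i => [|i IH]; first exact: mx_ofP.
have [u uE'] : exists u, u = (mx_of x - 1)%R by eexists.
rewrite -uE' in IH *; have uE : mx_of x = (1 + u)%R by rewrite uE' addrC subrK.
have h m : above i.+2 (mx_of (x ^+ m) - (1 + u *+ m))%R.
  elim: m => [|m IHm].
    by rewrite expg0 mx_of1 mulr0n addr0 subrr; exact: above0.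
  have [w wE] : exists w, w = (mx_of (x ^+ m) - (1 + u *+ m))%R by eexists.
  rewrite -wE in IHm.
  have mE : mx_of (x ^+ m) = (1 + u *+ m + w)%R by rewrite wE addrC subrK.
  have -> : (mx_of (x ^+ m.+1) - (1 + u *+ m.+1) = mx_of x * w + (u * u) *+ m)%R.
    apply/eqP; rewrite subr_eq; apply/eqP.
    rewrite expgS mx_ofM mE mulrDr {1}uE.
    rewrite mulrDl mul1r mulrDr mulr1 mulrnAr mulrS.
    rewrite [RHS]addrC !addrA. rewrite (addrAC _ (u *+ m)%R u).
    by rewrite (addrAC _ _ (mx_of x * w)%R).
  apply: aboveD; last first.
    have uu : above i.+2 (u * u)%R.
      by apply: above_le (aboveM IH IH); rewrite addSn addnS !ltnS leq_addl.
    elim: (m) => [|k IHk]; first by rewrite mulr0n; exact: above0.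
    by rewrite mulrS; apply: aboveD.
  rewrite -[i.+2]add0n; apply: aboveM => //; exact: above_unit (mx_ofP x).
move=> r s rs; have := h n r s rs; rewrite xn mx_of1 opprD addrA subrr.
rewrite sub0r mxE => /eqP; rewrite oppr_eq0 => /eqP.
by rewrite mxMn; exact: tR.
Qed.

(** The Frobenius map is additive on 1 and a strictly triangular matrix, whose p-th
    power vanishes. *)
Lemma unitriangular_exponent p : prime p -> (c < p) -> (p%:R = 0 :> R)%R -> exponent UT p.
Proof.
move=> p_pr cp pR x; apply: mx_of_inj; rewrite mx_ofX mx_of1.
have pMT : (p%:R = 0 :> MT)%R.
  by apply/matrixP => r s; rewrite mxMn -mulr_natr pR mulr0 mxE.
have cMT : p \in [pchar MT]%R by rewrite inE p_pr pMT eqxx.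
rewrite -[mx_of x](subrK 1%R) -(pFrobenius_autE cMT).
rewrite pFrobenius_autD_comm; last exact: commr1.
rewrite !pFrobenius_autE expr1n.
by rewrite (above_eq0 cp (aboveX (n := p) (mx_ofP x))) add0r.
Qed.

(** The elementary matrices just above the diagonal have nontrivial commutators of
    maximal weight. *)
Definition elem_mx (i j : nat) : MT := (1 + delta_mx (inord i) (inord j))%R.

Lemma above_delta i j : (i < j <= c) -> above 1 (delta_mx (inord i) (inord j) : MT)%R.
Proof.
move=> /andP[ij jc] r s rs; rewrite mxE; case: eqP => // rE; case: eqP => // sE.
move: rs; rewrite rE sE !inordK ?ltnS //; first by rewrite addn1 ltnS leqNgt ij.
exact: leq_trans (ltnW ij) jc.
Qed.

Lemma elem_exists i j : exists x : UT, (i < j <= c) -> mx_of x = elem_mx i j.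
Proof.
have [h|] := boolP (i < j <= c); last by exists 1.
suff h1 : above 1 (elem_mx i j - 1)%R by exists (exist is_uni _ h1).
by rewrite /elem_mx addrAC subrr add0r; apply: above_delta.
Qed.

Lemma delta_mul i j k l : (j <= c) -> (k <= c) ->
  (delta_mx (inord i) (inord j) * delta_mx (inord k) (inord l) =
   (delta_mx (inord i) (inord l) : MT) *+ (j == k))%R.
Proof.
move=> jc kc; rewrite -[LHS]/(delta_mx _ _ *m delta_mx _ _)%R mul_delta_mx_cond; congr (_ *+ _)%R.
by rewrite -val_eqE /= !inordK.
Qed.

Lemma elem_comm k (x y z : UT) : (0 < k < c) ->
  mx_of x = elem_mx 0 k -> mx_of y = elem_mx k k.+1 -> mx_of z = elem_mx 0 k.+1 ->
  [~ x, y] = z.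
Proof.
move=> /andP[k0 kc] xE yE zE; have kc' := ltnW kc.
suff xy : x * y = y * x * z.
  by rewrite /commg /conjg xy -!mulgA !mulKg.
apply: mx_of_inj; rewrite !mx_ofM xE yE zE /elem_mx.
have E (a b d : MT) : (b * a = 0 -> b * d = 0 -> a * d = 0 -> a * b = d ->
    (1 + a) * (1 + b) = (1 + b) * (1 + a) * (1 + d))%R.
  move=> ba bd ad ab; rewrite !mulrDr !mulrDl !mulr1 !mul1r.
  by rewrite ab ba bd ad !mul0r !addr0 !addrA (addrAC _ a b).
by apply: E; rewrite delta_mul //= ?eqxx ?mulr1n //; (case: eqP => [h|_]; last by rewrite mulr0n); move: k0 kc; lia.
Qed.

Lemma unitriangular_witness : (0 < c) ->
  exists (x : UT) s, size s = c.-1 /\ icomm x s <> 1.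
Proof.
move=> c0; have [a aP] := boolp.choice (elem_exists 0).
have [b bP] := boolp.choice (fun k => elem_exists k k.+1).
have H m : (m < c) -> icomm (a 1%N) [seq b k | k <- iota 1 m] = a m.+1.
  elim: m => [//|m IH] mc.
  have -> : iota 1 m.+1 = iota 1 m ++ [:: m.+1] by rewrite -[in LHS](addn1 m) iotaD.
  rewrite map_cat icomm_cat (IH (ltnW mc)) /=.
  by apply: (@elem_comm m.+1) => //; [apply: aP | apply: bP | apply: aP]; lia.
exists (a 1%N), [seq b k | k <- iota 1 c.-1]; split; first by rewrite size_map size_iota.
rewrite H ?prednK // => ac; have := aP c; rewrite ac mx_of1 c0 leqnn => /(_ isT).
rewrite /elem_mx => /esym /(canRL (addKr 1%R)); rewrite addNr.
move/matrixP => /(_ (inord 0) (inord c)); rewrite !mxE !eqxx => /eqP.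
by rewrite oner_eq0.
Qed.

End Unitriangular.

(** * Partial embeddings *)

Section EmbOn.
Variables (L : language).
Implicit Types (M N P : structure L).

(** An embedding of the substructure with domain [X], given by a total function
    to keep sigma types away. *)
Definition emb_on M N (X : set M) (f : M -> N) :=
  [/\ forall x y, X x -> X y -> f x = f y -> x = y,
      forall n (F : fun_sym L n) (t : n.-tuple M), (forall i, X (tnth t i)) ->
        f (fun_interp M F t) = fun_interp N F (map_tuple f t)
    & forall n (R : rel_sym L n) (t : n.-tuple M), (forall i, X (tnth t i)) ->
        rel_interp M R t <-> rel_interp N R (map_tuple f t)].

Lemma emb_onT M N (f : M -> N) : emb_on setT f <-> is_embedding f.
Proof.
split=> -[fi ff fr]; split=> //.
- by move=> x y; exact: fi.
- by move=> n F t; exact: ff.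
- by move=> n R t; exact: fr.
- by move=> x y _ _; exact: fi.
Qed.

Lemma emb_on_sub M N (X Y : set M) (f : M -> N) : X `<=` Y -> emb_on Y f -> emb_on X f.
Proof.
move=> XY [fi ff fr]; split.
- by move=> x y /XY Yx /XY Yy; exact: fi.
- by move=> n F t Xt; apply: ff => i; apply: XY.
- by move=> n R t Xt; apply: fr => i; apply: XY.
Qed.

Lemma embedding_emb_on M N (X : set M) (f : M -> N) : is_embedding f -> emb_on X f.
Proof. by move=> /emb_onT; exact: emb_on_sub. Qed.

Lemma map_tuple_comp M N P n (g : N -> P) (f : M -> N) (t : n.-tuple M) :
  map_tuple (g \o f) t = map_tuple g (map_tuple f t).
Proof. by apply: eq_from_tnth => i; rewrite !tnth_map. Qed.

Lemma map_tuple_id M n (t : n.-tuple M) : map_tuple id t = t.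
Proof. by apply: eq_from_tnth => i; rewrite !tnth_map. Qed.

Lemma map_tuple_eq M N n (f g : M -> N) (t : n.-tuple M) :
  (forall i, f (tnth t i) = g (tnth t i)) -> map_tuple f t = map_tuple g t.
Proof. by move=> fg; apply: eq_from_tnth => i; rewrite !tnth_map. Qed.

Lemma emb_on_comp M N P (X : set M) (f : M -> N) (g : N -> P) :
  emb_on X f -> emb_on (f @` X) g -> emb_on X (g \o f).
Proof.
move=> [fi ff fr] [gi gf gr].
have ft n (t : n.-tuple M) : (forall i, X (tnth t i)) ->
    forall i, (f @` X) (tnth (map_tuple f t) i).
  by move=> Xt i; rewrite tnth_map; exists (tnth t i).
split.
- move=> x y Xx Xy /= gfxy; apply: fi => //; apply: gi => //.
- move=> n F t Xt; rewrite (map_tuple_comp g f) /= ff // gf //; exact: ft.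
- move=> n R t Xt; rewrite (map_tuple_comp g f); apply: iff_trans (fr n R t Xt) _.
  by apply: gr; apply: ft.
Qed.

Lemma emb_on_eq M N (X : set M) (f g : M -> N) : fun_closed X ->
  (forall x, X x -> f x = g x) -> emb_on X f -> emb_on X g.
Proof.
move=> cX fg [fi ff fr].
have ft n (t : n.-tuple M) : (forall i, X (tnth t i)) -> map_tuple g t = map_tuple f t.
  by move=> Xt; apply: map_tuple_eq => i; rewrite fg.
split.
- by move=> x y Xx Xy; rewrite -!fg //; apply: fi.
- by move=> n F t Xt; rewrite -fg ?ff ?ft //; apply: cX.
- by move=> n R t Xt; rewrite ft //; apply: fr.
Qed.

Lemma lift_tuple (A B : Type) (X : set A) (f : A -> B) n (t : n.-tuple B) :
  (forall i, (f @` X) (tnth t i)) ->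
  exists2 u : n.-tuple A, forall i, X (tnth u i) & map_tuple f u = t.
Proof.
move=> ft; have c i : {x | X x /\ f x = tnth t i}.
  by apply: cid; have [x Xx fx] := ft i; exists x.
exists [tuple sval (c i) | i < n].
  by move=> i; rewrite tnth_mktuple; case: (svalP (c i)).
by apply: eq_from_tnth => i; rewrite tnth_map tnth_mktuple; case: (svalP (c i)).
Qed.

Lemma closed_image M N (X : set M) (f : M -> N) :
  fun_closed X -> emb_on X f -> fun_closed (f @` X).
Proof.
move=> cX [fi ff fr] n F t /lift_tuple[u Xu <-].
by exists (fun_interp M F u); [apply: cX | apply: ff].
Qed.

Lemma closed_preimage M N (X : set M) (Y : set N) (f : M -> N) :
  fun_closed X -> fun_closed Y -> emb_on X f -> fun_closed (X `&` f @^-1` Y).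
Proof.
move=> cX cY [fi ff fr] n F t XYt.
have Xt i : X (tnth t i) by case: (XYt i).
split; first exact: cX.
by rewrite /= ff //; apply: cY => i; rewrite tnth_map; case: (XYt i).
Qed.

Lemma sub_generated M (A : set M) : A `<=` generated A.
Proof. by move=> x Ax B [_]; apply. Qed.

Lemma generated_min M (A X : set M) : fun_closed X -> A `<=` X -> generated A `<=` X.
Proof. by move=> cX AX x; apply. Qed.

Lemma generated_mono M (A B : set M) : A `<=` B -> generated A `<=` generated B.
Proof.
move=> AB; apply: generated_min; first exact: generated_closed.
by move=> x /AB; exact: sub_generated.
Qed.

Lemma image_generated M N (X A : set M) (f : M -> N) :
  fun_closed X -> emb_on X f -> A `<=` X ->
  f @` generated A = generated (f @` A).
Proof.
move=> cX ef AX.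
have gX : generated A `<=` X by exact: generated_min.
apply/seteqP; split=> [_ [x Ax <-]|].
  have : (X `&` f @^-1` (generated (f @` A))) x.
    move: x Ax; apply: generated_min => [|x Ax].
      by apply: closed_preimage => //; exact: generated_closed.
    by split; [exact: AX | apply: sub_generated; exists x].
  by case.
apply: generated_min.
  by apply: closed_image; [exact: generated_closed | exact: emb_on_sub ef].
by move=> _ [x Ax <-]; exists x => //; exact: sub_generated.
Qed.

Lemma emb_on_inv M N (x0 : M) (X : set M) (f : M -> N) :
  fun_closed X -> emb_on X f ->
  exists g : N -> M, emb_on (f @` X) g /\ forall x, X x -> g (f x) = x.
Proof.
move=> cX [fi ff fr].
pose g y : M := if pselect (exists2 x, X x & f x = y) is left h then sval (cid2 h) else x0.
have gf x : X x -> g (f x) = x.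
  move=> Xx; rewrite /g; case: pselect => [h|]; last by case; exists x.
  by case: cid2 => z Xz fz /=; exact: fi.
have gK n (t : n.-tuple M) : (forall i, X (tnth t i)) -> map_tuple g (map_tuple f t) = t.
  by move=> Xt; apply: eq_from_tnth => i; rewrite !tnth_map gf.
exists g; split=> //; split.
- by move=> _ _ [x Xx <-] [y Xy <-]; rewrite !gf // => ->.
- by move=> n F t /lift_tuple[u Xu <-]; rewrite gK // -ff // gf //; exact: cX.
- by move=> n R t /lift_tuple[u Xu <-]; rewrite gK //; apply: iff_sym; exact: fr.
Qed.

Lemma sval_embedding M (X : substructure M) : is_embedding (M := sub_str X) (@sval M (sub_set X)).
Proof. by split=> //; exact: sval_inj. Qed.

Lemma substructure_eq M (X Y : substructure M) : sub_set X = sub_set Y -> X = Y.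
Proof.
case: X Y => X cX [Y cY] /= XY; move: cX cY; rewrite XY => cX cY.
by rewrite (Prop_irrelevance cX cY).
Qed.

Lemma embedding_comp M N P (f : M -> N) (g : N -> P) :
  is_embedding f -> is_embedding g -> is_embedding (g \o f).
Proof.
move=> /emb_onT ef /emb_onT eg; apply/emb_onT; apply: emb_on_comp => //.
exact: emb_on_sub eg.
Qed.

Lemma emb_on_sub_str M N (X : substructure M) (f : M -> N) :
  emb_on (sub_set X) f -> is_embedding (M := sub_str X) (f \o sval).
Proof.
move=> ef; apply/emb_onT.
apply: (@emb_on_comp (sub_str X) M N); first exact/emb_onT/sval_embedding.
by apply: emb_on_sub ef => _ [x _ <-]; exact: svalP.
Qed.

Lemma corestrict M N (X : substructure N) (f : M -> N) (fX : forall x, sub_set X (f x)) :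
  is_embedding f ->
  is_embedding (N := sub_str X) (fun x => exist (sub_set X) (f x) (fX x)).
Proof.
move=> [fi ff fr].
have mE n (t : n.-tuple M) :
    map_tuple sval (map_tuple (fun x => exist (sub_set X) (f x) (fX x)) t) = map_tuple f t.
  by apply: eq_from_tnth => i; rewrite !tnth_map.
split.
- by move=> x y /(congr1 sval) /= /fi.
- by move=> n F t; apply: sval_inj => /=; rewrite mE ff.
- by move=> n R t /=; rewrite mE; exact: fr.
Qed.

Lemma iso_inverse M N (f : M -> N) : is_isomorphism f ->
  exists2 g : N -> M, is_isomorphism g & cancel f g /\ cancel g f.
Proof.
move=> [[fi ff fr] [g fK gK]]; exists g => //; split; last by exists f.
split; first exact: can_inj gK.
- move=> n F t; apply: fi; rewrite gK ff -(map_tuple_comp f g).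
  by rewrite (@map_tuple_eq _ _ _ (f \o g) id) ?map_tuple_id // => i; exact: gK.
- move=> n R t; apply: iff_sym; apply: iff_trans (fr _ _ _) _; rewrite -(map_tuple_comp f g).
  by rewrite (@map_tuple_eq _ _ _ (f \o g) id) ?map_tuple_id // => i; exact: gK.
Qed.

Lemma iso_trans M N P : isomorphic M N -> isomorphic N P -> isomorphic M P.
Proof.
move=> [f [ef bf]] [g [eg bg]]; exists (g \o f); split; first exact: embedding_comp.
exact: bij_comp.
Qed.

Lemma iso_sym M N : isomorphic M N -> isomorphic N M.
Proof. by move=> [f /iso_inverse[g ig _]]; exists g. Qed.

Lemma iso_refl M : isomorphic M M.
Proof.
exists id; split; last by exists id.
split=> // [n F t|n R t]; by rewrite map_tuple_id.
Qed.

Lemma sub_str_fg M (X : substructure M) : finitely_generated (sub_str X) <->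
  exists2 A : set M, finite_set A & sub_set X = generated A.
Proof.
split=> [[A fA gA]|[A fA XA]]; last first.
  have -> : X = gen_sub A by exact: substructure_eq.
  exact: gen_sub_fg.
exists (sval @` A); first exact: finite_image.
rewrite -(@image_generated (sub_str X) M setT A sval) //; last first.
  exact/emb_onT/sval_embedding.
rewrite gA; apply/seteqP; split=> [x Xx|_ [x _ <-]]; first by exists (exist _ x Xx).
exact: svalP.
Qed.

Lemma embedding_fg M N (f : M -> N) (A : set M) : is_embedding f ->
  generated A = setT -> generated (f @` A) = range f.
Proof. by move=> /emb_onT ef gA; rewrite -(@image_generated _ _ setT) // gA. Qed.

Lemma embedding_image M N (f : M -> N) : is_embedding f ->
  exists2 X : substructure N, sub_set X = range f & isomorphic M (sub_str X).
Proof.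
move=> ef; have cf : fun_closed (range f).
  by apply: closed_image => //; exact/emb_onT.
exists (Substructure cf) => //.
have fX x : range f (f x) by exists x.
exists (fun x => exist (range f) (f x) (fX x)); split; first exact: (@corestrict M N (Substructure cf)).
have [g gf] : {g : {x | range f x} -> M & forall y, f (g y) = sval y}.
  by apply: (@boolp.choice _ _ (fun (y : {x | range f x}) z => f z = sval y)) => -[y yr]; have [x _ xy] := yr; exists x.
exists g => [x|y]; last by apply: sval_inj; rewrite /= gf.
by case: ef => fi _ _; apply: fi; rewrite gf.
Qed.

(** Embed [A] by universality; by homogeneity an automorphism moves the image of the
    generated structure back to its place. *)
Lemma fraisse_extend (K : structure L -> Prop) M : fraisse_limit K M ->
  forall (S : set M) (A : structure L) (f : M -> A), finite_set S -> K A -> emb_on (generated S) f ->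
  exists2 g : A -> M, is_embedding g & forall x, generated S x -> g (f x) = x.
Proof.
move=> [_ univ _ uh] S A f fS KA ef; have [e ee] := univ A KA.
pose h := e \o f; have eh : emb_on (generated S) h.
  by apply: emb_on_comp => //; exact: embedding_emb_on.
have ch : fun_closed (h @` generated S) by apply: closed_image => //; exact: generated_closed.
have hX (x : sub_str (gen_sub S)) : (h @` generated S) (h (sval x)).
  by exists (sval x) => //; exact: svalP.
pose f' (x : sub_str (gen_sub S)) : sub_str (Substructure ch) := exist (h @` generated S) (h (sval x)) (hX x).
have if' : is_isomorphism f'.
  split; first by apply: (@corestrict (sub_str (gen_sub S)) M (Substructure ch)); exact: emb_on_sub_str.
  have [g gP] : {g : sub_str (Substructure ch) -> sub_str (gen_sub S) & forall y, f' (g y) = y}.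
    apply: (@boolp.choice _ _ (fun y z => f' z = y)) => -[y yr].
    have [x Sx xy] := yr; exists (exist _ x Sx); exact: sval_inj.
  exists g => // x; apply: sval_inj; case: eh => hi _ _; apply: hi; try exact: svalP.
  exact: (congr1 sval (gP (f' x))).
have [a ia aP] := uh (gen_sub S) _ f' (gen_sub_fg fS) if'.
have [b [eb _] [ab ba]] := iso_inverse ia.
exists (b \o e) => [|x Sx]; first exact: embedding_comp.
have := aP (exist _ x Sx) => /= /esym; rewrite /h /= => ->; exact: ab.
Qed.

End EmbOn.

(** * A criterion for genericity *)

Lemma inj_surj_bij (A B : Type) (f : A -> B) :
  injective f -> (forall y, exists x, f x = y) -> bijective f.
Proof.
move=> fi fs; have [g gP] := boolp.choice fs.
by exists g => // x; apply: fi; rewrite gP.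
Qed.

Lemma extend_bijection (T U : Type) (D : set T) (E : set U) (h : T -> U) :
  countable [set: T] -> countable [set: U] ->
  infinite_set (~` D) -> infinite_set (~` E) ->
  (forall x y, D x -> D y -> h x = h y -> x = y) -> h @` D = E ->
  exists2 s : T -> U, bijective s & forall x, D x -> s x = h x.
Proof.
move=> cT cU iD iE hi hE.
have cD : countable (~` D) by apply: sub_countable cT; exact: subset_card_le.
have cE : countable (~` E) by apply: sub_countable cU; exact: subset_card_le.
have /card_bijP[f [g fg gf]] : (~` D #= ~` E)%card.
  by apply: card_eq_trans (eq_card_nat cD iD) _; apply/card_esym/eq_card_nat.
pose cD' x (n : ~ D x) : {x | x \in ~` D} := SigSub (@mem_set _ (~` D) x n).
pose s x := if pselect (D x) is right n then val (f (cD' x n)) else h x.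
exists s => [|x Dx]; last by rewrite /s; case: pselect.
apply: inj_surj_bij => [x y|y].
  have fE z (n : ~ D z) : E (val (f (cD' z n))) -> False.
    by have := set_mem (valP (f (cD' z n))).
  rewrite /s; case: pselect => [Dx|nx]; case: pselect => [Dy|ny].
  - exact: hi.
  - by move=> e; case: (fE y ny); rewrite -e -hE; exists x.
  - by move=> e; case: (fE x nx); rewrite e -hE; exists y.
  - by move=> /val_inj /(can_inj fg) [].
have [Ey|nEy] := pselect (E y).
  move: Ey; rewrite -hE => -[x Dx <-]; exists x; by rewrite /s; case: pselect.
pose x := g (SigSub (@mem_set _ (~` E) y nEy)).
exists (val x); rewrite /s; case: pselect => [Dx|nx]; first by have := set_mem (valP x).
have -> : cD' _ nx = x by apply: val_inj.
by rewrite gf.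
Qed.

Section WeakHomogeneity.
Variables (L : language) (K : structure L -> Prop) (M : structure L).
Variable const : fun_sym L 0.
Hypothesis age : fg_subs_in K M.
Hypothesis fgK : forall A, K A -> finitely_generated A.

(** The type of [b] over [a] decides every extension: any embedding of the
    structure generated by [b] in a member of [K] can be undone over [a] in [M]. *)
Definition determines (a b : set M) := forall C, K C -> forall f : M -> C,
  emb_on (generated b) f ->
  exists2 g : C -> M, is_embedding g & forall x, generated a x -> g (f x) = x.

Hypothesis W : forall a : set M, finite_set a ->
  exists b, [/\ finite_set b, a `<=` b & determines a b].

Lemma determines_mono (a a' b b' : set M) :
  a' `<=` a -> b `<=` b' -> determines a b -> determines a' b'.
Proof.
move=> aa bb D C KC f ef.
have [g eg gf] := D C KC f (emb_on_sub (generated_mono bb) ef).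
by exists g => // x ax; apply: gf; exact: generated_mono ax.
Qed.

Let x0 : M := fun_interp M const [tuple].

Lemma generated_inh (a : set M) : exists x, generated a x.
Proof. by exists x0; apply: generated_closed => -[]. Qed.

Lemma emb_on_of_sub (X : substructure M) (N : structure L) (y0 : N) (g : sub_str X -> N) :
  is_embedding g -> exists2 g' : M -> N, emb_on (sub_set X) g' &
    forall x (h : sub_set X x), g' x = g (exist _ x h).
Proof.
move=> eg; pose g' x := if pselect (sub_set X x) is left h then g (exist _ x h) else y0.
have gE x (h : sub_set X x) : g' x = g (exist _ x h).
  by rewrite /g'; case: pselect => // h'; rewrite (Prop_irrelevance h h').
exists g' => //; case: eg => gi gf gr.
have lift n (t : n.-tuple M) : (forall i, sub_set X (tnth t i)) ->
    exists2 u : n.-tuple (sub_str X), map_tuple sval u = t & map_tuple g' t = map_tuple g u.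
  move=> Xt; exists [tuple exist _ (tnth t i) (Xt i) | i < n].
    by apply: eq_from_tnth => i; rewrite tnth_map tnth_mktuple.
  by apply: eq_from_tnth => i; rewrite !tnth_map tnth_ord_tuple gE.
split.
- by move=> x y Xx Xy; rewrite !gE => /gi [].
- move=> n F t Xt; have [u ut gut] := lift n t Xt.
  rewrite gut -gf -ut gE; first by rewrite ut; exact: sub_closed.
  by move=> h; congr g; exact: sval_inj.
- move=> n R t Xt; have [u ut gut] := lift n t Xt.
  by rewrite gut -ut; exact: gr.
Qed.

Lemma determines_sub (a b b' : set M) (f : M -> M) :
  finite_set b' -> a `<=` b -> determines a b ->
  emb_on (generated b) f -> f @` generated b `<=` generated b' ->
  exists2 g : M -> M, emb_on (generated b') g & forall x, generated a x -> g (f x) = x.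
Proof.
move=> fb' ab D ef fbb'.
have [C KC [p ip]] := age (gen_sub_fg fb').
have [q iq [pq qp]] := iso_inverse ip.
have [y0 by0] := generated_inh b'.
pose f1 x : sub_str (gen_sub b') :=
  if pselect (generated b' (f x)) is left h then exist _ (f x) h else exist _ y0 by0.
have f1E x : generated b x -> sval (f1 x) = f x.
  by move=> bx; rewrite /f1; case: pselect => // -[]; apply: fbb'; exists x.
have ef1 : emb_on (generated b) f1.
  case: ef => fi ff fr.
  have mE n (t : n.-tuple M) : (forall i, generated b (tnth t i)) ->
      map_tuple sval (map_tuple f1 t) = map_tuple f t.
    by move=> bt; apply: eq_from_tnth => i; rewrite !tnth_map f1E.
  split.
  - by move=> x y bx by_ /(congr1 sval); rewrite !f1E //; exact: fi.
  - move=> n F t bt; apply: sval_inj; rewrite f1E; last exact: generated_closed.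
    by rewrite /= mE // ff.
  - by move=> n R t bt /=; rewrite mE //; exact: fr.
have [|g eg gf] := D C KC (q \o f1).
  by apply: emb_on_comp => //; apply: embedding_emb_on; case: iq.
have [|g' eg' gE'] := emb_on_of_sub x0 (g := g \o q) (X := gen_sub b').
  by apply: embedding_comp => //; case: iq.
exists g' => // x ax; have bx : generated b x by exact: generated_mono ax.
have h : generated b' (f x) by apply: fbb'; exists x.
rewrite (gE' _ h) -{2}(gf x ax) /=; congr (g (q _)); apply: sval_inj.
by rewrite f1E.
Qed.

(** Being determining is equivalent to a weak amalgamation property, which only
    depends on the isomorphism type of the pair. *)
Lemma determines_image (a b : set M) (e : M -> M) : finite_set b -> a `<=` b ->
  determines a b -> emb_on (generated b) e -> determines (e @` a) (e @` b).
Proof.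
move=> fb ab D ee C KC f ef.
have gE : e @` generated b = generated (e @` b).
  by apply: image_generated ee _; [exact: generated_closed | exact: sub_generated].
have gaE : e @` generated a = generated (e @` a).
  apply: image_generated ee _; first exact: generated_closed.
  by move=> x /ab; exact: sub_generated.
have [b' [fb' bb' Db']] := W (finite_image e fb).
have [g1 eg1 g1f] : exists2 g : C -> M, is_embedding g &
    forall x, generated a x -> g ((f \o e) x) = x.
  by apply: D => //; apply: emb_on_comp => //; rewrite gE.
have [g2 eg2 g2e] : exists2 g : M -> M, emb_on (generated b') g &
    forall x, generated a x -> g (e x) = x.
  by apply: (determines_sub fb' ab D ee); rewrite gE; exact: generated_mono.
have [A fA gA] := fgK KC.
have [b1 [fb1 bb1]] : exists b1, finite_set b1 /\ (range g1 `|` g2 @` generated b' `<=` generated b1).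
  exists (g1 @` A `|` g2 @` b'); rewrite finite_setU; split; first by split; exact: finite_image.
  move=> x [|]; [rewrite -(embedding_fg eg1 gA) | rewrite (image_generated (@generated_closed _ _ _) eg2 (@sub_generated _ _ _))].
    by apply: generated_mono => y; left.
  by apply: generated_mono => y; right.
have [g3 eg3 g3g] := determines_sub fb1 bb' Db' eg2 (fun x h => bb1 x (or_intror h)).
exists (g3 \o g1).
  apply/emb_onT; apply: emb_on_comp; first exact/emb_onT.
  by apply: emb_on_sub eg3 => x h; apply: bb1; left.
rewrite -gaE => _ [x ax <-] /=.
have -> : g1 (f (e x)) = x by apply: g1f.
rewrite -{1}(g2e x ax); apply: g3g; rewrite -gE; exists x => //.
exact: generated_mono ax.
Qed.

End WeakHomogeneity.
Section BackAndForth.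
Variables (L : language) (K : structure L -> Prop) (M : structure L).
Variable const : fun_sym L 0.
Hypotheses (age : fg_subs_in K M) (fgK : forall A, K A -> finitely_generated A).
Hypothesis W : forall a : set M, finite_set a ->
  exists b, [/\ finite_set b, a `<=` b & determines K a b].
Variable e : nat -> M.
Hypothesis e_surj : forall y, exists i, e i = y.

Local Notation S := (str_space K).
Local Notation plist := (seq (nat * nat)).

(** A finite list of pairs (x, i) stands for the partial map from a structure on
    nat to [M] sending x to [e i]. *)
Definition pdom (l : plist) : set nat := [set x | x \in unzip1 l].
Definition pimg (l : plist) : set M := e @` [set i | i \in unzip2 l].

Definition pmap (N : S) (l : plist) (h : nat -> M) :=
  emb_on (M := str_of N) (generated (M := str_of N) (pdom l)) h /\
  forall z, z \in l -> h z.1 = e z.2.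

Definition good (N : S) (ps qs : plist) :=
  (exists h, pmap N (ps ++ qs) h) /\ determines K (pimg ps) (pimg (ps ++ qs)).

Lemma pdom_fin l : finite_set (pdom l).
Proof. exact: finite_seq. Qed.

Lemma pimg_fin l : finite_set (pimg l).
Proof. by apply: finite_image; exact: finite_seq. Qed.

Lemma pmap_img N l h : pmap N l h -> h @` pdom l = pimg l.
Proof.
move=> [_ hE]; apply/seteqP; split=> [_ [x /mapP[z zl ->] <-]|_ [i /mapP[z zl ->] <-]].
  by rewrite hE //; exists z.2 => //; apply: map_f.
by rewrite -hE //; exists z.1 => //; apply: map_f.
Qed.

Lemma pmap_gen N l h : pmap N l h ->
  h @` generated (M := str_of N) (pdom l) = generated (pimg l).
Proof.
move=> hp; rewrite -(pmap_img hp); apply: image_generated (proj1 hp) _.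
  exact: generated_closed.
exact: sub_generated.
Qed.

Definition agree (A : set nat) (N N' : S) :=
  emb_on (M := str_of N) (N := str_of N') (generated (M := str_of N) A) id.

Lemma agree_gen A N N' : agree A N N' ->
  generated (M := str_of N') A = generated (M := str_of N) A.
Proof.
move=> ag; have := image_generated (@generated_closed L (str_of N) A) ag (@sub_generated L (str_of N) A).
by rewrite !image_id.
Qed.

Lemma agree_sym A N N' : agree A N N' -> agree A N' N.
Proof.
move=> ag; have [g [eg gE]] := emb_on_inv (0%N : str_of N) (@generated_closed L (str_of N) A) ag.
move: eg; rewrite image_id /agree (agree_gen ag) => eg.
by apply: emb_on_eq eg => //; rewrite -(agree_gen ag); exact: generated_closed.
Qed.

Lemma agree_pmap N N' l h : agree (pdom l) N N' -> pmap N l h -> pmap N' l h.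
Proof.
move=> ag [eh hE]; split=> //.
have ag' := agree_sym ag; rewrite /agree in ag'.
apply: (@emb_on_comp L (str_of N') (str_of N) M _ id h) ag' _.
by rewrite image_id (agree_gen ag).
Qed.

Lemma local_open (U : set S) :
  (forall N, U N -> exists A, finite_set A /\ forall N', agree A N N' -> U N') ->
  open U.
Proof.
move=> loc; rewrite str_space_openE => N /loc[A [fA UA]].
have [B [oB BN]] := gen_sub_cylinder N fA.
exists (cylinder K B); split=> // N' BN'; apply: UA.
case: BN => _ bf br; case: BN' => _ bf' br'.
have lift n (t : n.-tuple nat) : (forall i, generated (M := str_of N) A (tnth t i)) ->
    exists u : n.-tuple {x | generated (M := str_of N) A x}, map_tuple sval u = t.
  move=> Xt; exists [tuple exist _ (tnth t i) (Xt i) | i < n].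
  by apply: eq_from_tnth => i; rewrite tnth_map tnth_mktuple.
split=> // [n F t /lift[u <-]|n R t /lift[u <-]].
  by rewrite -(bf n F u) (bf' n F u) (@map_tuple_id L (str_of N)).
by rewrite (@map_tuple_id L (str_of N)); apply: iff_trans (iff_sym (br n R u)) (br' n R u).
Qed.

(** One round of the game: the partial map can be prolonged to meet [n]. *)
Definition reply (n : nat) (b : bool) (N : S) (ps : plist) :=
  exists ps' qs', [/\ good N ps' qs', {subset ps <= ps'} &
    exists2 z, z \in ps' & if b then z.1 = n else e z.2 = e n].

Definition start : set S := [set N | exists qs, good N [::] qs].
Definition round ps qs n b : set S := [set N | good N ps qs -> reply n b N ps].

Lemma good_agree ps qs N N' :
  agree (pdom (ps ++ qs)) N N' -> good N ps qs -> good N' ps qs.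
Proof. by move=> ag [[h hp] D]; split=> //; exists h; exact: agree_pmap ag hp. Qed.

Lemma start_open : open start.
Proof.
apply: local_open => N [qs gN]; exists (pdom ([::] ++ qs)); split; first exact: pdom_fin.
by move=> N' ag; exists qs; exact: good_agree ag gN.
Qed.

(** The premise is decided by the structure generated by the domain, so it is a clopen
    condition; hence the implication is open. *)
Lemma round_open ps qs n b : open (round ps qs n b).
Proof.
apply: local_open => N rN; have [/rN[ps' [qs' [g s z]]]|ng] := pselect (good N ps qs).
  exists (pdom (ps' ++ qs')); split=> [|N' ag _]; first exact: pdom_fin.
  by exists ps', qs'; split=> //; exact: good_agree ag g.
exists (pdom (ps ++ qs)); split=> [|N' ag g']; first exact: pdom_fin.
by case: ng; apply: good_agree g'; exact: agree_sym.
Qed.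

Section Copies.
Variables (N : S) (phi : str_of N -> M) (psi : M -> str_of N).
Hypotheses (iphi : is_embedding phi) (phiK : cancel phi psi) (psiK : cancel psi phi).

Let ipsi : is_embedding psi.
Proof.
have [|g [ig _] [fg gf]] := @iso_inverse _ _ _ phi; first by split=> //; exists psi.
have -> // : psi = g by apply/funext => y; rewrite -{1}(gf y) phiK.
Qed.

Let idx : {idx : M -> nat & forall y, e (idx y) = y} := boolp.choice e_surj.

Lemma copy_start : start N.
Proof.
have [w [fw _ Dw]] := W (finite_set0 M).
have /finite_seqP[s sE] : finite_set ((psi : M -> nat) @` w) by exact: finite_image.
pose qs := [seq (x, projT1 idx (phi x)) | x <- s].
have qP z : z \in [::] ++ qs -> (phi : nat -> M) z.1 = e z.2.
  by move=> /= /mapP[x _ ->] /=; rewrite (projT2 idx).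
have hp : pmap N ([::] ++ qs) phi.
  by split=> //; exact: embedding_emb_on.
exists qs; split; first by exists phi.
rewrite -(pmap_img hp); apply: determines_mono Dw => [_ [i //]|y wy].
exists (psi y); last exact: psiK.
rewrite /pdom /= /unzip1 -map_comp /= map_id.
by have : [set` s] (psi y) by rewrite -sE; exists y.
Qed.

(** The image under [phi] of the domain, together with the new point, lies in a
    determining set w; the structure generated by w embeds in [M] over the old part
    of the map, and [phi] followed by this embedding prolongs it. *)
Lemma copy_forth ps qs n : round ps qs n true N.
Proof.
move=> [[h hp] D]; set l := ps ++ qs in hp D.
have [h' [eh' h'h]] := emb_on_inv (0%N : str_of N) (@generated_closed L (str_of N) (pdom l)) (proj1 hp).
rewrite (pmap_gen hp) in eh'.
have [|w [fw Aw Dw]] := W (a := phi @` (pdom l `|` [set n])).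
  by apply: finite_image; rewrite finite_setU; split; [exact: pdom_fin | exact: finite_set1].
have h'img : h' @` generated (pimg l) = generated (M := str_of N) (pdom l).
  rewrite -(pmap_gen hp); apply/seteqP; split=> [_ [_ [x lx <-] <-]|x lx].
    by rewrite h'h.
  by exists (h x); [exists x | exact: h'h].
have ef : emb_on (generated (pimg l)) (phi \o h').
  by apply: emb_on_comp => //; exact: embedding_emb_on.
have psl : pimg ps `<=` pimg l.
  by move=> _ [i /= ips <-]; exists i => //=; rewrite /l /unzip2 map_cat mem_cat ips.
have [|g eg gf] := determines_sub const age fw psl D ef.
  rewrite (_ : [set _ | _ in _] = phi @` (h' @` generated (pimg l))); last first.
    by rewrite -image_comp.
  rewrite h'img (image_generated (X := setT) _ (proj2 (emb_onT phi) iphi)) //.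
  by apply: generated_mono => _ [x lx <-]; apply: Aw; exists x => //; left.
have /finite_seqP[s sE] : finite_set ((psi : M -> nat) @` w) by exact: finite_image.
pose j x := projT1 idx (g (phi x)).
have jE x : e (j x) = g (phi x) by exact: (projT2 idx).
pose ps' := (n, j n) :: ps; pose qs' := [seq (x, j x) | x <- s].
have w_s x : w (phi x) -> x \in s.
  by move=> wx; have : [set` s] x by rewrite -sE; exists (phi x).
have s_w x : x \in s -> w (phi x).
  by move=> xs; have : [set` s] x by []; rewrite -sE => -[y wy <-]; rewrite psiK.
have lw x : x \in unzip1 l -> w (phi x) by move=> xl; apply: Aw; exists x => //; left.
have domw x : pdom (ps' ++ qs') x -> w (phi x).
  rewrite /pdom /= inE => /orP[/eqP ->|]; first by apply: Aw; exists n => //; right.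
  rewrite /unzip1 map_cat mem_cat => /orP[xps|].
    by apply: lw; rewrite /l /unzip1 map_cat mem_cat xps.
  by rewrite -map_comp /= map_id; exact: s_w.
have hps z : z \in ps -> g (phi z.1) = e z.2.
  move=> zps; have zl : z \in l by rewrite mem_cat zps.
  have lz : generated (M := str_of N) (pdom l) z.1 by apply: sub_generated; exact: map_f.
  rewrite -(proj2 hp z zl) -{1}(h'h z.1 lz); apply: gf; apply: sub_generated.
  by rewrite (proj2 hp z zl); exists z.2 => //; exact: map_f.
have hp' : pmap N (ps' ++ qs') (g \o phi).
  split; last first.
    move=> z; rewrite inE => /orP[/eqP -> /=|]; first by rewrite jE.
    by rewrite mem_cat => /orP[/hps //|/mapP[x _ ->]] /=; rewrite jE.
  apply: emb_on_comp; first exact: embedding_emb_on.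
  apply: emb_on_sub eg.
  rewrite (image_generated (X := setT) _ (proj2 (emb_onT phi) iphi)) //.
  by apply: generated_mono => _ [x xd <-]; exact: domw.
exists ps', qs'; split; last by exists (n, j n); rewrite // inE eqxx.
  split; first by exists (g \o phi).
  have eg' : emb_on (generated w) g by [].
  have Dg := determines_image const age fgK W fw Aw Dw eg'.
  apply: determines_mono Dg => [_ [i /mapP[z zps ->] <-]|_ [y wy <-]].
    move: zps; rewrite inE => /orP[/eqP -> /=|zps].
      by rewrite jE; exists (phi n) => //; exists n => //; right.
    exists (phi z.1); last exact: hps.
    by exists z.1 => //; left; rewrite /pdom /= /l /unzip1 map_cat mem_cat map_f.
  rewrite -(pmap_img hp'); exists (psi y); last by rewrite /= psiK.
  rewrite /pdom /= inE /unzip1 map_cat mem_cat -map_comp /= map_id w_s ?psiK //.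
  by rewrite !orbT.
by move=> z zps; rewrite inE zps orbT.
Qed.

(** Here w surrounds the range. The old pair is transferred from the range to the
    image of the domain under [phi], where it is still determining; so the structure
    generated by w embeds in [M] over the image of the domain. *)
Lemma copy_back ps qs n : round ps qs n false N.
Proof.
move=> [[h hp] D]; set l := ps ++ qs in hp D.
have [h' [eh' h'h]] := emb_on_inv (0%N : str_of N) (@generated_closed L (str_of N) (pdom l)) (proj1 hp).
rewrite (pmap_gen hp) in eh'.
have ef : emb_on (generated (pimg l)) (phi \o h').
  by apply: emb_on_comp => //; exact: embedding_emb_on.
have psl : pimg ps `<=` pimg l.
  by move=> _ [i /= ips <-]; exists i => //=; rewrite /l /unzip2 map_cat mem_cat ips.
have Df := determines_image const age fgK W (pimg_fin l) psl D ef.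
have fgen := image_generated (@generated_closed _ _ (pimg l)) ef (@sub_generated _ _ _).
have fps : (phi \o h') @` pimg ps `<=` (phi \o h') @` pimg l by exact: image_subset.
have [|w [fw Aw Dw]] := W (a := pimg l `|` [set e n]).
  by rewrite finite_setU; split; [exact: pimg_fin | exact: finite_set1].
have [f2 [ef2 f2f]] := emb_on_inv (e 0) (@generated_closed _ _ (pimg l)) ef.
rewrite fgen in ef2.
have [|g eg gf] := determines_sub const age fw fps Df ef2.
  rewrite -fgen => _ [_ [x lx <-] <-]; rewrite f2f //.
  by apply: generated_mono lx => y ly; apply: Aw; left.
have /finite_seqP[s sE] : finite_set (projT1 idx @` w) by exact: finite_image.
have s_w j : j \in s -> w (e j).
  by move=> js; have : [set` s] j by []; rewrite -sE => -[y wy <-]; rewrite (projT2 idx).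
pose q j : nat := psi (g (e j)).
pose ps' := (q n, n) :: ps; pose qs' := [seq (q j, j) | j <- s].
have pimgE z : z \in ps -> pimg ps (e z.2).
  by move=> zps; exists z.2 => //; exact: map_f.
have hps z : z \in ps -> q z.2 = z.1.
  move=> zps; have zl : z \in l by rewrite mem_cat zps.
  have lz : generated (M := str_of N) (pdom l) z.1 by apply: sub_generated; exact: map_f.
  have ez : generated (pimg l) (e z.2) by apply: sub_generated; apply: psl; exact: pimgE.
  rewrite /q -{1}(f2f _ ez) gf; last by apply: sub_generated; exists (e z.2) => //; exact: pimgE.
  by rewrite /= -(proj2 hp z zl) h'h // phiK.
have zw z : z \in ps' ++ qs' -> w (e z.2) /\ z.1 = q z.2.
  rewrite inE => /orP[/eqP -> /=|]; first by split=> //; apply: Aw; right.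
  rewrite mem_cat => /orP[zps|/mapP[j js ->] /=]; last by split=> //; exact: s_w.
  by split; [apply: Aw; left; apply: psl; exact: pimgE | rewrite hps].
have epg : emb_on (generated w) (psi \o g).
  by apply: emb_on_comp => //; exact: embedding_emb_on.
have [h3 [eh3 h3E]] := emb_on_inv (e 0) (@generated_closed _ _ w) epg.
have hp' : pmap N (ps' ++ qs') h3.
  split; last by move=> z /zw[wz ->]; apply: h3E; exact: sub_generated.
  apply: emb_on_sub eh3.
  rewrite (image_generated (@generated_closed _ _ w) epg (@sub_generated _ _ _)).
  apply: generated_mono => x /mapP[z /zw[wz zq] ->]; rewrite zq.
  by exists (e z.2).
exists ps', qs'; split; last by exists (q n, n); rewrite // inE eqxx.
  split; first by exists h3.
  apply: determines_mono Dw => [_ [i /mapP[z zps ->] <-]|y wy].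
    move: zps; rewrite inE => /orP[/eqP -> /=|zps]; first by right.
    by left; apply: psl; exact: pimgE.
  exists (projT1 idx y); last exact: (projT2 idx).
  rewrite /unzip2 /= inE map_cat mem_cat -map_comp /= map_id; apply/orP; right; apply/orP; right.
  by have : [set` s] (projT1 idx y) by rewrite -sE; exists y.
by move=> z zps; rewrite inE zps orbT.
Qed.

End Copies.

(** The replies, made in turn for every [n], form a chain of partial maps whose union
    is an isomorphism. *)
Lemma rounds_iso N : start N -> (forall ps qs n b, round ps qs n b N) ->
  isomorphic (str_of N) M.
Proof.
move=> [qs0 g0] rounds.
pose goodp (p : plist * plist) := good N p.1 p.2.
have next (p : plist * plist) n : {p' | goodp p -> [/\ goodp p', {subset p.1 <= p'.1},
    exists2 z, z \in p'.1 & z.1 = n & exists2 z, z \in p'.1 & e z.2 = e n]}.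
  apply: cid; have [gp|] := pselect (goodp p); last by exists p.
  have [p1 [q1 [g1 s1 [z1 z1p z1n]]]] := rounds p.1 p.2 n true gp.
  have [p2 [q2 [g2 s2 [z2 z2p z2n]]]] := rounds p1 q1 n false g1.
  exists (p2, q2) => _; split=> //=; [by move=> z /s1/s2 | by exists z1; [apply: s2|] | by exists z2].
pose chain := fix chain k := if k is k'.+1 then sval (next (chain k') k') else ([::], qs0).
have cg k : goodp (chain k).
  by elim: k => [//|k /(svalP (next _ k)) []].
have cS k : {subset (chain k).1 <= (chain k.+1).1}.
  by case: (svalP (next (chain k) k) (cg k)).
have cle k k' : (k <= k') -> {subset (chain k).1 <= (chain k').1}.
  move=> /subnK <-; elim: (k' - k)%N => [//|m IH] z /IH; exact: cS.
have ch k : exists h, pmap N ((chain k).1 ++ (chain k).2) h by case: (cg k).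
have hit n : exists k z, z \in (chain k).1 /\ z.1 = n.
  by have [_ _ [z zp zn] _] := svalP (next (chain n) n) (cg n); exists n.+1, z.
pose rho x y := exists k z, [/\ z \in (chain k).1, z.1 = x & e z.2 = y].
have rho_fun x y y' : rho x y -> rho x y' -> y = y'.
  move=> [k [z [zk zx zy]]] [k' [z' [zk' zx' zy']]].
  have [h [_ hE]] := ch (maxn k k').
  have h1 : h z.1 = e z.2 by apply: hE; rewrite mem_cat (cle _ _ (leq_maxl _ _)).
  have h2 : h z'.1 = e z'.2 by apply: hE; rewrite mem_cat (cle _ _ (leq_maxr _ _)).
  by rewrite -zy -zy' -h1 -h2 zx zx'.
have [f fP] : {f : nat -> M & forall x, rho x (f x)}.
  apply: boolp.choice => x; have [k [z [zk zx]]] := hit x.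
  by exists (e z.2), k, z.
have many (s : seq nat) : exists k h, pmap N ((chain k).1 ++ (chain k).2) h /\
    forall x, x \in s -> pdom ((chain k).1 ++ (chain k).2) x /\ h x = f x.
  have [k kP] : exists k, forall x, x \in s ->
      exists z, [/\ z \in (chain k).1, z.1 = x & e z.2 = f x].
    elim: s => [|x s [k kP]]; first by exists 0%N.
    have [k' [z [zk zx zf]]] := fP x; exists (maxn k k') => y.
    rewrite inE => /orP[/eqP ->|/kP[z' [zk' zx' zf']]].
      by exists z; split=> //; apply: cle zk; exact: leq_maxr.
    by exists z'; split=> //; apply: cle zk'; exact: leq_maxl.
  have [h hp] := ch k; exists k, h; split=> // x /kP[z [zk zx zf]].
  have zl : z \in (chain k).1 ++ (chain k).2 by rewrite mem_cat zk.
  by rewrite -zx (proj2 hp z zl) zf zx; split=> //; rewrite /pdom /= -zx; exact: map_f.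
have tup n (t : n.-tuple nat) (x : nat) : exists h,
    [/\ emb_on (M := str_of N) (generated (M := str_of N) [set` x :: t]) h,
        map_tuple h t = map_tuple f t & h x = f x].
  have [k [h [[eh _] hf]]] := many (x :: t); exists h; split.
  - by apply: emb_on_sub eh; apply: generated_mono => y /= /hf [].
  - by apply: map_tuple_eq => i; apply: (proj2 (hf _ _)); rewrite inE mem_tnth orbT.
  - by apply: (proj2 (hf _ _)); rewrite inE eqxx.
have gt n (t : n.-tuple nat) x i : generated (M := str_of N) [set` x :: t] (tnth t i).
  by apply: sub_generated; rewrite /= inE mem_tnth orbT.
exists f; split; first split.
- move=> x y; have [h [[hi _ _] ht hx]] := tup 1%N [tuple y] x.
  have hy : h y = f y by have := congr1 (fun t => tnth t ord0) ht; rewrite !tnth_map.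
  rewrite -hx -hy; apply: hi; apply: sub_generated; rewrite /= !inE eqxx ?orbT //.
- move=> n F t; have [h [[_ hF _] ht hx]] := tup n t (fun_interp (str_of N) F t).
  by rewrite -hx -ht hF // => i; exact: gt.
- move=> n R t; have [h [[_ _ hR] ht _]] := tup n t 0%N.
  by rewrite -ht; apply: hR => i; exact: gt.
apply: inj_surj_bij => [x y|y].
  have [h [[hi _ _] ht hx]] := tup 1%N [tuple y] x.
  have hy : h y = f y by have := congr1 (fun t => tnth t ord0) ht; rewrite !tnth_map.
  rewrite -hx -hy; apply: hi; apply: sub_generated; rewrite /= !inE eqxx ?orbT //.
have [n <-] := e_surj y.
have [_ _ _ [z zp zn]] := svalP (next (chain n) n) (cg n).
exists z.1; apply: (rho_fun z.1) => //; by exists n.+1, z.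
Qed.

End BackAndForth.

Section Criterion.
Variables (L : language) (K : structure L -> Prop) (M : structure L).
Variable const : fun_sym L 0.
Hypotheses (fgK : forall A, K A -> finitely_generated A)
  (univ : forall A, K A -> embeds A M) (age : fg_subs_in K M)
  (cntM : countable [set: M]) (nfgM : ~ finitely_generated M).
Hypothesis coinfinite : forall N : structure L, fg_subs_in K N ->
  forall X : set N, fun_closed X -> X <> setT -> infinite_set X -> infinite_set (~` X).
Hypothesis W : forall a : set M, finite_set a ->
  exists b, [/\ finite_set b, a `<=` b & determines K a b].

Lemma iso_member_iso A B : iso_member K A -> isomorphic A B -> iso_member K B.
Proof. by move=> [C KC CA] AB; exists C => //; exact: iso_trans AB. Qed.

Lemma infinite_not_fg (N : structure L) : ~ finitely_generated N -> infinite_set [set: N].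
Proof.
move=> nfg fin; apply: nfg; exists setT => //.
by apply/seteqP; split=> // x _; exact: sub_generated.
Qed.

Lemma criterion_embed (N : structure L) (f : N -> M) : is_embedding f ->
  finitely_generated N -> iso_member K N.
Proof.
move=> ef fgN; have [X XE NX] := embedding_image ef.
apply: iso_member_iso (iso_sym NX); apply: age; apply/sub_str_fg.
have [S fS gS] := fgN; exists (f @` S); first exact: finite_image.
by rewrite XE -(embedding_fg ef gS).
Qed.

Lemma criterion_class : genericity_class K.
Proof.
have iM := infinite_not_fg nfgM.
have /card_esym/card_bijP[s [s' s's ss']] := eq_card_nat cntM iM.
pose e n : M := val (s (SigSub (mem_set (I : [set: nat] n)))).
have e_surj y : exists n, e n = y.
  exists (val (s' (SigSub (mem_set (I : [set: M] y))))); rewrite /e.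
  set u := s' _; have -> : SigSub (mem_set (I : [set: nat] (val u))) = u by exact: val_inj.
  by rewrite /u ss'.
split=> //.
- exists (fun n => sub_str (gen_sub (e @` [set` odflt [::] (unpickle n : option (seq nat))]))).
  move=> B KB; have [S fS gS] := fgK KB; have [f ef] := univ KB.
  have [idx idxP] := boolp.choice e_surj.
  have /finite_seqP[t tE] : finite_set ((idx \o f) @` S) by exact: finite_image.
  exists (pickle t); rewrite pickleK /= -tE.
  have -> : e @` ((idx \o f) @` S) = f @` S.
    apply/seteqP; split=> [_ [_ [x Sx <-] <-]|_ [x Sx <-]].
      by exists x => //=; rewrite idxP.
    by exists (idx (f x)); [exists x | rewrite idxP].
  have [X XE NX] := embedding_image ef; apply: iso_sym; apply: iso_trans NX _.
  have -> : X = gen_sub (f @` S) by apply: substructure_eq; rewrite XE /= (embedding_fg ef gS).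
  exact: iso_refl.
- move=> A KA X fgX; have [f ef] := univ KA; apply: (@criterion_embed (sub_str X) (f \o sval)) => //.
  by apply: embedding_comp => //; exact: sval_embedding.
- move=> A B KA KB; have [f ef] := univ KA; have [g eg] := univ KB.
  have [S fS gS] := fgK KA; have [T fT gT] := fgK KB.
  pose Z := gen_sub (f @` S `|` g @` T).
  have fgZ : finitely_generated (sub_str Z).
    by apply: gen_sub_fg; rewrite finite_setU; split; exact: finite_image.
  have [C KC [h /iso_inverse[k [ek _] _]]] := age fgZ.
  have fZ x : sub_set Z (f x).
    have : range f (f x) by exists x.
    by rewrite -(embedding_fg ef gS); apply: generated_mono => y; left.
  have gZ x : sub_set Z (g x).
    have : range g (g x) by exists x.
    by rewrite -(embedding_fg eg gT); apply: generated_mono => y; right.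
  exists C; split=> //.
    by exists (k \o (fun x => exist (sub_set Z) (f x) (fZ x))); apply: embedding_comp => //; exact: corestrict.
  by exists (k \o (fun x => exist (sub_set Z) (g x) (gZ x))); apply: embedding_comp => //; exact: corestrict.
- move=> A KA; have [f ef] := univ KA; have [S fS gS] := fgK KA.
  have [y ny] : exists y, ~ range f y.
    apply: contrapT => h; apply: nfgM; exists (f @` S); first exact: finite_image.
    rewrite (embedding_fg ef gS); apply/seteqP; split=> // y _.
    by apply: contrapT => ny; apply: h; exists y.
  pose Z := gen_sub (f @` S `|` [set y]).
  have fgZ : finitely_generated (sub_str Z).
    by apply: gen_sub_fg; rewrite finite_setU; split; [exact: finite_image | exact: finite_set1].
  have [C KC [h /iso_inverse[k [ek _] [hk kh]]]] := age fgZ.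
  have fZ x : sub_set Z (f x).
    have : range f (f x) by exists x.
    by rewrite -(embedding_fg ef gS); apply: generated_mono => z; left.
  exists C, (k \o (fun x => exist (sub_set Z) (f x) (fZ x))); split=> //.
    by apply: embedding_comp => //; exact: corestrict.
  have Zy : sub_set Z y by apply: sub_generated; right.
  move=> kT; have : range (k \o (fun x => exist (sub_set Z) (f x) (fZ x))) (k (exist _ y Zy)) by rewrite kT.
  move=> [x _ /= kk]; apply: ny; exists x => //.
  by have := congr1 (fun z => sval (h z)) kk; rewrite /= !kh.
Qed.

Lemma criterion_copy (s : nat -> M) : bijective s ->
  exists N : str_space K, is_isomorphism (M := str_of N) s.
Proof.
move=> bs; have [s' ss' s's] := bs.
pose I : interp L nat := Interp
  (fun n (F : fun_sym L n) t => s' (fun_interp M F (map_tuple s t)))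
  (fun n (R : rel_sym L n) t => rel_interp M R (map_tuple s t)).
have es : is_embedding (M := Structure I) s.
  split=> [|n F t|n R t]; first exact: can_inj ss'.
    by rewrite /= s's.
  exact: iff_refl.
have nfgI : ~ finitely_generated (Structure I).
  move=> [A fA gA]; apply: nfgM; exists (s @` A); first exact: finite_image.
  by rewrite (embedding_fg es gA); apply/seteqP; split=> // y _; exists (s' y).
have ageI : fg_subs_in K (Structure I).
  move=> X fgX; apply: (@criterion_embed (sub_str X) (s \o sval)) => //.
  by apply: embedding_comp es; exact: sval_embedding.
by exists (exist _ I (conj nfgI ageI)).
Qed.

(** A basic open set given by [B] is reached by transporting [M] along a bijection that
    extends an embedding of [B]: the complements of the domain and of the image of
    the embedding are infinite. *)
Lemma criterion_dense : dense [set N : str_space K | isomorphic (str_of N) M].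
Proof.
move=> O [N0 ON0]; rewrite str_space_openE => /(_ N0 ON0)[_ [[D [B [fgB KB ->]]] BN0 BO]].
have [C KC [p [ep [q pq qp]]]] := KB; have [f ef] := univ KC.
have [eq_ _] : is_isomorphism q.
  have [|q' iq' [pq' qp']] := @iso_inverse _ _ _ p; first by split=> //; exists q.
  by have -> : q = q' by apply/funext => y; rewrite -{1}(qp' y) pq.
have egB := embedding_comp eq_ ef.
pose x0 : M := fun_interp M const [tuple].
pose h x := if pselect (D x) is left d then f (q (exist _ x d)) else x0.
have hE x (d : D x) : h x = f (q (exist _ x d)).
  by rewrite /h; case: pselect => // d'; rewrite (Prop_irrelevance d d').
have [[nfg0 age0] N0E] := (svalP N0, erefl N0).
have DE : D = range (@sval nat D) by apply/seteqP; split=> [x d|_ [[x d] _ <-] //]; exists (exist _ x d).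
have [gB fgB' gBT] := fgB.
have coinf (N : structure L) (g : Structure B -> N) : fg_subs_in K N ->
    ~ finitely_generated N -> is_embedding g -> infinite_set (~` range g).
  move=> ageN nfgN eg; have [fin|inf] := pselect (finite_set (range g)).
    move=> fin'; apply: (infinite_not_fg nfgN).
    by rewrite -(setUv (range g)) finite_setU.
  apply: (coinfinite ageN) => //.
    by apply: closed_image => //; exact/emb_onT.
  move=> gT; apply: nfgN; exists (g @` gB); first exact: finite_image.
  by rewrite (embedding_fg eg gBT).
have hDE : h @` D = range (f \o q).
  apply/seteqP; split=> [_ [x d <-]|_ [[x d] _ <-]].
    by rewrite (hE x d); exists (exist _ x d).
  by exists x => //; rewrite (hE x d).
have [s bs sD] : exists2 s : nat -> M, bijective s & forall x, D x -> s x = h x.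
  apply: (extend_bijection (E := range (f \o q))) => //.
  - by rewrite {1}DE; apply: (coinf (str_of N0)).
  - exact: coinf.
  - move=> x y Dx Dy; rewrite (hE x Dx) (hE y Dy) => fxy.
    by case: egB => /(_ _ _ fxy) [].
have [N [es _]] := criterion_copy bs.
exists N; split; last by exists s.
apply: BO; case: es => si sF sR; case: egB => gi gF gR.
have mE n (t : n.-tuple {x | D x}) : map_tuple s (map_tuple sval t) = map_tuple (f \o q) t.
  apply: eq_from_tnth => i; rewrite !tnth_map; case: (tnth t i) => x d /=.
  by rewrite sD // (hE x d).
split; first exact: sval_inj.
  move=> n F t; apply: si; rewrite sF (mE n t) -gF.
  by case: (fun_interp _ F t) => x d /=; rewrite sD // (hE x d).
by move=> n R t; apply: iff_trans (gR n R t) _; rewrite -(mE n t); apply: iff_sym; exact: sR.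
Qed.

(** The copies of [M] are the points where all rounds are won. Each round is an open
    condition, and it is dense since it holds in all copies, which are dense. *)
Theorem generic_criterion : generic_for K M.
Proof.
split; first exact: criterion_class.
have iM := infinite_not_fg nfgM.
have /card_esym/card_bijP[r [r' rr' r'r]] := eq_card_nat cntM iM.
pose e n : M := val (r (SigSub (mem_set (I : [set: nat] n)))).
have be : bijective e.
  apply: inj_surj_bij => [x y /val_inj/(can_inj rr') []//|y].
  exists (val (r' (SigSub (mem_set (I : [set: M] y))))); rewrite /e.
  set u := r' _; have -> : SigSub (mem_set (I : [set: nat] (val u))) = u by exact: val_inj.
  by rewrite /u r'r.
have e_surj y : exists n, e n = y by have [e' _ ee'] := be; exists (e' y).
have [N0 i0] := criterion_copy be.
exists N0; last by apply: iso_sym; exists e.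
pose F k : set (str_space K) :=
  if k is k'.+1 then
    if (unpickle k' : option (seq (nat * nat) * seq (nat * nat) * nat * bool)) is Some (ps, qs, n, b)
    then round e ps qs n b else setT
  else start e.
exists (\bigcap_k F k).
  exists F => // k; split.
    case: k => [|k] /=; first exact: start_open.
    by case: unpickle => [[[[ps qs] n] b]|]; [exact: round_open | exact: openT].
  move=> O On Oo; have [N [ON [phi [ephi [psi phiK psiK]]]]] := criterion_dense On Oo.
  exists N; split=> //; case: k => [|k] /=.
    exact: (copy_start W e_surj ephi psiK).
  case: unpickle => [[[[ps qs] n] []]|//].
    exact: (copy_forth const age fgK W e_surj ephi phiK psiK).
  exact: (copy_back const age fgK W e_surj ephi phiK psiK).
move=> N FN; apply: (@iso_trans _ _ M); last by apply: iso_sym; exists e.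
apply: (rounds_iso e_surj); first exact: (FN 0%N I).
by move=> ps qs n b; have := FN (pickle (ps, qs, n, b)).+1 I; rewrite /F pickleK.
Qed.

End Criterion.

(** * Groups as structures *)

Section Reducts.
Variables (L L' : language) (h : lang_map L L').

Lemma reduct_embedding (M N : structure L') (f : M -> N) :
  is_embedding f -> is_embedding (M := reduct h M) (N := reduct h N) f.
Proof. by case=> fi ff fr; split=> // [n F t|n R t]; [exact: ff | exact: fr]. Qed.

Lemma reduct_isomorphic (M N : structure L') :
  isomorphic M N -> isomorphic (reduct h M) (reduct h N).
Proof. by case=> f [ef bf]; exists f; split=> //; exact: reduct_embedding. Qed.

End Reducts.

Lemma cover_fg (L : language) (K : structure L -> Prop) (N : structure L) (S : set N) :
  fg_subs_in K N -> finite_set S ->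
  exists2 A, K A & exists2 j : A -> N, is_embedding j & S `<=` range j.
Proof.
move=> age fS; have [A KA [f [ef [g fg gf]]]] := age _ (gen_sub_fg fS).
exists A => //; exists (sval \o f); first exact: embedding_comp ef (sval_embedding _).
move=> x Sx; exists (g (exist _ x (sub_generated Sx))) => //=.
by rewrite gf.
Qed.

Lemma tuple1E (T : Type) (t : 1.-tuple T) : t = [tuple thead t].
Proof. by apply: eq_from_tnth => i; rewrite (ord1 i). Qed.

Lemma tuple2E (T : Type) (t : 2.-tuple T) : t = [tuple tnth t ord0; tnth t ord_max].
Proof.
by case: t => -[|a [|b [|d t]]] // h; apply: val_inj.
Qed.

Section GroupLanguage.

Definition smul (R : structure grp_lang) (x y : R) : R := fun_interp R GMul [tuple x; y].
Definition sinv (R : structure grp_lang) (x : R) : R := fun_interp R GInv [tuple x].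
Definition sone (R : structure grp_lang) : R := fun_interp R GOne [tuple].

Lemma embedding_smul (R R' : structure grp_lang) (j : R -> R') : is_embedding j ->
  [/\ forall x y, j (smul x y) = smul (j x) (j y), forall x, j (sinv x) = sinv (j x)
    & j (sone R) = sone R'].
Proof.
case=> _ jf _; split=> [x y|x|]; rewrite /smul /sinv /sone jf.
- by congr fun_interp; apply: val_inj.
- by congr fun_interp; apply: val_inj.
- by congr fun_interp; apply: val_inj.
Qed.

(** Every finite subset lies in a substructure that is a group. *)
Definition locally_group (R : structure grp_lang) := forall S : set R, finite_set S ->
  exists (G : groupType) (j : G -> R), is_embedding (M := grp_str G) j /\ S `<=` range j.

Lemma locally_groupP (R : structure grp_lang) : locally_group R ->
  exists G : groupType, R = grp_str G.
Proof.
move=> loc.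
have law (S : seq R) : exists (G : groupType) (j : G -> R),
    [/\ forall x y, j (x * y) = smul (j x) (j y), forall x, j (x^-1) = sinv (j x),
        j 1 = sone R & forall i, (i < size S) -> exists y, j y = nth (sone R) S i].
  have [|G [j [ej jS]]] := loc [set x | exists2 i, (i < size S) & x = nth (sone R) S i].
    suff -> : [set x | exists2 i, (i < size S) & x = nth (sone R) S i] =
        nth (sone R) S @` [set i | (i < size S)].
      by apply: finite_image; exact: finite_II.
    by apply/seteqP; split=> [_ [i iS ->]|_ [i iS <-]]; exists i.
  have [jm ji j1] := embedding_smul ej; exists G, j; split=> // i iS.
  by have [|y _ yE] := jS (nth (sone R) S i); [exists i | exists y].
have mA : associative (@smul R).
  move=> x y z; have [G [j [jm ji j1 jS]]] := law [:: x; y; z].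
  have [a /= <-] := jS 0%N isT; have [b /= <-] := jS 1%N isT; have [d /= <-] := jS 2%N isT.
  by rewrite -!jm mulgA.
have m1 : left_id (sone R) (@smul R).
  move=> x; have [G [j [jm ji j1 jS]]] := law [:: x].
  by have [a /= <-] := jS 0%N isT; rewrite -j1 -!jm mul1g.
have mV : left_inverse (sone R) (@sinv R) (@smul R).
  move=> x; have [G [j [jm ji j1 jS]]] := law [:: x].
  by have [a /= <-] := jS 0%N isT; rewrite -j1 -ji -!jm mulVg.
exists (group_of mA m1 mV); rewrite /grp_str; clear law loc; move: mA m1 mV.
rewrite /smul /sinv /sone; case: R => T [f r] /= mA m1 mV; congr (Structure (Interp _ _)).
  apply/functional_extensionality_dep => n; apply/functional_extensionality_dep => F.
  apply/functional_extensionality_dep => t; case: F t => t /=.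
  - by rewrite [t in LHS]tuple2E.
  - by rewrite [t in LHS]tuple1E.
  - by congr f; exact: tuple0.
by apply/functional_extensionality_dep => n; apply/functional_extensionality_dep => -[].
Qed.

End GroupLanguage.

Lemma qgrp_strP (R : structure qgrp_lang) (S : structure grp_lang) :
  reduct forget_roots R = S ->
  exists f : forall n, qgrp_sym n -> n.-tuple S -> S,
    (forall n (F : grp_sym n), f n (QGrp F) = fun_interp S F) /\
    R = Structure (Interp (L := qgrp_lang) f (fun _ R => of_void _ R)).
Proof.
move=> <-; case: R => T [f r]; exists f; split=> //; congr (Structure (Interp _ _)).
by apply/functional_extensionality_dep => n; apply/functional_extensionality_dep => -[].
Qed.

Lemma locally_group_roots (R : structure qgrp_lang) :
  locally_group (reduct forget_roots R) ->
  exists (G : groupType) (root : nat -> G -> G), R = qgrp_str root.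
Proof.
move=> /locally_groupP[G /qgrp_strP[f [fE ->]]].
exists G, (fun n x => if @idP (2 <= n) is ReflectT h then f 1%N (QRoot h) [tuple x] else x).
congr (Structure (Interp _ _)).
apply/functional_extensionality_dep => n; apply/functional_extensionality_dep => F.
apply/functional_extensionality_dep => t; case: F t => [k F|m hm] t /=; first by rewrite fE.
case: {-}_ / idP => [h|]; last by case.
by rewrite [t in LHS]tuple1E (Prop_irrelevance h hm).
Qed.

Lemma preds_strP (L : language) m (R : structure (preds_lang L m)) (S : structure L) :
  reduct (forget_preds L m) R = S -> exists P : 'I_m -> set S, R = preds_str P.
Proof.
move=> <-; case: R => T [f r] /=.
exists (fun i x => r 1%N (NewPred L i) [tuple x]); congr (Structure (Interp _ _)).
apply/functional_extensionality_dep => n; apply/functional_extensionality_dep => R.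
apply/functional_extensionality_dep => t; case: R t => [k R|i] t //=.
by rewrite {1}(tuple1E t).
Qed.

Lemma preds_natP (G : groupType) m (P : 'I_m -> set G) :
  exists Q : nat -> set G, (fun i : 'I_m => Q i.+1) = P /\
    forall i, (m < i) -> Q i = [set 1].
Proof.
exists (fun i => if insub i.-1 : option 'I_m is Some k then P k else [set 1]); split.
  by apply/funext => i /=; rewrite valK.
by case=> // i mi; rewrite insubF // ltnNge -ltnS mi.
Qed.

Section Embeddings.
Variables G H : groupType.
Implicit Types f : G -> H.

Lemma grp_embeddingP f : is_embedding (M := grp_str G) (N := grp_str H) f <->
  injective f /\ hom f.
Proof.
split=> [ef|[fi hf]].
  by split; [case: ef | move=> x y; case: (embedding_smul ef) => + _ _; apply].
split=> // n F t; case: F t => t /=.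
- by rewrite hf !tnth_map.
- by rewrite (homV hf) [t]tuple1E.
- exact: hom1.
Qed.

Lemma qgrp_embeddingP f r r' : Q_powered H -> is_root r -> is_root r' ->
  is_embedding (M := qgrp_str (G := G) r) (N := qgrp_str (G := H) r') f <->
  injective f /\ hom f.
Proof.
move=> QH ir ir'; split=> [ef|[fi hf]].
  exact/grp_embeddingP/(reduct_embedding forget_roots ef).
have [_ gf _] := proj2 (grp_embeddingP f) (conj fi hf).
split=> // n F t; case: F t => [k F|m hm] t; first exact: gf.
rewrite /= [t]tuple1E /=; apply: (@Qpowered_expI _ m); rewrite ?ir' ?(ltnW hm) //.
by rewrite -(homX hf) ir.
Qed.

Lemma preds_embeddingP (L : language) m (M N : structure L) (P : 'I_m -> set M)
    (Q : 'I_m -> set N) (f : M -> N) :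
  is_embedding (M := preds_str P) (N := preds_str Q) f <->
  is_embedding f /\ forall i x, P i x <-> Q i (f x).
Proof.
split=> [[fi ff fr]|[[fi ff fr] PQ]].
  split; first split=> // n R t; first exact: (fr n (OldRel m R) t).
  by move=> i x; have := fr 1%N (NewPred L i) [tuple x].
split=> // n R t; case: R t => [k R|i] t /=; first exact: fr.
by rewrite [t]tuple1E; exact: PQ.
Qed.

End Embeddings.

Section EmbOnGroups.
Variables G H : groupType.

Lemma grp_emb_on (X : set G) (f : G -> H) : subgroup X ->
  emb_on (M := grp_str G) (N := grp_str H) X f <->
  (forall x y, X x -> X y -> f x = f y -> x = y) /\
  (forall x y, X x -> X y -> f (x * y) = f x * f y).
Proof.
move=> sX; split=> [[fi ff _]|[fi fm]].
  split=> // x y Xx Xy; have := ff 2%N GMul [tuple x; y]; rewrite /= => -> //.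
  by case=> -[|[|//]] h; rewrite (tnth_nth x).
split=> // n F; case: F => t Xt /=.
- by rewrite fm // !tnth_map.
- by rewrite [t]tuple1E /= (phomV sX fm (Xt ord0)).
- exact: phom1 sX fm.
Qed.

Lemma preds_emb_on (L : language) m (M N : structure L) (P : 'I_m -> set M)
    (Q : 'I_m -> set N) (X : set M) (f : M -> N) :
  emb_on (M := preds_str P) (N := preds_str Q) X f <->
  emb_on (M := M) (N := N) X f /\ forall i x, X x -> P i x <-> Q i (f x).
Proof.
split=> [[fi ff fr]|[[fi ff fr] PQ]].
  split; first split=> // n R t; first exact: (fr n (OldRel m R) t).
  move=> i x Xx; have := fr 1%N (NewPred L i) [tuple x]; apply=> j.
  by rewrite (ord1 j).
split=> // n R t; case: R t => [k R|i] t Xt /=; first exact: fr.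
by rewrite [t]tuple1E; apply: PQ; exact: (Xt ord0).
Qed.

Lemma grp_closed (X : set G) : fun_closed (M := grp_str G) X <-> subgroup X.
Proof.
split=> [cX|sX].
  apply: subgroup_intro => [|x y Xx Xy|x Xx].
  - by apply: (cX 0%N GOne [tuple]) => -[].
  - apply: (cX 2%N GMul [tuple x; y]) => -[] [|[|//]] h; by rewrite (tnth_nth x).
  - by apply: (cX 1%N GInv [tuple x]) => i; rewrite (ord1 i).
move=> n F; case: F => t Xt /=.
- exact: (subM sX (Xt _) (Xt _)).
- exact: (subV sX (Xt ord0)).
- exact: sub1.
Qed.

Lemma grp_generated (S : set G) : generated (M := grp_str G) S = subgroup_gen S.
Proof.
apply/seteqP; split.
  apply: generated_min; last exact: sub_gen.
  by apply/grp_closed; exact: subgroup_genP.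
apply: gen_min; last exact: (@sub_generated _ (grp_str G)).
by apply/grp_closed; exact: generated_closed.
Qed.

Lemma qgrp_closed r (X : set G) : Q_powered G -> is_root r ->
  fun_closed (M := qgrp_str (G := G) r) X <-> Q_powered_subgroup X.
Proof.
move=> QG ir; split=> [cX|[sX rX]].
  split=> [|g n n2 Xg]; first by apply/grp_closed => n F; exact: (cX n (QGrp F)).
  exists (r n g); last exact: ir.
  by apply: (cX 1%N (QRoot n2) [tuple g]) => i; rewrite (ord1 i).
move=> n F; case: F => [k F|m hm] t Xt; first exact: (proj2 (grp_closed X) sX).
have [x Xx xg] := rX (thead t) m hm (Xt ord0).
rewrite /=; have -> // : r m (thead t) = x.
by apply: (@Qpowered_expI _ m); rewrite ?(ltnW hm) // ir.
Qed.

Lemma qgrp_generated r c (S : set G) : Q_powered G -> is_root r -> nil_class G c ->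
  generated (M := qgrp_str (G := G) r) S = roots (subgroup_gen S).
Proof.
move=> QG ir nG; apply/seteqP; split.
  apply: generated_min; last by move=> x Sx; apply: sub_roots; exact: sub_gen.
  by apply/(qgrp_closed _ QG ir); exact: (roots_Qpowered QG nG (subgroup_genP _)).
have [sg rg] : Q_powered_subgroup (generated (M := qgrp_str (G := G) r) S).
  by apply/(qgrp_closed _ QG ir); exact: generated_closed.
move=> x [n n0 xn]; apply/(Qpowered_sub_root x QG (conj sg rg) n0).
by move: xn; apply: gen_min => //; exact: (@sub_generated _ (qgrp_str r)).
Qed.

End EmbOnGroups.

(** * The Fraisse limits are groups *)

Lemma lazard_local (G : groupType) c (P : nat -> set G) :
  (forall S : set G, finite_set S -> exists (H : groupType) (R : nat -> set H) (j : H -> G),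
    [/\ hom j, injective j, S `<=` range j, lazard_series c R
      & forall i x, (0 < i) -> P i (j x) <-> R i x]) ->
  lazard_series c P.
Proof.
move=> loc.
have loc2 x y : exists (H : groupType) (R : nat -> set H) (j : H -> G) (a b : H),
    [/\ hom j, injective j, j a = x /\ j b = y, lazard_series c R
      & forall i x, (0 < i) -> P i (j x) <-> R i x].
  have [|H [R [j [hj ij jS lR PR]]]] := loc [set x; y].
    by rewrite finite_setU; split; exact: finite_set1.
  have [a _ ax] := jS x (or_introl erefl); have [b _ by_] := jS y (or_intror erefl).
  by exists H, R, j, a, b.
have sP i : (0 < i) -> subgroup (P i).
  move=> i0; apply: subgroup_intro => [|x y|x].
  - have [H [R [j [a [b [hj ij _ [sR _ _ _ _] PR]]]]]] := loc2 1 1.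
    by rewrite -(hom1 hj); apply/PR => //; apply: sub1; exact: sR.
  - have [H [R [j [a [b [hj ij [<- <-] [sR _ _ _ _] PR]]]]]] := loc2 x y.
    by move=> /(PR _ _ i0) Ra /(PR _ _ i0) Rb; rewrite -hj; apply/PR => //; apply: subM => //; exact: sR.
  - have [H [R [j [a [b [hj ij [<- _] [sR _ _ _ _] PR]]]]]] := loc2 x 1.
    by move=> /(PR _ _ i0) Ra; rewrite -(homV hj); apply/PR => //; apply: subV => //; exact: sR.
split=> //.
- apply/seteqP; split=> // x _.
  by have [H [R [j [a [b [hj ij [<- _] [_ R1 _ _ _] PR]]]]]] := loc2 x 1; apply/PR => //; rewrite R1.
- move=> i i0 x; have [H [R [j [a [b [hj ij [<- _] [_ _ Rd _ _] PR]]]]]] := loc2 x 1.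
  by move=> /PR - /(_ isT) Ra; apply/PR => //; apply: Rd.
- move=> k ck; apply/seteqP; split=> [x|_ ->]; last by apply: sub1; apply: sP; apply: leq_ltn_trans ck.
  have [H [R [j [a [b [hj ij [<- _] [_ _ _ Rk _] PR]]]]]] := loc2 x 1.
  by move=> /PR - /(_ (leq_ltn_trans (leq0n c) ck)); rewrite Rk // => -> /=; exact: hom1.
- move=> i k i0 k0; apply/comm_sub_le; first by apply: sP; rewrite addn_gt0 i0.
  move=> x y; have [H [R [j [a [b [hj ij [<- <-] [_ _ _ _ Rc] PR]]]]]] := loc2 x y.
  move=> /(PR _ _ i0) Ra /(PR _ _ k0) Rb; rewrite -(homR hj); apply/PR; first by rewrite addn_gt0 i0.
  by apply: Rc => //; exact: comm_subP.
Qed.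

Lemma nil_local (G : groupType) c :
  (forall S : set G, finite_set S -> exists (H : groupType) (j : H -> G),
    [/\ hom j, injective j, S `<=` range j & nil_class H c]) -> nil_class G c.
Proof.
move=> loc x s ss.
have [|H [j [hj ij jS nH]]] := loc [set y | y \in x :: s]; first exact: finite_seq.
have [a _ ax] := jS x (mem_head _ _).
have [t ts] : exists t, map j t = s.
  apply: map_lift => y ys.
  by have [|z _ zy] := jS y; [rewrite /= inE ys orbT | exists z].
by rewrite -ax -ts -(hom_icomm hj) nH ?(hom1 hj) // -ss -ts size_map.
Qed.

Lemma lazard_index (G H : groupType) c (P : nat -> set G) (R : nat -> set H) (j : H -> G) :
  hom j -> injective j -> lazard_series c R -> (forall i, (c.+1 < i)%N -> P i = [set 1]) ->
  (forall (i : 'I_c.+1) x, R i.+1 x <-> P i.+1 (j x)) ->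
  forall i x, (0 < i) -> P i (j x) <-> R i x.
Proof.
move=> hj ij [_ _ _ Rk _] Pk PR [//|i] x _.
have [ic|ci] := ltnP i c.+1; first exact: iff_sym (PR (Ordinal ic) x).
rewrite Pk ?ltnS // Rk ?(leq_trans _ (leqW ci)) //=; split=> [/= jx|->]; last exact: hom1.
by apply: ij; rewrite jx (hom1 hj).
Qed.

(** All the conditions defining the class concern finitely many elements at a time, so
    they pass from the finitely generated substructures to the limit. *)
Lemma KP_cp_limit c p (M : structure (preds_lang grp_lang c.+1)) :
  fg_subs_in (@KP_cp c p) M ->
  exists (G : groupType) (P : nat -> set G),
    [/\ M = @preds_str grp_lang c.+1 (grp_str G) (fun i => P i.+1),
        exponent G p, nil_class G c & lazard_series c P].
Proof.
move=> age.
have [|G /preds_strP[P' ME]] := @locally_groupP (reduct (forget_preds grp_lang c.+1) M).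
  move=> S fS; have [A [H [R [_ _ _ _ AH]]] [j ej jS]] := cover_fg age fS.
  have [f [ef [g fg gf]]] := iso_sym AH.
  exists H, (j \o f); split.
    exact: (reduct_embedding (forget_preds _ _) (embedding_comp ef ej)).
  by move=> x /jS[a _ <-]; exists (g a) => //=; rewrite gf.
have [P [PE Pc]] := preds_natP P'; rewrite -PE in ME; rewrite ME in age *.
have loc (S : set G) : finite_set S -> exists (H : groupType) (R : nat -> set H) (j : H -> G),
    [/\ hom j /\ injective j, S `<=` range j, exponent H p /\ nil_class H c, lazard_series c R
      & forall i x, (0 < i) -> P i (j x) <-> R i x].
  move=> fS; have [A [H [R [_ eH nH lR AH]]] [j ej jS]] := cover_fg age fS.
  have [f [ef [g fg gf]]] := iso_sym AH.
  have /preds_embeddingP[/grp_embeddingP[ij hj] PR] := embedding_comp ef ej.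
  exists H, R, (j \o f); split=> //.
  - by move=> x /jS[a _ <-]; exists (g a) => //=; rewrite gf.
  - by split=> //; apply/nilP.
  - exact: (lazard_index hj ij lR Pc PR).
exists G, P; split=> //.
- move=> x; have [H [R [j [[hj ij] jS [eH _] _ _]]]] := loc [set x] (finite_set1 x).
  by have [a _ <-] := jS x erefl; rewrite -(homX hj) eH (hom1 hj).
- apply: nil_local => S /loc[H [R [j [[hj ij] jS [_ nH] _ _]]]].
  by exists H, j.
- by apply: lazard_local => S /loc[H [R [j [[hj ij] jS _ lR PR]]]]; exists H, R, j.
Qed.

Lemma KP_cQ_limit c (M : structure (preds_lang qgrp_lang c.+1)) :
  fg_subs_in (@KP_cQ c) M ->
  exists (G : groupType) (root : nat -> G -> G) (P : nat -> set G),
    [/\ M = @preds_str qgrp_lang c.+1 (qgrp_str root) (fun i => P i.+1),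
        is_root root & lazard_Q c P].
Proof.
move=> age.
have [|G [root /preds_strP[P' ME]]] := @locally_group_roots (reduct (forget_preds qgrp_lang c.+1) M).
  move=> S fS; have [A [H [r [R [_ _ _ _ AH]]]] [j ej jS]] := cover_fg age fS.
  have [f [ef [g fg gf]]] := iso_sym AH.
  exists H, (j \o f); split.
    exact: (reduct_embedding forget_roots (reduct_embedding (forget_preds _ _) (embedding_comp ef ej))).
  by move=> x /jS[a _ <-]; exists (g a) => //=; rewrite gf.
have [P [PE Pc]] := preds_natP P'; rewrite -PE in ME; rewrite ME in age *.
have loc (S : set G) : finite_set S -> exists (H : groupType) (r : nat -> H -> H) (R : nat -> set H) (j : H -> G),
    [/\ [/\ hom j, injective j & forall n x, (2 <= n) -> j (r n x) = root n (j x)],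
        S `<=` range j, is_root r, lazard_Q c R
      & forall i x, (0 < i) -> P i (j x) <-> R i x].
  move=> fS; have [A [H [r [R [[QH ir] nH _ [lR QR] AH]]]] [j ej jS]] := cover_fg age fS.
  have [f [ef [g fg gf]]] := iso_sym AH.
  have /preds_embeddingP[ejf PR] := embedding_comp ef ej.
  have [ij hj] := proj1 (grp_embeddingP (j \o f)) (reduct_embedding forget_roots ejf).
  exists H, r, R, (j \o f); split=> //.
  - split=> // n x n2; case: ejf => _ /(_ 1%N (QRoot n2) [tuple x]) /= -> _.
    by [].
  - by move=> x /jS[a _ <-]; exists (g a) => //=; rewrite gf.
  - by split=> //; apply/nilP.
  - exact: (lazard_index hj ij lR Pc PR).
have loc2 (x y : G) : exists (H : groupType) (r : nat -> H -> H) (R : nat -> set H) (j : H -> G) (a b : H),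
    [/\ [/\ hom j, injective j & forall n x, (2 <= n) -> j (r n x) = root n (j x)],
        j a = x /\ j b = y, is_root r, lazard_Q c R
      & forall i x, (0 < i) -> P i (j x) <-> R i x].
  have [|H [r [R [j [hj jS ir lR PR]]]]] := loc [set x; y].
    by rewrite finite_setU; split; exact: finite_set1.
  have [a _ ax] := jS x (or_introl erefl); have [b _ by_] := jS y (or_intror erefl).
  by exists H, r, R, j, a, b.
have ir : is_root root.
  move=> n g n2; have [H [r [R [j [a [b [[hj ij jr] [<- _] ir _ _]]]]]]] := loc2 g 1.
  by rewrite -jr // -(homX hj) ir.
have QG : Q_powered G.
  split=> [x n n0|g n n2].
    have [H [r [R [j [a [b [[hj ij jr] [<- _] _ [[tH _] _ _ _] _]]]]]]] := loc2 x 1.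
    move=> an; have : j (a ^+ n) = j 1 by rewrite (homX hj) an (hom1 hj).
    by move=> /ij /(tH _ _ n0) ->; exact: hom1.
  exists (root n g); split=> [|x xg]; first exact: ir.
  have [H [r [R [j [a [b [[hj ij jr] [ag bx] ir' [QH _ _ _] _]]]]]]] := loc2 g x.
  rewrite -ag -bx -jr //; congr j; apply: (@Qpowered_expI _ n); rewrite ?(ltnW n2) //.
  by rewrite ir' //; apply: ij; rewrite (homX hj) bx xg ag.
exists G, root, P; split=> //; split=> //.
- by apply: nil_local => S /loc[H [r [R [j [[hj ij _] jS _ [_ nH _ _] _]]]]]; exists H, j.
- by apply: lazard_local => S /loc[H [r [R [j [[hj ij _] jS _ [_ _ lR _] PR]]]]]; exists H, R, j.
- move=> i i0; split.
    have [sP _ _ _ _] : lazard_series c P.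
      by apply: lazard_local => S /loc[H [r [R [j [[hj ij _] jS _ [_ _ lR _] PR]]]]]; exists H, R, j.
    exact: sP.
  move=> g n n2 Pg; exists (root n g); last exact: ir.
  have [H [r [R [j [a [b [[hj ij jr] [ag _] ir' [QH _ _ QR] PR]]]]]]] := loc2 g 1.
  rewrite -ag -jr //; apply/PR => //; apply/(Qpowered_sub_root _ QH (QR i i0) (ltnW n2)).
  by rewrite ir' //; apply/PR => //; rewrite ag.
Qed.

(** * Recovering a Lazard series *)

Section LazardFacts.
Variables (G : groupType) (c : nat) (P : nat -> set G).
Hypothesis lP : lazard_series c P.

Lemma lazard_sub i : (0 < i) -> subgroup (P i).
Proof. by case: lP => + _ _ _ _; apply. Qed.

Lemma lazard_all x : P 1%N x.
Proof. by case: lP => _ -> _ _ _. Qed.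

Lemma lazard_top i x : (c < i) -> P i x -> x = 1.
Proof. by case: lP => _ _ _ + _ => /[apply] ->. Qed.

Lemma lazard_mono i j : (0 < i <= j) -> P j `<=` P i.
Proof.
move=> /andP[i0 ij]; rewrite -(subnK ij); elim: (j - i)%N => [//|k IH] x Px.
by apply: IH; case: lP => _ _ Pd _ _; apply: Pd => //; rewrite addn_gt0 i0 orbT.
Qed.

Lemma lazard_comm i j x y : (0 < i) -> (0 < j) -> P i x -> P j y -> P (i + j) [~ x, y].
Proof.
by case: lP => _ _ _ _ Pc i0 j0 Px Py; apply: (Pc i j) => //; exact: comm_subP.
Qed.

Lemma lazard_icomm i x s : (0 < i) -> P i x -> P (i + size s) (icomm x s).
Proof.
elim: s i x => [|y s IH] i x i0 Px; first by rewrite addn0.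
rewrite /= addnS -addSn; apply: IH => //; rewrite -addn1.
by apply: lazard_comm => //; exact: lazard_all.
Qed.

(** On the k-th term, commutators with c - k further elements form a
    homomorphism, since the error terms lie beyond the last term. *)
Lemma icomm_mul k s x y : (0 < k) -> (k + size s)%N = c -> P k x -> P k y ->
  icomm (x * y) s = icomm x s * icomm y s.
Proof.
elim: s k x y => [//|b s IH] k x y k0 /= ks Px Py.
have k1s : (k.+1 + size s)%N = c by rewrite addSn -addnS.
have P1 z : P k z -> P k.+1 [~ z, b].
  by move=> Pz; rewrite -addn1; apply: lazard_comm => //; exact: lazard_all.
have P2 : P k.+2 [~ [~ x, b], y].
  apply: (@lazard_mono _ (k.+1 + k)); first lia.
  by apply: lazard_comm => //; exact: P1.
have -> : [~ x * y, b] = [~ x, b] * ([~ [~ x, b], y] * [~ y, b]).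
  by rewrite commMl (mulgA [~ x, b] [~ _, y]) (commgEl [~ x, b] y) mulVKg.
have P2' := @lazard_mono k.+1 k.+2 (leqnSn _) _ P2.
rewrite (IH k.+1 _ _ isT k1s (P1 x Px) (subM (lazard_sub (ltn0Sn k)) P2' (P1 y Py))).
rewrite (IH k.+1 _ _ isT k1s P2' (P1 y Py)).
have -> : icomm [~ [~ x, b], y] s = 1; last by rewrite mul1g.
apply: (@lazard_top c.+1) => //; rewrite -ks -[(k + _).+1]addSn -addSnnS.
exact: lazard_icomm.
Qed.

Lemma icomm_exp k s x n : (0 < k) -> (k + size s)%N = c -> P k x ->
  icomm (x ^+ n) s = icomm x s ^+ n.
Proof.
move=> k0 ks Px; elim: n => [|n IH]; first by rewrite !expg0 icomm1.
by rewrite !expgS (icomm_mul k0 ks) ?IH //; apply: subX => //; exact: lazard_sub.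
Qed.

Lemma icomm_ker k s : (0 < k) -> (k + size s)%N = c ->
  subgroup [set x | P k x /\ icomm x s = 1].
Proof.
move=> k0 ks; have sP := lazard_sub k0.
apply: subgroup_intro => [|x y [Px xs] [Py ys]|x [Px xs]].
- by split; [exact: sub1 | exact: icomm1].
- by split; [exact: subM | rewrite (icomm_mul k0 ks) // xs ys mulg1].
- split; first exact: subV.
  have := icomm1 s; rewrite -(mulVg x) (icomm_mul k0 ks) ?xs ?mulg1 //; exact: subV.
Qed.

Lemma lazard_level x : x <> 1 -> exists k, [/\ (0 < k <= c), P k x & ~ P k.+1 x].
Proof.
move=> x1; apply: contrapT => h.
suff H k : (k <= c) -> P k.+1 x by apply: x1; exact: lazard_top (H c (leqnn c)).
elim: k => [_|k IH kc]; first exact: lazard_all.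
apply: contrapT => nP; apply: h; exists k.+1; split=> //; exact: IH (ltnW kc).
Qed.

End LazardFacts.

(** Each element of exact level [k] is a commutator of weight [k], and has a
    nontrivial commutator of weight [c]; so in every larger group it has
    the same level for every Lazard series. *)
Definition witnessed (G : groupType) c (P : nat -> set G) :=
  forall k a, (0 < k <= c) -> P k a -> ~ P k.+1 a ->
    exists y s t, [/\ size s = k.-1, size t = (c - k)%N, icomm y s = a & icomm a t <> 1].

Section Core.
Variables (G : groupType) (c : nat) (P : nat -> set G).
Hypotheses (lP : lazard_series c P) (wP : witnessed c P).
Variables (closed : set G -> Prop) (cl : set G -> set G) (X : set G).
Hypotheses (closedI : forall A B, closed A -> closed B -> closed (A `&` B))
  (closedP : forall i, (0 < i) -> closed (P i))
  (closed_ker : forall k s, (0 < k) -> (k + size s)%N = c ->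
     closed [set x | P k x /\ icomm x s = 1])
  (clC : forall A, closed (cl A)) (clS : forall A, A `<=` cl A)
  (cl_min : forall A B, closed B -> A `<=` B -> cl A `<=` B).
Hypothesis cX : closed X.
Variables (r : set G -> nat) (d : nat).
Hypotheses (r_le : forall A, (r A <= d))
  (r_strict : forall A B, closed A -> closed B -> A `<=` B -> B `<=` X ->
     (r B <= r A) -> B `<=` A).

(** Ascending chains of closed subgroups of [X] are finite because the rank is bounded. *)
Lemma closed_fg A : closed A -> A `<=` X ->
  exists2 T : seq G, [set` T] `<=` A & A `<=` cl [set` T].
Proof.
move=> cA AX.
suff H n (T : seq G) : [set` T] `<=` A -> (d - r (cl [set` T]) <= n)%N ->
    exists2 T : seq G, [set` T] `<=` A & A `<=` cl [set` T].
  by apply: (H _ [::] _ (leqnn _)) => x.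
elim: n T => [|n IH] T TA; have clA := cl_min cA TA.
  rewrite leqn0 subn_eq0 => dr; exists T => //; apply: (r_strict (clC _) cA clA AX).
  exact: leq_trans (r_le _) dr.
move=> dr; have [AT|nAT] := pselect (A `<=` cl [set` T]); first by exists T.
have [x Ax nx] : exists2 x, A x & ~ cl [set` T] x.
  by apply: contrapT => h; apply: nAT => x Ax; apply: contrapT => nx; apply: h; exists x.
have xTA : [set` x :: T] `<=` A.
  by move=> y /=; rewrite inE => /orP[/eqP ->//|]; exact: TA.
apply: (IH (x :: T)) => //.
have lt : (r (cl [set` T]) < r (cl [set` x :: T]))%N.
  rewrite ltnNge; apply/negP => le; apply: nx.
  apply: (r_strict (clC _) (clC _) _ _ le).
  - by apply: cl_min => // y yT; apply: clS; rewrite /= inE yT orbT.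
  - by apply: subset_trans AX; exact: cl_min.
  - by apply: clS; rewrite /= inE eqxx.
by move: lt dr; lia.
Qed.

(** Centralizing finitely many tuples is enough to be pushed to the next term,
   because descending chains of closed subgroups of X are finite. *)
Lemma finite_kernel k : (0 < k <= c) ->
  exists L : seq (seq G), (forall s, s \in L -> size s = (c - k)%N) /\
    forall x, X x -> P k x -> (forall s, s \in L -> icomm x s = 1) -> P k.+1 x.
Proof.
move=> kc; have /andP[k0 kc'] := kc.
pose ker (L : seq (seq G)) : set G :=
  [set x | [/\ X x, P k x & forall s, s \in L -> icomm x s = 1]].
pose okL (L : seq (seq G)) := forall s, s \in L -> size s = (c - k)%N.
have cker L : okL L -> closed (ker L).
  elim: L => [_|s L IH sL].
    have -> : ker [::] = X `&` P k by apply/seteqP; split=> x [].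
    by apply: closedI => //; exact: closedP.
  have -> : ker (s :: L) = ker L `&` [set x | P k x /\ icomm x s = 1].
    apply/seteqP; split=> [x [Xx Px h]|x [[Xx Px h] [_ xs]]].
      split; last by split=> //; apply: h; rewrite inE eqxx.
      by split=> // t tL; apply: h; rewrite inE tL orbT.
    by split=> // t; rewrite inE => /orP[/eqP ->|/h].
  apply: closedI; first by apply: IH => t tL; apply: sL; rewrite inE tL orbT.
  by apply: closed_ker => //; rewrite sL ?inE ?eqxx // subnKC.
have step L : okL L -> ~ (forall x, X x -> P k x -> (forall s, s \in L -> icomm x s = 1) -> P k.+1 x) ->
    exists s, size s = (c - k)%N /\ ~ (ker L `<=` ker (s :: L)).
  move=> oL nL; have [x [Xx Px xL nPx]] : exists x, [/\ X x, P k x, (forall s, s \in L -> icomm x s = 1) & ~ P k.+1 x].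
    apply: contrapT => h; apply: nL => x Xx Px xL; apply: contrapT => nPx.
    by apply: h; exists x.
  have [y [s [t [_ st _ xt]]]] := wP kc Px nPx.
  exists t; split=> // sub; have [_ _ h] := sub x (And3 Xx Px xL).
  by apply: xt; apply: h; rewrite inE eqxx.
have okc L s : okL L -> size s = (c - k)%N -> okL (s :: L).
  by move=> oL ss t; rewrite inE => /orP[/eqP ->|/oL].
have kerS L s : ker (s :: L) `<=` ker L.
  by move=> x [Xx Px h]; split=> // t tL; apply: h; rewrite inE tL orbT.
have kerX L : ker L `<=` X by move=> x [].
suff H n L : okL L -> (r (ker L) <= n)%N -> exists L', okL L' /\
    forall x, X x -> P k x -> (forall s, s \in L' -> icomm x s = 1) -> P k.+1 x.
  by apply: (H _ [::] _ (leqnn _)) => x.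
elim: n L => [|n IH] L oL rL.
  exists L; split=> //; apply: contrapT => /(step L oL)[s [ss]]; apply.
  apply: (r_strict (cker _ (okc _ _ oL ss)) (cker _ oL) (kerS _ _) (kerX _)).
  by move: rL; rewrite leqn0 => /eqP ->.
have [?|/(step L oL)[s [ss nsub]]] := pselect (forall x, X x -> P k x ->
    (forall s, s \in L -> icomm x s = 1) -> P k.+1 x); first by exists L.
apply: (IH (s :: L)); first exact: okc.
rewrite -ltnS; apply: leq_trans rL; rewrite ltnNge; apply/negP => le; apply: nsub.
exact: (r_strict (cker _ (okc _ _ oL ss)) (cker _ oL) (kerS _ _) (kerX _)).
Qed.

(** The set [b] contains, for generators t of each term P k, elements of which t is a
    commutator of weight at least k, so that f t lies in R k for every Lazard series R.
    It also contains tuples of length c - k that no element of X of exact level k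
    centralizes: if the image of such an element were in R (k + 1), its commutator
    with the image of the tuple would have weight c + 1, hence be trivial. *)
Theorem lazard_determined : exists2 b : set G, finite_set b &
  forall (H : groupType) (R : nat -> set H) (f : G -> H) (Y : set G),
    lazard_series c R -> subgroup Y -> X `<=` Y -> b `<=` Y ->
    (forall x y, Y x -> Y y -> f (x * y) = f x * f y) ->
    (forall x y, Y x -> Y y -> f x = f y -> x = y) ->
    (forall i, (0 < i) -> closed (Y `&` f @^-1` R i)) ->
  forall i x, (0 < i) -> X x -> P i x <-> R i (f x).
Proof.
have genP k : {TL : seq G * seq (seq G) | (0 < k <= c) ->
    [/\ [set` TL.1] `<=` X `&` P k, X `&` P k `<=` cl [set` TL.1],
        forall s, s \in TL.2 -> size s = (c - k)%N
      & forall x, X x -> P k x -> (forall s, s \in TL.2 -> icomm x s = 1) -> P k.+1 x]}.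
  apply: cid; have [kc|] := boolP (0 < k <= c); last by exists ([::], [::]).
  have /andP[k0 _] := kc.
  have [T T1 T2] := closed_fg (closedI cX (closedP k0)) (@subIsetl _ _ _).
  by have [L [L1 L2]] := finite_kernel kc; exists (T, L).
have witP a : {ys : G * seq G | forall k, (0 < k <= c) -> P k a -> a <> 1 ->
    icomm ys.1 ys.2 = a /\ (k <= (size ys.2).+1)%N}.
  apply: cid; have [->|a1] := pselect (a = 1); first by exists (1, [::]).
  have [k' [kc' Pa nPa]] := lazard_level lP a1; have [y [s [t [ss _ ya _]]]] := wP kc' Pa nPa.
  exists (y, s) => k /andP[k0 kc] Pk _; split=> //=.
  rewrite ss prednK; last by case/andP: kc'.
  rewrite leqNgt; apply/negP => kk'; apply: nPa.
  by apply: (lazard_mono lP (j := k)) => //; rewrite kk'.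
pose T k := (sval (genP k)).1; pose L k := (sval (genP k)).2.
pose bl := flatten [seq flatten [seq (sval (witP a)).1 :: (sval (witP a)).2 | a <- T k] ++ flatten (L k) | k <- iota 1 c].
exists [set` bl]; first exact: finite_seq.
move=> H R f Y lR sY XY bY fm fi cR.
have f1 : f 1 = 1 := phom1 sY fm; have fV := phomV sY fm.
have fR x y : Y x -> Y y -> f [~ x, y] = [~ f x, f y].
  move=> Yx Yy; have YxV := subV sY Yx; have YyV := subV sY Yy.
  have Yxy := subM sY Yx Yy.
  by rewrite /commg /conjg !fm ?fV //; apply: subM.
have fI s x : Y x -> (forall y, y \in s -> Y y) -> f (icomm x s) = icomm (f x) (map f s).
  elim: s x => [//|y s IH] x Yx Ys /=; have Yy : Y y by apply: Ys; rewrite inE eqxx.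
  rewrite IH ?fR //; first exact: subR.
  by move=> z zs; apply: Ys; rewrite inE zs orbT.
have fw k a : (0 < k <= c) -> a \in T k -> R k (f a).
  move=> kc aT; have [T1 _ _ _] := svalP (genP k) kc.
  have /andP[k0 kc'] := kc; have [Xa Pa] := T1 a aT.
  have [->|a1] := pselect (a = 1); first by rewrite f1; apply: sub1; exact: lazard_sub lR _ k0.
  have wY z : z \in (sval (witP a)).1 :: (sval (witP a)).2 -> Y z.
    move=> zw; apply: bY => /=; apply/flattenP; eexists.
      by apply: map_f; rewrite mem_iota add1n ltnS; exact: kc.
    rewrite mem_cat; apply/orP; left; apply/flattenP; eexists; last exact: zw.
    exact: (map_f (fun a => (sval (witP a)).1 :: (sval (witP a)).2)).
  have [ya ks] := svalP (witP a) k kc Pa a1.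
  rewrite -ya fI; first 1 last.
  - by apply: wY; rewrite inE eqxx.
  - by move=> z zw; apply: wY; rewrite inE zw orbT.
  apply: (lazard_mono lR (j := (1 + size (map f (sval (witP a)).2))%N)).
    by rewrite k0 size_map add1n.
  by apply: (lazard_icomm lR) => //; exact: (lazard_all lR).
move=> i x i0 Xx; split=> [Px|Rx].
  have [ci|ic] := ltnP c i.
    by rewrite (lazard_top lP ci Px) f1; apply: sub1; exact: lazard_sub lR _ i0.
  have kc : (0 < i <= c) by rewrite i0.
  have [T1 T2 _ _] := svalP (genP i) kc.
  have : (Y `&` f @^-1` R i) x.
    apply: (cl_min (cR i i0) _ (T2 x (conj Xx Px))) => a aT.
    by split; [apply: XY; case: (T1 a aT) | exact: fw].
  by case.
have H' k : (k < i) -> P k.+1 x.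
  elim: k => [_|k IH ki]; first exact: (lazard_all lP).
  have Px := IH (ltnW ki).
  have [ck|kc] := ltnP c k.+1.
    by rewrite (lazard_top lP ck Px); apply: sub1; exact: lazard_sub lP _ _.
  have [_ _ L1 L2] := svalP (genP k.+1) kc; apply: L2 => // s sL.
  have sY' z : z \in s -> Y z.
    move=> zs; apply: bY => /=; apply/flattenP; eexists.
      by apply: map_f; rewrite mem_iota add1n ltnS; exact: (kc : (0 < k.+1 <= c)%N).
    rewrite mem_cat; apply/orP; right; apply/flattenP; exists s => //.
  have Ys : Y (icomm x s).
    elim: (s) (x) (XY x Xx) sY' => //= y t IHt z Yz h; apply: IHt.
      by apply: subR => //; apply: h; rewrite inE eqxx.
    by move=> w wt; apply: h; rewrite inE wt orbT.
  apply: fi => //; first exact: sub1.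
  rewrite f1 fI //; last exact: XY.
  apply: (lazard_top lR (i := (k.+2 + size (map f s))%N)).
    by rewrite size_map L1 // addSn ltnS subnKC.
  by apply: (lazard_icomm lR) => //; apply: (lazard_mono lR (j := i)).
by case: i i0 Rx H' => // i _ _; apply.
Qed.

End Core.

(** * Members of the classes *)

Lemma lazard_preimage (G H : groupType) c (P : nat -> set H) (j : G -> H) :
  hom j -> injective j -> lazard_series c P -> lazard_series c (fun i => j @^-1` P i).
Proof.
move=> hj ij lP; have [_ P1 Pd _ _] := lP.
have sP i (i0 : (0 < i)) : subgroup (j @^-1` P i) := hom_preimage hj (lazard_sub lP i0).
split=> //; first by apply/seteqP; split=> // x _; exact: (lazard_all lP).
- by move=> i i0 x /=; apply: Pd.
- move=> k ck; apply/seteqP; split=> [x /(lazard_top lP ck) jx|_ ->].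
    by apply: ij; rewrite jx (hom1 hj).
  by apply: sub1; apply: sP; apply: leq_ltn_trans ck.
- move=> i k i0 k0; apply/comm_sub_le => [|x y Px Py]; first by apply: sP; rewrite addn_gt0 i0.
  by rewrite /= (homR hj); apply: (lazard_comm lP).
Qed.

Lemma Qpowered_preimage (G H : groupType) (A : set H) (j : G -> H) :
  Q_powered G -> Q_powered H -> hom j -> Q_powered_subgroup A -> Q_powered_subgroup (j @^-1` A).
Proof.
move=> QG QH hj QA; split; first exact (hom_preimage hj (proj1 QA)).
move=> g n n2 /= Ag; have [x [xg _]] := proj2 QG g n n2; exists x => //=.
by apply/(Qpowered_sub_root _ QH QA (ltnW n2)); rewrite -(homX hj) xg.
Qed.

Lemma torsion_free_inj (G H : groupType) (j : G -> H) :
  hom j -> injective j -> torsion_free H -> torsion_free G.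
Proof.
move=> hj ij tH x n n0 xn; apply: ij; rewrite (hom1 hj); apply: (tH _ n) => //.
by rewrite -(homX hj) xn (hom1 hj).
Qed.

Lemma gens_map (G H : groupType) (j : G -> H) (s : seq G) : hom j ->
  gens (map j s) = j @` gens s.
Proof.
move=> hj; apply/seteqP; split.
  apply: gen_min; first exact (hom_image hj (subgroup_genP _)).
  by move=> _ /mapP[x xs ->]; exists x => //; exact: sub_gen.
move=> _ [x xs <-]; move: x xs; apply: (gen_min (hom_preimage hj (subgroup_genP _))) => x xs.
by apply: sub_gen; exact: map_f.
Qed.

Lemma exists_gens (G : groupType) (s : seq G) :
  exists (H : groupType) (j : H -> G) (t : seq H),
    [/\ hom j, injective j, map j t = s & forall x, gens t x].
Proof.
have [H [j [hj ij rj]]] := exists_sub (subgroup_genP [set x | x \in s]).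
have [t ts] : exists t, map j t = s.
  apply: map_lift => y ys.
  by have [z _ zy] : range j y by [rewrite rj; exact: sub_gen]; exists z.
exists H, j, t; split=> // x.
have : gens (map j t) (j x) by rewrite ts -rj; exists x.
by rewrite gens_map // => -[z zt /ij <-].
Qed.

Lemma exists_roots (G : groupType) : Q_powered G -> exists r : nat -> G -> G, is_root r.
Proof.
move=> [_ rG].
suff H n : {f : G -> G & forall g, (2 <= n) -> f g ^+ n = g}.
  by exists (fun n => projT1 (H n)) => n g n2; exact: (projT2 (H n) g n2).
apply: (@boolp.choice _ _ (fun g x => (2 <= n) -> x ^+ n = g)) => g.
by have [n2|n2] := leqP 2 n; [have [x [xg _]] := rG g n n2; exists x | exists g].
Qed.

Lemma qgrp_fgP (G : groupType) c r : Q_powered G -> nil_class G c -> is_root r ->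
  finitely_generated (qgrp_str (G := G) r) <-> exists s : seq G, forall x, roots (gens s) x.
Proof.
move=> QG nG ir; split=> [[A /finite_seqP[s ->] gA]|[s sG]].
  by exists s => x; rewrite -(qgrp_generated _ QG ir nG) gA.
exists [set` s]; first exact: finite_seq.
by apply/seteqP; split=> // x _; rewrite (qgrp_generated _ QG ir nG).
Qed.

Lemma grp_fgP (G : groupType) :
  finitely_generated (grp_str G) <-> exists s : seq G, forall x, gens s x.
Proof.
split=> [[A /finite_seqP[s ->] gA]|[s sG]].
  by exists s => x; have : [set: G] x by []; rewrite -gA grp_generated.
exists [set` s]; first exact: finite_seq.
by apply/seteqP; split=> // x _; rewrite grp_generated.
Qed.

Lemma exists_hull (U : groupType) c (P : nat -> set U) (s : seq U) : lazard_Q c P ->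
  exists (H : groupType) (R : nat -> set H) (j : H -> U),
    [/\ lazard_Q c R, hom j /\ injective j, range j = roots (gens s)
      & exists t : seq H, forall x, roots (gens t) x].
Proof.
move=> [QU nU lP QP].
have [sA rA] := roots_Qpowered QU nU (subgroup_genP [set x | x \in s]).
have [H [j [hj ij rj]]] := exists_sub sA.
have QH : Q_powered H.
  split=> [|g n n2]; first exact (torsion_free_inj hj ij (proj1 QU)).
  have [|x] := rA (j g) n n2; first by rewrite -rj; exists g.
  rewrite -rj => -[h _ <-] hg; exists h; split.
    by apply: ij; rewrite (homX hj).
  move=> h' h'g; apply: ij; apply: (@Qpowered_expI _ n); rewrite ?(ltnW n2) //.
  by rewrite hg -(homX hj) h'g.
exists H, (fun i => j @^-1` P i), j; split=> //.
  split=> //; first exact (nil_inj hj ij nU).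
    exact: lazard_preimage.
  by move=> i i0; apply: Qpowered_preimage => //; exact: QP.
have [t ts] : exists t, map j t = s.
  apply: map_lift => y ys.
  by have [z _ zy] : range j y by [rewrite rj; apply: sub_roots; exact: sub_gen]; exists z.
exists t => x; have : roots (gens s) (j x) by rewrite -rj; exists x.
case=> n n0; rewrite -ts gens_map // -(homX hj) => -[z zt /ij zx].
by exists n => //; rewrite -zx.
Qed.

(** Embed a finitely generated subgroup with the same hull in a group with a Lazard
    series, extend the embedding to the hull, and pull the series back. *)
Lemma exists_lazard_Q (H : groupType) c (s : seq H) : Q_powered H -> nil_class H c ->
  (forall x, roots (gens s) x) -> exists P : nat -> set H, lazard_Q c P.
Proof.
move=> QH nH sH; have [H1 [j [t [hj ij js tH]]]] := exists_gens s.
have [U [i [P [[QU nU lP QP] hi ii]]]] :=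
  embed_in_Qpowered (nil_inj hj ij nH) (torsion_free_inj hj ij (proj1 QH)) tH.
pose ji h : H * U := (j h, i h).
have hji : hom ji by move=> x y; rewrite /ji hj hi.
have sR : subgroup (range ji) := hom_image hji (@subgroupT _).
have [y [h _ [h1 <-]]|x [h _ [<- h1]]|f [fm fi _ _]] := extend_to_roots QH QU nH nU sR.
- by have -> : h = 1; [apply: ij; rewrite h1 (hom1 hj) | exact: hom1].
- by have -> : h = 1; [apply: ii; rewrite h1 (hom1 hi) | exact: hom1].
have D x : roots [set x | exists y, range ji (x, y)] x.
  move: x (sH x) => x [n n0]; rewrite -js gens_map // => -[z _ zx].
  by exists n => //; exists (i z); exists z; rewrite // -zx.
have hf : hom f by move=> x y; exact: fm.
have if' : injective f by move=> x y; apply: fi.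
exists (fun k => f @^-1` P k); split=> //; first exact: lazard_preimage.
by move=> k k0; apply: Qpowered_preimage => //; exact: QP.
Qed.

Lemma KP_cp_intro c p (H : groupType) (R : nat -> set H) :
  finite_set [set: H] -> exponent H p -> nil_class H c -> lazard_series c R ->
  @KP_cp c p (@preds_str grp_lang c.+1 (grp_str H) (fun i => R i.+1)).
Proof. by move=> fH eH nH lR; exists H, R; split=> //; [apply/nilP | exact: iso_refl]. Qed.

Lemma KP_cQ_intro c (H : groupType) (R : nat -> set H) r (s : seq H) :
  lazard_Q c R -> is_root r -> (forall x, roots (gens s) x) ->
  @KP_cQ c (@preds_str qgrp_lang c.+1 (qgrp_str r) (fun i => R i.+1)).
Proof.
move=> [QH nH lR QR] ir sH; exists H, r, R; split=> //; try exact: iso_refl.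
  exact/nilP.
by apply/(qgrp_fgP QH nH ir); exists s.
Qed.

Definition level_witness (H : groupType) c (R : nat -> set H) k (b : H) :=
  [/\ R k b, ~ R k.+1 b & exists (y : H) s t,
    [/\ size s = k.-1, size t = (c - k)%N, icomm y s = b & icomm b t <> 1]].

(** Take the commutator of the first k entries of [y :: s]: it has weight k, and it is not
    in the next term because the commutator with the remaining entries is not 1. *)
Lemma exists_level (H : groupType) c (R : nat -> set H) (y : H) s k : lazard_series c R ->
  size s = c.-1 -> icomm y s <> 1 -> (0 < k <= c) -> exists b, level_witness c R k b.
Proof.
move=> lR ss ys /andP[k0 kc].
have s1 : size (take k.-1 s) = k.-1 by rewrite size_takel // ss; lia.
have s2 : size (drop k.-1 s) = (c - k)%N by rewrite size_drop ss; lia.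
have ys' : icomm (icomm y (take k.-1 s)) (drop k.-1 s) <> 1 by rewrite -icomm_cat cat_take_drop.
exists (icomm y (take k.-1 s)); split; last by exists y, (take k.-1 s), (drop k.-1 s).
  have := lazard_icomm lR (take k.-1 s) (ltn0Sn 0) (lazard_all lR y).
  by rewrite s1 add1n prednK.
move=> Rk; apply: ys'; apply: (lazard_top lR (i := (k.+1 + size (drop k.-1 s))%N)).
  by rewrite s2; lia.
exact: (lazard_icomm lR).
Qed.

Lemma witnessed_transfer (G : groupType) c (P : nat -> set G) :
  (forall k a, (0 < k <= c) -> P k a -> ~ P k.+1 a ->
    exists (H : groupType) (R : nat -> set H) (b : H) (g : H -> G),
      [/\ level_witness c R k b, hom g, injective g & g b = a]) ->
  witnessed c P.
Proof.
move=> h k a kc Pa nPa.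
have [H [R [b [g [[_ _ [y [s [t [ss st yb bt]]]]] hg ig <-]]]]] := h k a kc Pa nPa.
exists (g y), (map g s), (map g t); rewrite !size_map -!(hom_icomm hg) yb; split=> //.
by rewrite -(hom1 hg) => /ig.
Qed.

Lemma gens1 (G : groupType) (a x : G) : gens [:: a] x -> exists n, x = a ^+ n \/ x = a ^- n.
Proof.
case/gens_cyclic => [u /gens_nil ->|n [u [/gens_nil -> xE]]].
  by rewrite !conj1g; split; apply: sub1; exact: subgroup_genP.
by exists n; rewrite !mulg1 in xE.
Qed.

(** An element a of G and an element b of H of the same level k generate cyclic groups
    in which the terms of the two series correspond. The hypotheses [aP] and [bR] hold
    for prime exponent as well as for subgroups closed under roots. *)
Section Line.
Variables (G H : groupType) (c k : nat) (P : nat -> set G) (R : nat -> set H) (a : G) (b : H).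
Hypotheses (lP : lazard_series c P) (lR : lazard_series c R)
  (Pa : P k a) (nPa : ~ P k.+1 a) (Rb : R k b) (nRb : ~ R k.+1 b).
Hypothesis ab1 : forall n, a ^+ n = 1 <-> b ^+ n = 1.
Hypothesis aP : forall n i, (0 < i) -> a ^+ n <> 1 -> P i (a ^+ n) -> P i a.
Hypothesis bR : forall n i, (0 < i) -> b ^+ n <> 1 -> R i (b ^+ n) -> R i b.

Local Notation graph := (gens [:: (a, b)]).

Lemma line_graph x y : graph (x, y) -> exists n,
  (x = a ^+ n /\ y = b ^+ n) \/ (x = a ^- n /\ y = b ^- n).
Proof. by move=> /gens1[n] []; rewrite pairX => -[-> ->]; exists n; [left|right]. Qed.

Lemma line_fun y : graph (1, y) -> y = 1.
Proof.
move=> /line_graph[n [[/esym an ->]|[/esym an ->]]]; first exact/ab1.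
have : a ^+ n = 1 by rewrite -[LHS]invgK an invg1.
by move/ab1 => ->; rewrite invg1.
Qed.

Lemma line_inj x : graph (x, 1) -> x = 1.
Proof.
move=> /line_graph[n [[-> /esym bn]|[-> /esym bn]]]; first exact/ab1.
have : b ^+ n = 1 by rewrite -[LHS]invgK bn invg1.
by move/ab1 => ->; rewrite invg1.
Qed.

Lemma line_dom x : gens [:: a] x -> exists y, graph (x, y).
Proof.
move=> xa; have [z gz <-] : (fst @` (graph : set (G * H))) x.
  move: x xa; apply: (gen_min (hom_image (@hom_fst G H) (subgroup_genP _))) => x /=.
  by rewrite inE => /eqP ->; exists (a, b) => //; apply: sub_gen; rewrite /= inE eqxx.
by exists z.2; case: z gz.
Qed.

Lemma line_preds x y i : (0 < i) -> graph (x, y) -> P i x <-> R i y.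
Proof.
move=> i0 /line_graph[n nE].
have sP := lazard_sub lP i0; have sR := lazard_sub lR i0.
have Pi : P i a <-> (i <= k).
  split=> [Pia|ik]; last by apply: (lazard_mono lP (j := k)) => //; rewrite i0.
  by rewrite leqNgt; apply/negP => ki; apply: nPa; apply: (lazard_mono lP (j := i)).
have Ri : R i b <-> (i <= k).
  split=> [Pia|ik]; last by apply: (lazard_mono lR (j := k)) => //; rewrite i0.
  by rewrite leqNgt; apply/negP => ki; apply: nRb; apply: (lazard_mono lR (j := i)).
suff : P i (a ^+ n) <-> R i (b ^+ n).
  case: nE => -[-> ->] //.
  have VP (K : groupType) (A : set K) u : subgroup A -> A u^-1 <-> A u.
    by move=> sA; split=> [/(subV sA)|/(subV sA) //]; rewrite invgK.
  move=> h; apply: iff_trans (VP _ _ _ sP) _; apply: iff_trans h _.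
  exact: iff_sym (VP _ _ _ sR).
have [a1|a1] := pselect (a ^+ n = 1).
  by rewrite a1 (proj1 (ab1 n) a1); split=> _; apply: sub1.
have b1 : b ^+ n <> 1 by move/ab1.
split=> [/(aP i0 a1)/Pi/Ri Rib|/(bR i0 b1)/Ri/Pi Pia]; exact: subX.
Qed.

End Line.

(** * The limit of exponent p *)

Lemma count_strict (T : eqType) (A B : pred T) (s : seq T) :
  (forall x, A x -> B x) -> (count B s <= count A s) ->
  forall x, x \in s -> B x -> A x.
Proof.
move=> AB; elim: s => //= y s IH le x; rewrite inE => xs Bx.
have le' := sub_count AB s.
have yAB : B y -> A y by move=> By; move: le; rewrite By; case: (A y) => //=; lia.
have le2 : (count B s <= count A s).
  by move: le; case By: (B y); [rewrite (yAB By)|]; case: (A y) (AB y) => //=; try lia; move=> /(_ isT); rewrite By.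
by case/orP: xs => [/eqP xy|xs]; [rewrite xy in Bx *; exact: yAB | exact: IH].
Qed.

Lemma exists_exponent_witness c p : (0 < c < p) -> prime p ->
  exists (H : groupType) (R : nat -> set H) (y : H) s,
    [/\ finite_set [set: H], exponent H p, nil_class H c, lazard_series c R
      & size s = c.-1 /\ icomm y s <> 1].
Proof.
move=> /andP[c0 cp] p_pr.
pose H := unitriangular 'F_p c.
have nH : nil_class H c := @unitriangular_nil _ _.
have [y [s ys]] := unitriangular_witness 'F_p c0.
exists H, (fun i => @lower_central H i.-1), y, s; split=> //.
- have -> : [set: H] = (@mx_of 'F_p c) @^-1` setT by [].
  apply: finite_preimage; last exact: finite_finset.
  by move=> u v _ _; exact: mx_of_inj.
- apply: unitriangular_exponent => //.
  exact: pchar_Fp_0.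
- by apply: lower_central_series; apply/nilP.
Qed.

Section ExponentP.
Variables (c p : nat) (G : groupType) (P : nat -> set G).
Hypotheses (c0 : (0 < c)) (cp : (c < p)) (p_pr : prime p).
Local Notation GP := (@preds_str grp_lang c.+1 (grp_str G) (fun i => P i.+1)).
Hypotheses (lim : fraisse_limit (@KP_cp c p) GP).
Hypotheses (eG : exponent G p) (nG : nil_class G c) (lP : lazard_series c P).

Lemma exponent_mem (H : groupType) (A : set H) x n : exponent H p -> subgroup A ->
  x ^+ n <> 1 -> A (x ^+ n) -> A x.
Proof.
move=> eH sA xn Axn.
have n0 : (0 < n) by rewrite lt0n; apply: contra_notN xn => /eqP ->.
have co : coprime n p.
  rewrite coprime_sym prime_coprime //; apply: contra_notN xn => /dvdnP[m ->].
  by rewrite mulnC expgnA eH expg1n.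
have [u v uv _] := egcdnP p n0; rewrite (eqP co) in uv.
have : x ^+ (u * n) = x by rewrite uv expgnDr mulnC expgnA eH expg1n mul1g.
by move=> <-; rewrite mulnC expgnA; exact: subX.
Qed.

Lemma exponent_exp1 (H K : groupType) (x : H) (y : K) n : exponent H p -> exponent K p ->
  x <> 1 -> x ^+ n = 1 -> y ^+ n = 1.
Proof.
move=> eH eK x1 xn; have [pn|pn] := boolP (p %| n).
  by have /dvdnP[m ->] := pn; rewrite mulnC expgnA eK expg1n.
case: x1; have n0 : (0 < n) by rewrite lt0n; apply: contraNneq pn => ->.
have [u v uv _] := egcdnP p n0.
have co : coprime n p by rewrite coprime_sym prime_coprime.
rewrite (eqP co) in uv.
have <- : x ^+ (u * n) = x by rewrite uv expgnDr mulnC expgnA eH expg1n mul1g.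
by rewrite mulnC expgnA xn expg1n.
Qed.

Lemma preds_sub_lazard (H : groupType) (R : nat -> set H) (X : set G) (f : G -> H) :
  subgroup X -> (forall x y, X x -> X y -> f (x * y) = f x * f y) ->
  (forall x y, X x -> X y -> f x = f y -> x = y) ->
  (forall i x, (0 < i) -> X x -> P i x <-> R i (f x)) ->
  emb_on (M := GP) (N := @preds_str grp_lang c.+1 (grp_str H) (fun i => R i.+1)) X f.
Proof.
move=> sX fm fi fP; apply/preds_emb_on; split; first by apply/grp_emb_on.
by move=> i x Xx; apply: fP.
Qed.

Lemma exponent_extend (H : groupType) (R : nat -> set H) (s : seq G) (f : G -> H) :
  finite_set [set: H] -> exponent H p -> nil_class H c -> lazard_series c R ->
  (forall x y, gens s x -> gens s y -> f (x * y) = f x * f y) ->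
  (forall x y, gens s x -> gens s y -> f x = f y -> x = y) ->
  (forall i x, (0 < i) -> gens s x -> P i x <-> R i (f x)) ->
  exists g : H -> G, [/\ hom g, injective g & forall x, gens s x -> g (f x) = x].
Proof.
move=> fH eH nH lR fm fi fP.
have ef := preds_sub_lazard (subgroup_genP _) fm fi fP.
have gE : generated (M := GP) [set` s] = gens s := grp_generated [set` s].
rewrite -gE in ef.
have [g eg gf] := fraisse_extend lim (finite_seq s) (KP_cp_intro fH eH nH lR) ef.
have /preds_embeddingP[/grp_embeddingP[ig hg] _] := eg.
by exists g; split=> // x sx; apply: gf; rewrite gE.
Qed.

(** By homogeneity, an element of level k is the commutator of weight k in a copy of the
    unitriangular group. *)
Lemma exponent_witnessed : witnessed c P.
Proof.
have [|H [R [y [s [fH eH nH lR [ss ys]]]]]] := @exists_exponent_witness c p _ p_pr.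
  by rewrite c0.
apply: witnessed_transfer => k a kc Pa nPa; have /andP[k0 _] := kc.
have [b wb] := exists_level lR ss ys kc; have [Rb nRb _] := wb.
have a1 : a <> 1 by move=> a1; apply: nPa; rewrite a1; apply: sub1; exact: lazard_sub lP _ _.
have b1 : b <> 1 by move=> b1; apply: nRb; rewrite b1; apply: sub1; exact: lazard_sub lR _ _.
have ab n : a ^+ n = 1 <-> b ^+ n = 1 by split; exact: exponent_exp1.
have [f [fm fi fR]] := graph_hom (subgroup_genP _) (@line_fun _ _ a b ab) (@line_inj _ _ a b ab).
have [|||g [hg ig gf]] := @exponent_extend H R [:: a] f fH eH nH lR.
- by move=> x x' /(line_dom b) Dx /(line_dom b) Dx'; apply: fm.
- by move=> x x' /(line_dom b) Dx /(line_dom b) Dx'; apply: fi.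
- move=> i x i0 /(line_dom b)[z xz]; rewrite (fR _ _ xz).
  apply: (line_preds lP lR Pa nPa Rb nRb ab _ _ i0 xz) => n j j0 n1.
    exact: exponent_mem eG (lazard_sub lP j0) n1.
  exact: exponent_mem eH (lazard_sub lR j0) n1.
exists H, R, b, g; split=> //.
by rewrite -(fR a b (@gens_head _ _ _)); exact: gf (@gens_head _ _ _).
Qed.

Lemma exponent_gens_finite (s : seq G) : finite_set (gens s).
Proof.
have [_ _ age _] := lim.
have [A [H [R [fH _ _ _ AH]]] [f [ef [g fg gf]]]] := age _ (@gen_sub_fg _ GP [set` s] (finite_seq s)).
have [h [eh [h' hh' h'h]]] := AH.
pose m (x : H) : G := sval (f (h' x)).
have -> : gens s = range m; last by apply: finite_image.
rewrite -(grp_generated [set` s]); apply/seteqP; split=> [x Sx|_ [x _ <-]].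
  exists (h (g (exist _ x Sx))) => //; by rewrite /m hh' gf.
exact: (svalP (f (h' x))).
Qed.

Lemma exponent_determines (a : set G) : finite_set a ->
  exists b, [/\ finite_set b, a `<=` b & determines (M := grp_str G) (K_cp c p) a b].
Proof.
move=> /finite_seqP[sa aE]; have /finite_seqP[l lE] := exponent_gens_finite sa.
have gE (t : seq G) : generated (M := grp_str G) [set` t] = gens t by exact: grp_generated.
pose r (A : set G) := count (fun x => `[< A x >]) l.
have [||||||||| b0 fb0 bP] := @lazard_determined G c P lP exponent_witnessed
    (@subgroup G) (@subgroup_gen G) (gens sa) _ _ _ _ _ _ _ r (size l) _ _.
- exact: subgroupI.
- exact: lazard_sub lP.
- by move=> k s k0 ks; exact: icomm_ker lP _ _ k0 ks.
- exact: subgroup_genP.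
- exact: sub_gen.
- by move=> A B; exact: gen_min.
- exact: subgroup_genP.
- by move=> A; exact: count_size.
- move=> A B _ _ AB BX rBA x Bx; apply/asboolP.
  apply: (@count_strict G (fun x => `[< A x >]) (fun x => `[< B x >]) l _ rBA x); last exact/asboolP.
    by move=> y /asboolP Ay; apply/asboolP; exact: AB.
  by have := BX x Bx; rewrite lE.
have /finite_seqP[sb0 b0E] := fb0.
exists [set` sa ++ sb0]; split; first exact: finite_seq.
  by move=> x; rewrite aE /= mem_cat => ->.
move=> C [H [fH eH nH [phi [ephi [psi phiK psiK]]]]] f ef.
have {nH}nH : nil_class H c by apply/nilP.
have lR := lower_central_series (proj2 (nilP H c) nH).
have ef' : emb_on (M := grp_str G) (N := grp_str H) (gens (sa ++ sb0)) (phi \o f).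
  rewrite -gE; by apply: emb_on_comp ef _; exact: embedding_emb_on.
have [fi fm] := proj1 (grp_emb_on _ (subgroup_genP _)) ef'.
have saY : gens sa `<=` gens (sa ++ sb0).
  by apply: gen_mono => x /= xs; rewrite mem_cat xs.
have bY : b0 `<=` gens (sa ++ sb0).
  by move=> x; rewrite b0E => /= xb; apply: sub_gen; rewrite /= mem_cat xb orbT.
have fP := bP H _ (phi \o f) _ lR (subgroup_genP _) saY bY fm fi.
have [|||g [hg ig gf]] := @exponent_extend H _ sa (phi \o f) fH eH nH lR.
- by move=> x y /saY Yx /saY Yy; exact: fm.
- by move=> x y /saY Yx /saY Yy; exact: fi.
- move=> i x i0 Xx; apply: fP => // j j0.
  exact: (partial_preimage (subgroup_genP _) fm (lazard_sub lR j0)).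
exists (g \o phi).
  by apply: embedding_comp ephi _; apply/grp_embeddingP.
by move=> x; rewrite aE gE; exact: gf.
Qed.

End ExponentP.
(** * Genericity in exponent p *)

Lemma lazard_prod (G H : groupType) c (P : nat -> set G) (R : nat -> set H) :
  lazard_series c P -> lazard_series c R ->
  lazard_series c (fun i => [set u : G * H | P i u.1 /\ R i u.2]).
Proof.
move=> lP lR.
have sPR i : (0 < i) -> subgroup [set u : G * H | P i u.1 /\ R i u.2].
  move=> i0; have sP := lazard_sub lP i0; have sR := lazard_sub lR i0.
  apply: subgroup_intro => [|u v [Pu Ru] [Pv Rv]|u [Pu Ru]].
  - by split; exact: sub1.
  - by split; exact: subM.
  - by split; exact: subV.
split=> //.
- by apply/seteqP; split=> // u _; split; [exact: (lazard_all lP) | exact: (lazard_all lR)].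
- by move=> i i0 u [Pu Ru]; case: lP => _ _ Pd _ _; case: lR => _ _ Rd _ _; split; [exact: Pd | exact: Rd].
- move=> k ck; apply/seteqP; split=> [[x y] [/(lazard_top lP ck) /= -> /(lazard_top lR ck) /= ->] //|_ ->].
  by apply: (sub1 (sPR k _)); apply: leq_ltn_trans ck.
- move=> i j i0 j0; apply/comm_sub_le; first by apply: sPR; rewrite addn_gt0 i0.
  move=> u v [Pu Ru] [Pv Rv]; split; first exact: (lazard_comm lP i0 j0 Pu Pv).
  exact: (lazard_comm lR i0 j0 Ru Rv).
Qed.

(** The complement of a proper subgroup contains a coset. *)
Lemma coinfinite_group (L : language) (h : lang_map grp_lang L) (K : structure L -> Prop) :
  (forall A, K A -> exists G : groupType, isomorphic (reduct h A) (grp_str G)) ->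
  forall N : structure L, fg_subs_in K N ->
  forall X : set N, fun_closed X -> X <> setT -> infinite_set X -> infinite_set (~` X).
Proof.
move=> hK N age X cX XT iX.
have [|G NG] := @locally_groupP (reduct h N).
  move=> S fS; have [A KA [j ej jS]] := cover_fg age fS.
  have [G [f /iso_inverse[g [eg _] [fg gf]]]] := hK A KA.
  exists G, (j \o g); split; first exact: embedding_comp eg (reduct_embedding h ej).
  by move=> x /jS[a _ <-]; exists (f a) => //=; rewrite fg.
have cX' : fun_closed (M := reduct h N) X by move=> n F; exact: (cX n (fun_map h F)).
have : forall Y : set (reduct h N), fun_closed (M := reduct h N) Y -> Y <> setT ->
    infinite_set Y -> infinite_set (~` Y).
  rewrite NG => Y /grp_closed sY YT iY fY; apply: iY.
  have [y ny] : exists y, ~ Y y.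
    by apply: contrapT => h'; apply: YT; apply/seteqP; split=> // z _; apply: contrapT => nz; apply: h'; exists z.
  have : finite_set ((fun x => y^-1 * x) @` (~` Y)) by exact: finite_image.
  apply: sub_finite_set => x Yx; exists (y * x); last by rewrite mulKg.
  by move=> Yyx; apply: ny; exact: subMl sY Yx Yyx.
by apply.
Qed.

Lemma age_reduct (L : language) m (K : structure (preds_lang L m) -> Prop)
    (K' : structure L -> Prop) (S : structure L) (P : 'I_m -> set S) :
  (forall A, K A -> K' (reduct (forget_preds L m) A)) ->
  fg_subs_in K (preds_str P) -> fg_subs_in K' S.
Proof.
move=> KK' age X /sub_str_fg[A fA XA].
pose cX : fun_closed (M := preds_str P) (sub_set X) := @sub_closed _ _ X.
have fgX : finitely_generated (sub_str (Substructure cX)) by apply/sub_str_fg; exists A.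
have [B KB BX] := age _ fgX.
exists (reduct (forget_preds L m) B); first exact: KK'.
exact: (reduct_isomorphic (forget_preds L m) BX).
Qed.

Lemma finitely_generated_iso (L : language) (A B : structure L) :
  isomorphic A B -> finitely_generated A -> finitely_generated B.
Proof.
move=> [f [ef [g fg gf]]] [S fS gS]; exists (f @` S); first exact: finite_image.
by rewrite (embedding_fg ef gS); apply/seteqP; split=> // y _; exists (g y).
Qed.

Section ExponentGeneric.
Variables (c p : nat) (G : groupType) (P : nat -> set G).
Hypotheses (c0 : (0 < c)) (cp : (c < p)) (p_pr : prime p).
Local Notation GP := (@preds_str grp_lang c.+1 (grp_str G) (fun i => P i.+1)).
Hypotheses (lim : fraisse_limit (@KP_cp c p) GP).
Hypotheses (eG : exponent G p) (nG : nil_class G c) (lP : lazard_series c P).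

(** Otherwise the embedding of G in a larger product G x H would have a left inverse
    defined and injective on the whole product. *)
Lemma exponent_not_fg : ~ finitely_generated (grp_str G).
Proof.
move=> /grp_fgP[s sG].
have fG : finite_set [set: G].
  have -> : [set: G] = gens s by apply/seteqP; split=> // x _; exact: sG.
  exact: exponent_gens_finite lim s.
have [|H [R [y [t [fH eH nH lR [_ yt]]]]]] := @exists_exponent_witness c p _ p_pr.
  by rewrite c0.
have [||||||| g [hg ig gf]] := @exponent_extend c p G P lim (G * H)%type
    (fun i => [set u : G * H | P i u.1 /\ R i u.2]) s (fun x => (x, 1)).
- by rewrite -setXTT; exact: finite_setX.
- by move=> [x z]; rewrite pairX eG eH.
- exact: nil_prod.
- exact: lazard_prod.
- by move=> x x' _ _; rewrite -[RHS]/(_, _) /= mulg1.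
- by move=> x x' _ _ [].
- move=> i x i0 _; split=> [Px|[]//]; split=> //.
  exact: (sub1 (lazard_sub lR i0)).
have := gf (g (1, icomm y t)) (sG _) => /ig [_ /esym].
exact: yt.
Qed.

Theorem exponent_generic : generic_for (K_cp c p) (grp_str G).
Proof.
have [cG univ age _] := lim.
apply: (generic_criterion (GOne : fun_sym grp_lang 0)).
- move=> A [H [fH _ _ [f [ef [g fg gf]]]]]; exists setT.
    have -> : [set: A] = f @^-1` [set: H] by [].
    by apply: (finite_preimage _ fH) => x y _ _ /(can_inj fg).
  by apply/seteqP; split=> // x _; exact: sub_generated.
- move=> A [H [fH eH /nilP nH [phi [ephi _]]]].
  have lR := lower_central_series (proj2 (nilP H c) nH).
  have [g /preds_embeddingP[eg _]] := univ _ (KP_cp_intro fH eH nH lR).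
  by exists (g \o phi); exact: embedding_comp ephi eg.
- apply: age_reduct age => A [H [R [fH eH nH _ AH]]]; exists H; split=> //.
  exact: (reduct_isomorphic (forget_preds _ _) AH).
- exact: cG.
- exact: exponent_not_fg.
- apply: (@coinfinite_group grp_lang (LangMap (fun _ F => F) (fun _ R => R))).
  move=> A [H [_ _ _ AH]]; exists H.
  exact: (reduct_isomorphic (LangMap (L := grp_lang) (L' := grp_lang) (fun _ F => F) (fun _ R => R)) AH).
- exact: (exponent_determines c0 cp p_pr lim eG lP).
Qed.

End ExponentGeneric.

(** * The limit of Q-powered groups *)

Lemma qgrp_emb_on (G H : groupType) r r' (X : set G) (f : G -> H) :
  Q_powered H -> is_root r -> is_root r' -> Q_powered G -> Q_powered_subgroup X ->
  (forall x y, X x -> X y -> f (x * y) = f x * f y) ->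
  (forall x y, X x -> X y -> f x = f y -> x = y) ->
  emb_on (M := qgrp_str (G := G) r) (N := qgrp_str (G := H) r') X f.
Proof.
move=> QH ir ir' QG QX fm fi; have sX := proj1 QX.
have [_ gf _] := proj2 (grp_emb_on f sX) (conj fi fm).
split=> // n F; case: F => [k F|m hm] t Xt; first exact: gf.
rewrite /= [t]tuple1E /=; have Xx : X (thead t) := Xt ord0.
have Xr : X (r m (thead t)) by apply/(Qpowered_sub_root _ QG QX (ltnW hm)); rewrite ir.
by apply: (@Qpowered_expI _ m); rewrite ?(ltnW hm) // -(phomX sX fm _ Xr) ir // ir'.
Qed.

(** A completion of the group of integral unitriangular matrices. *)
Lemma exists_Q_witness c : (0 < c) ->
  exists (H : groupType) (R : nat -> set H) (t : seq H) (y : H) s,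
    [/\ lazard_Q c R, forall x, roots (gens t) x & size s = c.-1 /\ icomm y s <> 1].
Proof.
move=> c0; have nZ := @unitriangular_nil int c.
have tZ : torsion_free (unitriangular int c).
  apply: unitriangular_torsion_free => a n n0 /eqP.
  rewrite -GRing.mulr_natr natz GRing.mulf_eq0 => /orP[/eqP //|].
  by rewrite eqz_nat eqn0Ngt n0.
have [y [s [ss ys]]] := unitriangular_witness int c0.
have [H1 [j [t [hj ij jt tH]]]] := exists_gens (y :: s).
case: t jt tH => [//|y1 s1] /= [jy js] tH.
have [U [i [P [lQ hi ii]]]] :=
  embed_in_Qpowered (nil_inj hj ij nZ) (torsion_free_inj hj ij tZ) tH.
have [H [R [k [lR [hk ik] rk [t tH']]]]] := exists_hull (map i (y1 :: s1)) lQ.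
have lift z : z \in map i (y1 :: s1) -> exists w, k w = z.
  move=> zs; have [w _ wz] : range k z by rewrite rk; apply: sub_roots; exact: sub_gen.
  by exists w.
have [y2 ky] := lift (i y1) (mem_head _ _).
have [s2 ks] : exists s2, map k s2 = map i s1.
  by apply: map_lift => z zs; apply: lift; rewrite inE zs orbT.
exists H, R, t, y2, s2; split=> //; split.
  by rewrite -ss -js size_map -(size_map i) -ks size_map.
move=> e; apply: ys; rewrite -jy -js -(hom_icomm hj).
have -> : icomm y1 s1 = 1; last exact: hom1.
by apply: ii; rewrite (hom_icomm hi) -ky -ks -(hom_icomm hk) e (hom1 hk) (hom1 hi).
Qed.

Section QLimit.
Variables (c : nat) (G : groupType) (root : nat -> G -> G) (P : nat -> set G).
Hypothesis c0 : (0 < c).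
Local Notation GP := (@preds_str qgrp_lang c.+1 (qgrp_str root) (fun i => P i.+1)).
Hypotheses (lim : fraisse_limit (@KP_cQ c) GP) (ir : is_root root) (lQ : lazard_Q c P).

Let QG : Q_powered G. Proof. by case: lQ. Qed.
Let nG : nil_class G c. Proof. by case: lQ. Qed.
Let lP : lazard_series c P. Proof. by case: lQ. Qed.
Let QP i : (0 < i) -> Q_powered_subgroup (P i). Proof. by case: lQ => _ _ _; apply. Qed.

Let Qhull (s : seq G) : Q_powered_subgroup (roots (gens s)) :=
  roots_Qpowered QG nG (subgroup_genP _).

Lemma Q_extend (H : groupType) (R : nat -> set H) (s : seq G) (t : seq H) (f : G -> H) :
  lazard_Q c R -> (forall x, roots (gens t) x) ->
  (forall x y, roots (gens s) x -> roots (gens s) y -> f (x * y) = f x * f y) ->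
  (forall x y, roots (gens s) x -> roots (gens s) y -> f x = f y -> x = y) ->
  (forall i x, (0 < i) -> roots (gens s) x -> P i x <-> R i (f x)) ->
  exists g : H -> G, [/\ hom g, injective g & forall x, roots (gens s) x -> g (f x) = x].
Proof.
move=> lR tH fm fi fP; have [QH nH _ _] := lR; have [r irr] := exists_roots QH.
have gE : generated (M := GP) [set` s] = roots (gens s) := qgrp_generated [set` s] QG ir nG.
have ef : emb_on (M := GP) (N := @preds_str qgrp_lang c.+1 (qgrp_str r) (fun i => R i.+1))
    (generated (M := GP) [set` s]) f.
  rewrite gE; apply/preds_emb_on; split; first exact: qgrp_emb_on.
  by move=> i x Xx; apply: fP.
have [g eg gf] := fraisse_extend lim (finite_seq s) (KP_cQ_intro lR irr tH) ef.
have /preds_embeddingP[/(qgrp_embeddingP _ QG irr ir)[ig hg] _] := eg.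
by exists g; split=> // x sx; apply: gf; rewrite gE.
Qed.

(** As for exponent p, with the hulls of the cyclic groups in place of these groups. *)
Lemma Q_witnessed : witnessed c P.
Proof.
have [H [R [t [y [s [lR tH [ss ys]]]]]]] := exists_Q_witness c0.
have [QH nH lR' QR] := lR.
apply: witnessed_transfer => k a kc Pa nPa; have /andP[k0 _] := kc.
have [b wb] := exists_level lR' ss ys kc; have [Rb nRb _] := wb.
have a1 : a <> 1 by move=> a1; apply: nPa; rewrite a1; apply: sub1; exact: lazard_sub lP _ _.
have b1 : b <> 1 by move=> b1; apply: nRb; rewrite b1; apply: sub1; exact: lazard_sub lR' _ _.
have exp1 (K : groupType) (x : K) n : Q_powered K -> x <> 1 -> x ^+ n = 1 -> n = 0%N.
  by move=> [tK _] x1; case: n => // n /(tK _ _ (ltn0Sn n)).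
have ab n : a ^+ n = 1 <-> b ^+ n = 1.
  by split=> [/(exp1 _ _ _ QG a1)|/(exp1 _ _ _ QH b1)] ->.
have [f [fm fi _ fR]] := extend_to_roots QG QH nG nH (subgroup_genP _)
  (@line_fun _ _ a b ab) (@line_inj _ _ a b ab).
have dom x : roots (gens [:: a]) x -> roots [set x | exists y, gens [:: (a, b)] (x, y)] x.
  by apply: roots_mono; exact: line_dom.
have mem (K : groupType) (S : nat -> set K) (x : K) n i : Q_powered K ->
    (forall i, (0 < i) -> Q_powered_subgroup (S i)) ->
    (0 < i) -> x ^+ n <> 1 -> S i (x ^+ n) -> S i x.
  move=> QK QS i0 xn; apply: (proj1 (Qpowered_sub_root _ QK (QS i i0) _)).
  by rewrite lt0n; apply: contra_notN xn => /eqP ->.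
have [||| g [hg ig gf]] := @Q_extend H R [:: a] t f lR tH.
- by move=> x x' /dom Dx /dom Dx'; apply: fm.
- by move=> x x' /dom Dx /dom Dx'; apply: fi.
- move=> i x i0 /dom/fR[n n0 xn].
  apply: iff_trans (iff_sym (Qpowered_sub_root x QG (QP i0) n0)) _.
  apply: iff_trans _ (Qpowered_sub_root (f x) QH (QR i i0) n0).
  apply: (line_preds lP lR' Pa nPa Rb nRb ab _ _ i0 xn) => m j j0.
    exact: mem QP j0.
  exact: mem QR j0.
exists H, R, b, g; split=> //.
have ga : roots (gens [:: a]) a by apply: sub_roots; exact: gens_head.
have [n n0 abn] := fR a (dom _ ga).
have <- : f a = b; last exact: gf.
have gan : gens [:: (a, b)] (a ^+ n, b ^+ n).
  by have := subX n (subgroup_genP _) (@gens_head _ (a, b) [::]); rewrite pairX.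
apply: (@Qpowered_expI _ n) => //; apply: divg1_eq; apply: (@line_fun _ _ a b ab).
by have := subM (subgroup_genP _) abn (subV (subgroup_genP _) gan); rewrite -[_ * _]/(_, _) /= mulgV.
Qed.

(** Here [closed] means Q-powered, and the rank of a closed subgroup of the hull is that
    of its trace on the group generated by [sa]. As the Lazard series of [H] induces
    the given one, the extension property applies in the language with predicates. *)
Lemma Q_determines (sa : seq G) : exists sb : seq G,
  {subset sa <= sb} /\
  forall (H : groupType) (R : nat -> set H) (t : seq H) (f : G -> H),
  lazard_Q c R -> (forall x, roots (gens t) x) ->
  (forall x y, roots (gens sb) x -> roots (gens sb) y -> f (x * y) = f x * f y) ->
  (forall x y, roots (gens sb) x -> roots (gens sb) y -> f x = f y -> x = y) ->
  exists g : H -> G, [/\ hom g, injective g & forall x, roots (gens sa) x -> g (f x) = x].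
Proof.
have [H0 [j [t [hj ij jt tH]]]] := exists_gens sa.
have [l pl lH] := exists_polycyclic (nil_inj hj ij nG) tH.
have [r0 [d [r_le _ r_strict]]] := polycyclic_rank pl.
have iso A : Q_powered_subgroup A -> isolated (j @^-1` A).
  move=> QA; split=> [|x n n0 /=]; first exact (hom_preimage hj (proj1 QA)).
  by rewrite (homX hj) => /(Qpowered_sub_root _ QG QA n0).
have [||||||||| b0 fb0 bP] := @lazard_determined G c P lP Q_witnessed
    (@Q_powered_subgroup G) (fun A => roots (subgroup_gen A)) (roots (gens sa))
    _ _ _ _ _ _ _ (fun A => r0 (j @^-1` A)) d _ _.
- by move=> A B; exact: Qpowered_subI.
- exact: QP.
- move=> k s k0 ks; split; first exact (icomm_ker lP k0 ks).
  move=> g n n2 [Pg gs]; have [x [xg _]] := proj2 QG g n n2.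
  have Px : P k x by apply/(Qpowered_sub_root _ QG (QP k0) (ltnW n2)); rewrite xg.
  exists x => //; split=> //; apply: (proj1 QG _ n (ltnW n2)).
  by rewrite -(icomm_exp lP n k0 ks Px) xg.
- by move=> A; apply: roots_Qpowered QG nG (subgroup_genP _).
- by move=> A x Ax; apply: sub_roots; exact: sub_gen.
- move=> A B QB AB x /(roots_mono (gen_min (proj1 QB) AB)).
  exact: Qpowered_sub_roots.
- exact: Qhull.
- by move=> A; exact: r_le.
- move=> A B QA QB AB BX rBA y By; have [n n0] := BX y By.
  rewrite -jt gens_map // => -[h _ hy].
  apply/(Qpowered_sub_root y QG QA n0); rewrite -hy.
  apply: (r_strict _ _ (iso A QA) (iso B QB) _ rBA h); first by move=> z /= /AB.
  by split; [rewrite /= hy; apply/(Qpowered_sub_root y QG QB n0) | exact: lH].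
have /finite_seqP[sb0 b0E] := fb0.
exists (sa ++ sb0); split; first by move=> x xs; rewrite mem_cat xs.
move=> H R u f lR uH fm fi; have [QH nH lR' QR] := lR.
have saY : roots (gens sa) `<=` roots (gens (sa ++ sb0)).
  by apply: roots_mono; apply: gen_mono => x /= xs; rewrite mem_cat xs.
have bY : b0 `<=` roots (gens (sa ++ sb0)).
  by move=> x; rewrite b0E => /= xb; apply: sub_roots; apply: sub_gen; rewrite /= mem_cat xb orbT.
have QY := Qhull (sa ++ sb0); have sY := proj1 QY.
have fP := bP H R f _ lR' sY saY bY fm fi.
apply: (Q_extend lR uH).
- by move=> x y /saY Yx /saY Yy; exact: fm.
- by move=> x y /saY Yx /saY Yy; exact: fi.
move=> i x i0 Xx; apply: fP => // k k0; split.
  exact: (partial_preimage sY fm (lazard_sub lR' k0)).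
move=> g n n2 [Yg Rg]; have [x' Yx' xg] := proj2 QY g n n2 Yg; exists x' => //; split=> //.
by rewrite /preimage /=; apply/(Qpowered_sub_root _ QH (QR k k0) (ltnW n2)); rewrite -(phomX sY fm n Yx') xg.
Qed.

(** Otherwise the embedding of G in a larger product G x H would have a left inverse
    defined and injective on the whole product. *)
Lemma Q_not_fg (s : seq G) : ~ (forall x, roots (gens s) x).
Proof.
move=> sG; have [H [R [t [y [u [lR tH [_ yu]]]]]]] := exists_Q_witness c0.
have [QH nH lR' QR] := lR.
have QGH := Qpowered_prod QG QH; have nGH := nil_prod nG nH.
pose PR i := [set v : G * H | P i v.1 /\ R i v.2].
have lPR : lazard_Q c PR.
  split=> //; first exact: lazard_prod.
  move=> i i0.
  have -> : PR i = (fst @^-1` P i) `&` (snd @^-1` R i) by apply/seteqP; split=> v [].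
  apply: Qpowered_subI => //.
    by apply: Qpowered_preimage => //; exact: QP.
  by apply: Qpowered_preimage => //; exact: QR.
pose v := [seq (x, 1) | x <- s] ++ [seq (1, z) | z <- t] : seq (G * H).
have QV : Q_powered_subgroup (roots (gens v)) := roots_Qpowered QGH nGH (subgroup_genP _).
have vGH x : roots (gens v) x.
  have hl : hom (fun x : G => (x, 1 : H)) by move=> a b; rewrite -[RHS]/(_, _) /= mulg1.
  have hr : hom (fun z : H => (1 : G, z)) by move=> a b; rewrite -[RHS]/(_, _) /= mulg1.
  have Ql := Qpowered_preimage QG QGH hl QV; have Qr := Qpowered_preimage QH QGH hr QV.
  have Gl g : roots (gens v) (g, 1).
    apply: (Qpowered_sub_roots QG Ql); apply: roots_mono (sG g).
    apply: (gen_min (proj1 Ql)) => z zs; apply: sub_roots; apply: sub_gen.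
    by rewrite /v /= mem_cat map_f.
  have Hr z : roots (gens v) (1, z).
    apply: (Qpowered_sub_roots QH Qr); apply: roots_mono (tH z).
    apply: (gen_min (proj1 Qr)) => w ws; apply: sub_roots; apply: sub_gen.
    by rewrite /v /= mem_cat orbC map_f.
  case: x => g z; have := subM (proj1 QV) (Gl g) (Hr z).
  by rewrite -[_ * _]/(_, _) /= mulg1 mul1g.
have [||| g [hg ig gf]] := @Q_extend (G * H)%type PR s v (fun x => (x, 1)) lPR vGH.
- by move=> x x' _ _; rewrite -[RHS]/(_, _) /= mulg1.
- by move=> x x' _ _ [].
- move=> i x i0 _; split=> [Px|[]//]; split=> //.
  exact: (sub1 (lazard_sub lR' i0)).
by have := gf (g (1, icomm y u)) (sG _) => /ig [_ /esym].
Qed.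

End QLimit.

(** * Genericity of the Q-powered limit and of its group reduct *)

Lemma exists_completion (H : groupType) c (t : seq H) :
  nil_class H c -> torsion_free H -> (forall x, gens t x) ->
  exists (K : groupType) (R : nat -> set K) (i : H -> K) (u : seq K),
    [/\ lazard_Q c R, forall x, roots (gens u) x, hom i & injective i].
Proof.
move=> nH tH gH; have [U [i [P [lQ hi ii]]]] := embed_in_Qpowered nH tH gH.
have [K [R [k [lR [hk ik] rk [u uK]]]]] := exists_hull (map i t) lQ.
have fac x : {w | k w = i x}.
  apply: cid; have [w _ wx] : range k (i x).
    by rewrite rk; apply: sub_roots; rewrite gens_map //; exists x.
  by exists w.
exists K, R, (fun x => sval (fac x)), u; split=> //.
- by move=> x y; apply: ik; rewrite hk !(svalP (fac _)) hi.
- by move=> x y /(congr1 k); rewrite !(svalP (fac _)) => /ii.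
Qed.

Section QGeneric.
Variables (c : nat) (G : groupType) (root : nat -> G -> G) (P : nat -> set G).
Hypothesis c0 : (0 < c).
Local Notation GP := (@preds_str qgrp_lang c.+1 (qgrp_str root) (fun i => P i.+1)).
Hypotheses (lim : fraisse_limit (@KP_cQ c) GP) (ir : is_root root) (lQ : lazard_Q c P).

Let QG : Q_powered G. Proof. by case: lQ. Qed.
Let nG : nil_class G c. Proof. by case: lQ. Qed.

Lemma Q_universal (H : groupType) (R : nat -> set H) (t : seq H) :
  lazard_Q c R -> (forall x, roots (gens t) x) -> exists2 g : H -> G, hom g & injective g.
Proof.
move=> lR tH; have [QH _ _ _] := lR; have [r irr] := exists_roots QH.
have [_ univ _ _] := lim; have [g eg] := univ _ (KP_cQ_intro lR irr tH).
have /preds_embeddingP[/(qgrp_embeddingP _ QG irr ir)[ig hg] _] := eg.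
by exists g.
Qed.

(** Any Lazard series of a member C may be chosen to embed C in the limit, since all
    of them induce the same series on the determined part. *)
Theorem Q_generic : generic_for (K_cQ c) (qgrp_str root).
Proof.
have [cG _ age _] := lim.
have K_fg A : K_cQ c A -> finitely_generated A.
  by move=> [H [r [_ _ fgH AH]]]; exact: finitely_generated_iso (iso_sym AH) fgH.
apply: (generic_criterion (QGrp GOne : fun_sym qgrp_lang 0)) => //.
- move=> A [H [r [[QH irr] /nilP nH /(qgrp_fgP QH nH irr)[t tH] [phi [ephi _]]]]].
  have [R lR] := exists_lazard_Q QH nH tH.
  have [g hg ig] := Q_universal lR tH.
  exists (g \o phi); apply: embedding_comp ephi _.
  exact/(qgrp_embeddingP _ QG irr ir).
- apply: age_reduct age => A [H [r [R [QH nH fgH _ AH]]]]; exists H, r; split=> //.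
  exact: (reduct_isomorphic (forget_preds _ _) AH).
- by move=> /(qgrp_fgP QG nG ir)[s]; exact: (Q_not_fg c0 lim ir lQ).
- apply: (@coinfinite_group qgrp_lang forget_roots) => A [H [r [_ _ _ AH]]]; exists H.
  exact: (reduct_isomorphic forget_roots AH).
move=> a /finite_seqP[sa aE]; have [sb [sab D]] := Q_determines c0 lim ir lQ sa.
exists [set` sb]; split; first exact: finite_seq.
  by move=> x; rewrite aE /= => /sab.
move=> C [H [r [[QH irr] /nilP nH /(qgrp_fgP QH nH irr)[t tH] [phi [ephi _]]]]] f ef.
have [R lR] := exists_lazard_Q QH nH tH.
have ef' : emb_on (M := grp_str G) (N := grp_str H) (roots (gens sb)) (phi \o f).
  rewrite -(qgrp_generated _ QG ir nG).
  have [fi ff fr] : emb_on (N := qgrp_str r) (generated (M := qgrp_str root) [set` sb]) (phi \o f).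
    by apply: emb_on_comp ef _; exact: embedding_emb_on.
  by split=> // n F; exact: (ff n (QGrp F)).
have sY := proj1 (roots_Qpowered QG nG (subgroup_genP [set x | x \in sb])).
have [fi fm] := proj1 (grp_emb_on _ sY) ef'.
have [g [hg ig gf]] := D H R t (phi \o f) lR tH fm fi.
exists (g \o phi).
  by apply: embedding_comp ephi _; apply/(qgrp_embeddingP _ QG irr ir).
by move=> x; rewrite aE (qgrp_generated _ QG ir nG); exact: gf.
Qed.

(** An embedding of the group generated by the determining set in a torsion-free group
    extends to an embedding of its hull in a completion of that group. *)
Theorem tf_generic : generic_for (K_ctf c) (grp_str G).
Proof.
have [cG _ age _] := lim.
have K_fg A : K_ctf c A -> finitely_generated A.
  by move=> [H [_ _ fgH AH]]; exact: finitely_generated_iso (iso_sym AH) fgH.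
apply: (generic_criterion (GOne : fun_sym grp_lang 0)) => //.
- move=> A [H [tfH /nilP nH /grp_fgP[t tH] [phi [ephi _]]]].
  have [K [R [i [u [lR uK hi ii]]]]] := exists_completion nH tfH tH.
  have [g hg ig] := Q_universal lR uK.
  exists (g \o i \o phi); apply: embedding_comp ephi _.
  by apply/grp_embeddingP; split=> [|x y]; [exact: inj_comp | rewrite /= hi hg].
- move=> X fgX; have sX := proj1 (grp_closed _) (@sub_closed _ _ X).
  have [H [j [hj ij rj]]] := exists_sub sX.
  have [Z ZE HZ] := embedding_image (proj2 (grp_embeddingP j) (conj ij hj)).
  have ZX : Z = X by apply: substructure_eq; rewrite ZE.
  rewrite ZX in HZ; exists (grp_str H) => //; exists H; split=> //; last exact: iso_refl.
  + exact (torsion_free_inj hj ij (proj1 QG)).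
  + by apply/nilP; exact (nil_inj hj ij nG).
  + exact: finitely_generated_iso (iso_sym HZ) fgX.
- move=> /grp_fgP[s sG]; apply: (Q_not_fg c0 lim ir lQ (s := s)) => x.
  by apply: sub_roots; exact: sG.
- apply: (@coinfinite_group grp_lang (LangMap (fun _ F => F) (fun _ R => R))).
  move=> A [H [_ _ _ AH]]; exists H.
  exact: (reduct_isomorphic (LangMap (L := grp_lang) (L' := grp_lang) (fun _ F => F) (fun _ R => R)) AH).
move=> a /finite_seqP[sa aE]; have [sb [sab D]] := Q_determines c0 lim ir lQ sa.
exists [set` sb]; split; first exact: finite_seq.
  by move=> x; rewrite aE /= => /sab.
move=> C [H [tfH /nilP nH /grp_fgP[t tH] [phi [ephi _]]]] f ef.
have [K [R [i [u [lR uK hi ii]]]]] := exists_completion nH tfH tH.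
have [QK nK _ _] := lR.
have ei : is_embedding (M := grp_str H) (N := grp_str K) i by apply/grp_embeddingP.
have ef' : emb_on (M := grp_str G) (N := grp_str K) (gens sb) (i \o phi \o f).
  rewrite -(grp_generated [set` sb]); apply: emb_on_comp ef _.
  by apply: embedding_emb_on; exact: embedding_comp ephi ei.
have sb_sub : subgroup (gens sb) := subgroup_genP _.
have [fi fm] := proj1 (grp_emb_on _ sb_sub) ef'.
set f2 := i \o phi \o f in fi fm.
pose Gr : set (G * K) := [set v | gens sb v.1 /\ v.2 = f2 v.1].
have sGr : subgroup Gr.
  apply: subgroup_intro => [|[x y] [x' y'] [/= gx ->] [/= gx' ->]|[x y] [/= gx ->]].
  - by split; [exact: (sub1 sb_sub) | rewrite (phom1 sb_sub fm)].
  - by split; [exact: (subM sb_sub) | rewrite /= fm].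
  - by split; [exact: (subV sb_sub) | rewrite /= (phomV sb_sub fm)].
have domE x : gens sb x -> exists y, Gr (x, y) by exists (f2 x).
have [y [/= _ ->]|x [/= gx /esym fx]|F [Fm Fi FR _]] := extend_to_roots QG QK nG nK sGr.
  exact: (phom1 sb_sub fm).
  by apply: fi => //; [exact: (sub1 sb_sub) | rewrite fx (phom1 sb_sub fm)].
have dom x : roots (gens sb) x -> roots [set x | exists y, Gr (x, y)] x.
  exact: (roots_mono domE).
have [||g [hg ig gf]] := D K R u F lR uK.
- by move=> x y /dom Dx /dom Dy; exact: Fm.
- by move=> x y /dom Dx /dom Dy; exact: Fi.
exists (g \o (i \o phi)).
  apply: embedding_comp (embedding_comp ephi ei) _.
  exact/grp_embeddingP.
move=> x; rewrite aE grp_generated => gx.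
have gbx : gens sb x by apply: gen_mono gx => z /= /sab.
rewrite -[RHS](gf x (sub_roots gx)) /=; congr g.
by rewrite (FR x (f2 x)).
Qed.

End QGeneric.

Theorem theorem4p13 (c p : nat) (c_ge1 : 1 <= c) (p_prime : prime p)
    (p_gt_c : c < p)
    (Gp : structure (preds_lang grp_lang c.+1))
    (Gp_limit : fraisse_limit (@KP_cp c p) Gp)
    (GQ : structure (preds_lang qgrp_lang c.+1))
    (GQ_limit : fraisse_limit (@KP_cQ c) GQ) :
  [/\ generic_for (K_cp c p) (reduct (forget_preds grp_lang c.+1) Gp),
      generic_for (K_cQ c) (reduct (forget_preds qgrp_lang c.+1) GQ)
    & generic_for (K_ctf c)
        (reduct forget_roots (reduct (forget_preds qgrp_lang c.+1) GQ))].
Proof.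
have [_ _ agep _] := Gp_limit; have [_ _ ageQ _] := GQ_limit.
have [G [P [GpE eG nG lP]]] := KP_cp_limit agep.
have [H [root [Q [GQE ir lQ]]]] := KP_cQ_limit ageQ.
rewrite GpE in Gp_limit *; rewrite GQE in GQ_limit *.
split.
- exact: (exponent_generic c_ge1 p_gt_c p_prime Gp_limit eG nG lP).
- exact: (Q_generic c_ge1 GQ_limit ir lQ).
- exact: (tf_generic c_ge1 GQ_limit ir lQ).
Qed.
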